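(* Consider the interval-monitored step-stress accelerated life-test model with Weibull lifetimes described in the context, with tuning parameter $\beta\ge 0$ and restriction $\boldsymbol{m}(\boldsymbol{\theta})=\boldsymbol{0}_r$. Assume that all matrices defined below exist finitely (and the indicated inverses exist), and suppose that the true distribution belongs to the model with true parameter $\boldsymbol{\theta}_0\in\Theta$ satisfying $\boldsymbol{m}(\boldsymbol{\theta}_0)=\boldsymbol{0}_r$. Then: (1) the RMDPDE estimating equations $$\boldsymbol{W}^T(\boldsymbol{\theta})\boldsymbol{D}_{\boldsymbol{\pi}(\boldsymbol{\theta})}^{\beta-1}\big(\widehat{\boldsymbol{p}}-\boldsymbol{\pi}(\boldsymbol{\theta})\big)+\boldsymbol{M}(\boldsymbol{\theta})\boldsymbol{\lambda}_\beta=\boldsymbol{0}_3,\qquad \boldsymbol{m}(\boldsymbol{\theta})=\boldsymbol{0}_r,$$ (with $\boldsymbol{\lambda}_\beta\in\mathbb{R}^r$ a vector of Lagrange multipliers) have a consistent sequence of roots $\widetilde{\boldsymbol{\theta}}_\beta$, i.e. $\widetilde{\boldsymbol{\theta}}_\beta\xrightarrow{P}\boldsymbol{\theta}_0$ as $N\to\infty$; (2) $$\sqrt{N}\big(\widetilde{\boldsymbol{\theta}}_\beta-\boldsymbol{\theta}_0\big)\xrightarrow[N\to\infty]{L}\mathcal{N}\big(\boldsymbol{0},\boldsymbol{\Sigma}_\beta(\boldsymbol{\theta}_0)\big),$$ where $\boldsymbol{\Sigma}_\beta(\boldsymbol{\theta}_0)=\boldsymbol{P}_\beta(\boldsymbol{\theta}_0)\boldsymbol{K}_\beta(\boldsymbol{\theta}_0)\boldsymbol{P}_\beta(\boldsymbol{\theta}_0)^T$,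 $\boldsymbol{P}_\beta(\boldsymbol{\theta}_0)=\boldsymbol{J}_\beta(\boldsymbol{\theta}_0)^{-1}-\boldsymbol{Q}_\beta(\boldsymbol{\theta}_0)\boldsymbol{M}^T(\boldsymbol{\theta}_0)\boldsymbol{J}_\beta(\boldsymbol{\theta}_0)^{-1}$, $\boldsymbol{Q}_\beta(\boldsymbol{\theta}_0)=\boldsymbol{J}_\beta(\boldsymbol{\theta}_0)^{-1}\boldsymbol{M}(\boldsymbol{\theta}_0)\big[\boldsymbol{M}^T(\boldsymbol{\theta}_0)\boldsymbol{J}_\beta(\boldsymbol{\theta}_0)^{-1}\boldsymbol{M}(\boldsymbol{\theta}_0)\big]^{-1}$, $\boldsymbol{J}_\beta(\boldsymbol{\theta}_0)=\boldsymbol{W}^T\boldsymbol{D}_{\boldsymbol{\pi}(\boldsymbol{\theta}_0)}^{\beta-1}\boldsymbol{W}$ and $\boldsymbol{K}_\beta(\boldsymbol{\theta}_0)=\boldsymbol{W}^T\big(\boldsymbol{D}_{\boldsymbol{\pi}(\boldsymbol{\theta}_0)}^{2\beta-1}-\boldsymbol{\pi}(\boldsymbol{\theta}_0)^{\beta}\boldsymbol{\pi}(\boldsymbol{\theta}_0)^{\beta T}\big)\boldsymbol{W}$, with $\boldsymbol{W}=\boldsymbol{W}(\boldsymbol{\theta}_0)$.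
   Context: Step-stress model: stress levels $x_1<\dots<x_k$ are applied, the stress being raised from $x_i$ to $x_{i+1}$ at fixed times $\tau_1<\dots<\tau_{k-1}$; the test ends at $\tau_k$ (set $\tau_0=0$). Parameter $\boldsymbol{\theta}=(a_0,a_1,\eta)^T\in\Theta=\mathbb{R}\times\mathbb{R}^{-}\times\mathbb{R}^{+}$; the Weibull scale at stress $x_i$ is $\lambda_i=\exp(a_0+a_1x_i)$ and the shape $\eta$ is common. Under the cumulative exposure model the lifetime $T$ has cdf $F_T(t)=1-\exp\!\big(-((t+h_{i-1})/\lambda_i)^\eta\big)$ for $t\in[\tau_{i-1},\tau_i)$ (and $t\in[\tau_{k-1},\tau_k]$ for $i=k$), where $h_0=0$ and the shifting times $h_{i-1}$ are chosen so that $F_T$ is continuous at each $\tau_{i-1}$. Inspection times $0=t_0<t_1<\dots<t_L=\tau_k$ include all $\tau_i$. For $j=1,\dots,L$, $\pi_j(\boldsymbol{\theta})=F_T(t_j)-F_T(t_{j-1})$ and $\pi_{L+1}(\boldsymbol{\theta})=1-F_T(t_L)$; $\boldsymbol{\pi}(\boldsymbol{\theta})=(\pi_1,\dots,\pi_{L+1})^T$. $N$ units are tested; $n_j$ is the number of failures in $(t_{j-1},t_j]$ ($j\le L$), $n_{L+1}$ the number of survivors, so $(n_1,\dots,n_{L+1})$ is multinomial$(N,\boldsymbol{\pi}(\boldsymbol{\theta}))$; $\widehat{p}_j=n_j/N$, $\widehat{\boldsymbol{p}}=(\widehat p_1,\dots,\widehat p_{L+1})^T$. The density power divergence for $\beta>0$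 is $d_\beta(\widehat{\boldsymbol{p}},\boldsymbol{\pi}(\boldsymbol{\theta}))=\sum_{j=1}^{L+1}\big(\pi_j(\boldsymbol{\theta})^{1+\beta}-(1+\tfrac1\beta)\widehat p_j\pi_j(\boldsymbol{\theta})^\beta+\tfrac1\beta\widehat p_j^{1+\beta}\big)$, and for $\beta=0$ it is the Kullback–Leibler divergence $\sum_j\widehat p_j\log(\widehat p_j/\pi_j(\boldsymbol{\theta}))$. The restriction function $\boldsymbol{m}:\Theta\to\mathbb{R}^r$ ($r\le 3$) is differentiable with $\boldsymbol{M}(\boldsymbol{\theta})=\partial\boldsymbol{m}^T(\boldsymbol{\theta})/\partial\boldsymbol{\theta}$ a continuous $3\times r$ matrix of rank $r$; $\Theta_0=\{\boldsymbol{\theta}:\boldsymbol{m}(\boldsymbol{\theta})=\boldsymbol{0}_r\}$. The restricted minimum DPD estimator (RMDPDE) is $\widetilde{\boldsymbol{\theta}}_\beta=\arg\min_{\boldsymbol{\theta}\in\Theta_0}d_\beta(\widehat{\boldsymbol{p}},\boldsymbol{\pi}(\boldsymbol{\theta}))$. $\boldsymbol{W}(\boldsymbol{\theta})$ is the $(L+1)\times 3$ matrix whose $j$-th row is $\boldsymbol{w}_j^T=\partial\pi_j(\boldsymbol{\theta})/\partial\boldsymbol{\theta}^T$. $\boldsymbol{D}_{\boldsymbol{\pi}(\boldsymbol{\theta})}$ is the diagonal matrix with entries $\pi_j(\boldsymbol{\theta})$, and $\boldsymbol{\pi}(\boldsymbol{\theta})^\beta$ is the vector with entries $\pi_j(\boldsymbol{\theta})^\beta$.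 *)

(* Defs.v *)
From HB Require Import structures.
From mathcomp Require Import all_boot all_order all_algebra.
From mathcomp Require Import all_classical all_reals all_analysis.
Set Implicit Arguments. Unset Strict Implicit. Unset Printing Implicit Defensive.
Import Order.TTheory GRing.Theory Num.Theory.
Import numFieldNormedType.Exports.
Local Open Scope classical_set_scope.
Local Open Scope ring_scope.

Section Model.
Variable R : realType.

Definition i0 : 'I_3 := @Ordinal 3 0 isT.
Definition i1 : 'I_3 := @Ordinal 3 1 isT.
Definition i2 : 'I_3 := @Ordinal 3 2 isT.
Definition a0 (th : 'cV[R]_3) := th i0 ord0.
Definition a1 (th : 'cV[R]_3) := th i1 ord0.
Definition eta (th : 'cV[R]_3) := th i2 ord0.

Definition inTheta (th : 'cV[R]_3) : Prop := a1 th < 0 /\ 0 < eta th.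

Variables (k L : nat) (x tau t : nat -> R).

Definition lam (th : 'cV[R]_3) (i : nat) : R := expR (a0 th + a1 th * x i).

Fixpoint shift (th : 'cV[R]_3) (n : nat) : R :=
  match n with
  | 0 => 0
  | n'.+1 => lam th n'.+2 * (tau n'.+1 + shift th n') / lam th n'.+1 - tau n'.+1
  end.

Definition stage (s : R) : nat := head k [seq i <- iota 1 k.-1 | s < tau i].

Definition cdfT (th : 'cV[R]_3) (s : R) : R :=
  let i := stage s in
  1 - expR (- powR ((s + shift th i.-1) / lam th i) (eta th)).

Definition piv (th : 'cV[R]_3) : 'cV[R]_(L.+1) :=
  \col_(j < L.+1) (if (j < L)%N then cdfT th (t j.+1) - cdfT th (t j)
                   else 1 - cdfT th (t L)).

Definition Wmat (th : 'cV[R]_3) : 'M[R]_(L.+1, 3) :=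
  \matrix_(j, c) ('D_(delta_mx c ord0) (fun th' : 'cV[R]_3 => piv th' j ord0) th).

Definition Dpow (th : 'cV[R]_3) (a : R) : 'M[R]_(L.+1) :=
  diag_mx (\row_j powR (piv th j ord0) a).

Definition pipow (th : 'cV[R]_3) (a : R) : 'cV[R]_(L.+1) :=
  \col_j powR (piv th j ord0) a.

End Model.

Definition Mmat (R : realType) (r : nat) (m : 'cV[R]_3 -> 'cV[R]_r)
  (th : 'cV[R]_3) : 'M[R]_(3, r) :=
  \matrix_(c, i) ('D_(delta_mx c ord0) (fun th' : 'cV[R]_3 => m th' i ord0) th).

Definition counts_ok (L N : nat) (n : {ffun 'I_L.+1 -> 'I_N.+1}) : bool :=
  (\sum_j (n j : nat))%N == N.

Definition multinom_pmf (R : realType) (L N : nat) (p : 'cV[R]_(L.+1))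
  (n : {ffun 'I_L.+1 -> 'I_N.+1}) : R :=
  (N`!)%:R / (\prod_j ((n j : nat)`!)%:R) * \prod_j p j ord0 ^+ (n j : nat).

Definition phat (R : realType) (L N : nat) (n : {ffun 'I_L.+1 -> 'I_N.+1})
  : 'cV[R]_(L.+1) := \col_j ((n j : nat)%:R / N%:R).

Definition Prob (R : realType) (L N : nat) (p : 'cV[R]_(L.+1))
  (E : 'cV[R]_(L.+1) -> Prop) : R :=
  \sum_(n : {ffun 'I_L.+1 -> 'I_N.+1} | counts_ok n && `[< E (phat R n) >])
     multinom_pmf p n.

Definition Expect (R : realType) (L N : nat) (p : 'cV[R]_(L.+1))
  (g : 'cV[R]_(L.+1) -> R) : R :=
  \sum_(n : {ffun 'I_L.+1 -> 'I_N.+1} | counts_ok n) multinom_pmf p n * g (phat R n).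

Definition std_gauss_expect (R : realType) (A : 'M[R]_3) (f : 'cV[R]_3 -> R)
  : \bar R :=
  (\int[lebesgue_measure]_(g0 in [set: R])
    \int[lebesgue_measure]_(g1 in [set: R])
     \int[lebesgue_measure]_(g2 in [set: R])
      (f (A *m \col_(c < 3) (if c == i0 then g0 else if c == i1 then g1 else g2))
        * normal_pdf 0 1 g0 * normal_pdf 0 1 g1 * normal_pdf 0 1 g2)%:E)%E.

Definition cvg_law_normal (R : realType) (L : nat) (p : 'cV[R]_(L.+1))
  (Y : nat -> 'cV[R]_(L.+1) -> 'cV[R]_3) (Sigma : 'M[R]_3) : Prop :=
  exists A : 'M[R]_3, A *m A^T = Sigma /\
    forall f : 'cV[R]_3 -> R, continuous f -> (exists B : R, forall y, `|f y| <= B) ->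
      ((fun N => (Expect N p (fun ph => f (Y N ph)))%:E) @ \oo
         --> std_gauss_expect A f)%E.

Definition cvg_prob (R : realType) (L : nat) (p : 'cV[R]_(L.+1))
  (T : nat -> 'cV[R]_(L.+1) -> 'cV[R]_3) (th0 : 'cV[R]_3) : Prop :=
  forall eps : R, 0 < eps ->
    (fun N => Prob N p (fun ph => eps < `|T N ph - th0|)) @ \oo --> (0 : R).

(* Main.v *)
(** The estimator is a fixed function T of the frequency vector p, defined for p
    near pi(th0).  Since m is only C^1, the implicit function theorem does not
    apply to the system formed by the estimating equations.  Instead T(p) is
    obtained from the minimisers of d_beta(p, pi(th)) + K |m(th)|^2 over a ball of
    radius C |p - pi(th0)|: a local quadratic lower bound for the divergence and
    injectivity of W keep them in the interior, so the gradient vanishes there, and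
    letting K grow yields a root with a multiplier.  Applying P to the estimating
    equation, with P M = 0 and P J = 1 - Q M^T, gives
    T(p) - th0 = P W^T D^(beta-1) (p - pi(th0)) + o(|p - pi(th0)|).
    Consistency is then Chebyshev's inequality, and asymptotic normality follows
    from the central limit theorem for multinomial frequencies.  The latter is
    proved for trigonometric polynomials by replacing one multinomial step at a
    time by its Gaussian counterpart, and extended to bounded continuous functions
    by approximation on large cubes. *)
Require Import Defs.
From HB Require Import structures.
From mathcomp Require Import all_boot all_order all_algebra.
From mathcomp Require Import all_classical all_reals all_analysis.
From mathcomp Require Import measurable_realfun.
From mathcomp Require Import ring lra zify.
Set Implicit Arguments. Unset Strict Implicit. Unset Printing Implicit Defensive.
Import Order.TTheory GRing.Theory Num.Theory.
Import numFieldNormedType.Exports.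
Local Open Scope classical_set_scope.
Local Open Scope ring_scope.

(** The exponent [beta] enters only through a weight [w] with a primitive [l] of [w] and a primitive
    [E] of [s * w s], so the logarithmic case [beta = 0] and the power case share one argument. The
    matrix M occurs in the equations and is merely continuous, so the system itself is never
    differentiated. A rate takes the place of a derivative: the search ball has radius proportional
    to |p - pi(th0)|, hence the root and its multiplier are both O(|p - pi(th0)|), and every error
    term of the expansion is this O times a factor that tends to 0. Multinomial expectations are
    finite sums, so an estimator obtained by choice raises no question of measurability. When r > 0
    the matrix Sigma is singular, since Sigma M = 0, and the limit law has no density on the whole
    space. It is treated as the image of a standard Gaussian vector under a square root [A] of
    Sigma, and on cosines only [A *m A^T] enters. The multinomial expectation is used twice: as the
    law of the data, and as the Bernstein operator that produces trigonometric approximations with a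
    bound valid on the whole space. *)

Section Walk.
Variables (R : realType) (L : nat).
Implicit Types (p v : 'cV[R]_L.+1) (G F : 'cV[R]_L.+1 -> R).

(** Mean of [G] at the end of a random walk from [v] whose [N] independent steps are unit vectors
    drawn with law [p]. Conditioning on the first step gives a recursion suited to induction, unlike
    the closed multinomial sum. *)
Fixpoint walk p (N : nat) G v : R :=
  if N is N'.+1 then \sum_j p j ord0 * walk p N' G (v + delta_mx j ord0) else G v.

Definition countv N (n : {ffun 'I_L.+1 -> 'I_N.+1}) : 'cV[R]_L.+1 :=
  \col_j (n j : nat)%:R.

Let inc N (j : 'I_L.+1) (n : {ffun 'I_L.+1 -> 'I_N.+1}) :
  {ffun 'I_L.+1 -> 'I_N.+2} := [ffun i => inord (n i + (i == j))%N].
Let dec N (j : 'I_L.+1) (n : {ffun 'I_L.+1 -> 'I_N.+2}) :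
  {ffun 'I_L.+1 -> 'I_N.+1} := [ffun i => inord (n i - (i == j))%N].

Let incE N j (n : {ffun 'I_L.+1 -> 'I_N.+1}) i :
  inc j n i = (n i + (i == j))%N :> nat.
Proof.
rewrite ffunE inordK //; have := ltn_ord (n i); case: eqP => _ /=; lia.
Qed.

Let counts_ok_inc N j (n : {ffun 'I_L.+1 -> 'I_N.+1}) :
  counts_ok (inc j n) = counts_ok n.
Proof.
rewrite /counts_ok (eq_bigr (fun i => (n i + (i == j))%N)); last first.
  by move=> i _; rewrite incE.
rewrite big_split /= [X in (_ + X)%N](bigD1 j) //= eqxx.
by rewrite [X in (_ + (_ + X))%N]big1 ?addn0 ?addn1 ?eqSS // => i /negbTE ->.
Qed.

(** The total N + 1 matters here: since cell [j] holds at least one unit, every other cell holds at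
    most N, so no count is altered by [inord] in the smaller range. *)
Let decK N j (n : {ffun 'I_L.+1 -> 'I_N.+2}) :
  counts_ok n && (0 < n j)%N -> inc j (dec j n) = n.
Proof.
case/andP=> /eqP nok nj; apply/ffunP => i; apply: val_inj.
rewrite /= incE ffunE inordK.
  by case: eqP => [->|_] /=; lia.
case: eqP => [->|/eqP ij] /=; first by have := ltn_ord (n j); lia.
move: nok; rewrite (bigD1 j) //= (bigD1 i) //=.
set s := (\sum_(_ < _ | _) _)%N => h.
move: h => /eqP; move: (n j : nat) (n i : nat) nj => a b; lia.
Qed.

Let incK N j (n : {ffun 'I_L.+1 -> 'I_N.+1}) : dec j (inc j n) = n.
Proof.
by apply/ffunP => i; apply: val_inj; rewrite /= ffunE incE addnK inord_val.
Qed.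

Let countv_inc N j (n : {ffun 'I_L.+1 -> 'I_N.+1}) :
  countv (inc j n) = countv n + delta_mx j ord0.
Proof.
apply/colP => i; rewrite !mxE incE natrD andbT; by case: eqP.
Qed.

(** Size biasing: given the counts, a fixed unit lies in cell [j] with probability n_j / (N + 1),
    and removing it leaves a multinomial sample of size N. *)
Let pmf_inc N p j (n : {ffun 'I_L.+1 -> 'I_N.+1}) :
  multinom_pmf p (inc j n) * (inc j n j)%:R / N.+1%:R =
  p j ord0 * multinom_pmf p n.
Proof.
rewrite /multinom_pmf !incE eqxx addn1.
rewrite (bigD1 j) //= [in LHS](bigD1 j (P := xpredT)) //= incE eqxx addn1.
rewrite [in RHS](bigD1 j) //= [in RHS](bigD1 j (P := xpredT)) //=.
rewrite (eq_bigr (fun i => ((n i)`!)%:R)); last first.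
  by move=> i /negbTE ij; rewrite incE ij addn0.
rewrite [X in _ * (_ * X) * _](eq_bigr (fun i => p i ord0 ^+ n i)); last first.
  by move=> i /negbTE ij; rewrite incE ij addn0.
rewrite !factS !natrM exprS.
set A := \prod_(i < _ | _) _; set B := \prod_(i < _ | _) _.
have A0 : A != 0 by apply/prodf_neq0 => i _; rewrite pnatr_eq0 -lt0n fact_gt0.
have f0 : (n j)`!%:R != 0 :> R by rewrite pnatr_eq0 -lt0n fact_gt0.
have h1 : (n j).+1%:R != 0 :> R by rewrite pnatr_eq0.
have h2 : N.+1%:R != 0 :> R by rewrite pnatr_eq0.
by field; rewrite f0 A0 !nat1r h1 h2.
Qed.

Lemma multinomial_step N p G :
  \sum_(n : {ffun 'I_L.+1 -> 'I_N.+2} | counts_ok n)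
     multinom_pmf p n * G (countv n) =
  \sum_j p j ord0 * \sum_(n : {ffun 'I_L.+1 -> 'I_N.+1} | counts_ok n)
     multinom_pmf p n * G (countv n + delta_mx j ord0).
Proof.
(* Inserts 1 as the sum over [j] of n_j / (N + 1). Terms with n_j = 0 then vanish, and [inc j] is a
   bijection onto the remaining ones. *)
transitivity (\sum_(n : {ffun 'I_L.+1 -> 'I_N.+2} | counts_ok n) \sum_j
     multinom_pmf p n * (n j)%:R / N.+1%:R * G (countv n)).
  apply: eq_bigr => n /eqP nok; rewrite -mulr_suml -mulr_suml -mulr_sumr.
  by rewrite -natr_sum nok mulfK // pnatr_eq0.
rewrite exchange_big /=; apply: eq_bigr => j _; rewrite mulr_sumr.
rewrite (bigID (fun n : {ffun 'I_L.+1 -> 'I_N.+2} => (0 < n j)%N)) /=.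
rewrite [X in _ + X]big1 ?addr0; last first.
  by move=> n /andP[_]; rewrite -eqn0Ngt => /eqP ->; rewrite mulr0 !mul0r.
rewrite (reindex_onto (inc j) (dec j)); last by move=> n; exact: decK.
apply: eq_big => [n|n _].
  by rewrite incK eqxx counts_ok_inc incE eqxx addn1 !andbT.
by rewrite pmf_inc countv_inc mulrA.
Qed.

Lemma multinomial_walk N p G v :
  \sum_(n : {ffun 'I_L.+1 -> 'I_N.+1} | counts_ok n)
     multinom_pmf p n * G (v + countv n) = walk p N G v.
Proof.
elim: N v => [|N IH] v /=.
  rewrite (big_pred1 [ffun=> ord0]) => [|n].
    rewrite /multinom_pmf !big1 => [|i _|i _]; rewrite ?ffunE ?expr0 //.
    rewrite divr1 !mul1r; congr (G _); apply/colP => i.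
    by rewrite !mxE ffunE /= addr0.
  have -> : n = [ffun=> ord0].
    by apply/ffunP => i; apply: val_inj; rewrite ffunE /=; case: (n i) => -[].
  rewrite /= eqxx; apply/eqP; rewrite big1 // => i _; by rewrite ffunE.
rewrite (multinomial_step N p (fun c => G (v + c))).
apply: eq_bigr => j _; congr (_ * _); rewrite -IH.
by apply: eq_bigr => n _; rewrite -addrA [X in G (_ + X)]addrC.
Qed.

Lemma Expect_walk N p (g : 'cV[R]_L.+1 -> R) :
  Expect N p g = walk p N (fun c => g (N%:R^-1 *: c)) 0.
Proof.
rewrite -multinomial_walk /Expect; apply: eq_bigr => n _; congr (_ * g _).
by apply/colP => i; rewrite !mxE add0r mulrC.
Qed.

Definition simplex p := (forall j, 0 <= p j ord0) /\ \sum_j p j ord0 = 1.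

Lemma pmf_ge0 N p (n : {ffun 'I_L.+1 -> 'I_N.+1}) :
  simplex p -> 0 <= multinom_pmf p n.
Proof.
move=> [p0 _]; rewrite /multinom_pmf mulr_ge0 ?divr_ge0 ?prodr_ge0 //.
by move=> j _; rewrite exprn_ge0.
Qed.

Lemma walk_cst N p (a : R) v : simplex p -> walk p N (cst a) v = a.
Proof.
move=> [_ p1]; elim: N v => //= N IH v.
under eq_bigr do rewrite IH.
by rewrite -mulr_suml p1 mul1r.
Qed.

Lemma ExpectD N p (f g : 'cV[R]_L.+1 -> R) :
  Expect N p (fun y => f y + g y) = Expect N p f + Expect N p g.
Proof. by rewrite -big_split; apply: eq_bigr => n _; rewrite mulrDr. Qed.

Lemma ExpectZ N p (a : R) (f : 'cV[R]_L.+1 -> R) :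
  Expect N p (fun y => a * f y) = a * Expect N p f.
Proof. by rewrite mulr_sumr; apply: eq_bigr => n _; rewrite mulrCA. Qed.

Lemma Expect_cst N p (a : R) : simplex p -> Expect N p (cst a) = a.
Proof. by move=> sp; rewrite Expect_walk -[RHS](walk_cst N a 0 sp). Qed.

Lemma ler_Expect N p (f g : 'cV[R]_L.+1 -> R) : simplex p ->
  (forall y, f y <= g y) -> Expect N p f <= Expect N p g.
Proof.
by move=> sp fg; apply: ler_sum => n _; apply: ler_wpM2l => //; exact: pmf_ge0.
Qed.

Lemma ler_norm_ExpectB N p (f g h : 'cV[R]_L.+1 -> R) : simplex p ->
  (forall y, `|f y - g y| <= h y) ->
  `|Expect N p f - Expect N p g| <= Expect N p h.
Proof.
move=> sp fgh.
have -> : Expect N p f - Expect N p g = Expect N p (fun y => f y + -1 * g y).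
  by rewrite ExpectD ExpectZ mulN1r.
rewrite ler_norml -[- Expect N p h]mulN1r -ExpectZ.
by apply/andP; split; apply: ler_Expect => // y; have := fgh y;
  rewrite ler_norml => /andP[]; lra.
Qed.

Lemma ProbE N p (E : 'cV[R]_L.+1 -> Prop) :
  Prob N p E = Expect N p (fun y => (`[< E y >])%:R).
Proof.
rewrite /Prob /Expect big_mkcondr; apply: eq_bigr => n _.
by case: (asbool _); rewrite ?mulr1 ?mulr0.
Qed.

Lemma ler_Prob N p (E F : 'cV[R]_L.+1 -> Prop) : simplex p ->
  (forall y, E y -> F y) -> Prob N p E <= Prob N p F.
Proof.
move=> sp EF; rewrite !ProbE; apply: ler_Expect => // y.
by rewrite ler_nat; case: asboolP => // /EF Fy; rewrite asboolT.
Qed.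

Lemma Prob_ge0 N p (E : 'cV[R]_L.+1 -> Prop) : simplex p -> 0 <= Prob N p E.
Proof. by move=> sp; rewrite /Prob sumr_ge0 // => n _; exact: pmf_ge0. Qed.

Lemma ProbC N p (E : 'cV[R]_L.+1 -> Prop) : simplex p ->
  Prob N p E = 1 - Prob N p (fun y => ~ E y).
Proof.
move=> sp; rewrite !ProbE -[X in X - _](Expect_cst N 1 sp).
set F := fun _ => _; set F' := fun _ => _.
transitivity (Expect N p (fun y => cst 1 y + -1 * F' y)); last first.
  by rewrite ExpectD ExpectZ mulN1r.
apply: eq_bigr => n _; congr (_ * _); rewrite /F /F' asbool_neg /cst.
by case: (asbool (E (phat R n))) => /=; ring.
Qed.

(** Squared mean plus N times the variance of one step. The general starting point [v] lets the
    induction hypothesis apply after the first step. *)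
Lemma walk_sqr N p (a : 'cV[R]_L.+1) (b : R) v : simplex p ->
  walk p N (fun c => ((a^T *m c) ord0 ord0 + b) ^+ 2) v =
  ((a^T *m v) ord0 ord0 + b + N%:R * (a^T *m p) ord0 ord0) ^+ 2 +
  N%:R * ((\sum_j p j ord0 * a j ord0 ^+ 2) - ((a^T *m p) ord0 ord0) ^+ 2).
Proof.
move=> [_ p1]; elim: N v => [|N IH] v /=; first by rewrite !mul0r !addr0.
under eq_bigr do rewrite IH.
set s := \sum_j p j ord0 * a j ord0 ^+ 2.
have mE : (a^T *m p) ord0 ord0 = \sum_j p j ord0 * a j ord0.
  by rewrite mxE; apply: eq_bigr => j _; rewrite mxE mulrC.
set m := (a^T *m p) ord0 ord0 in mE *.
set u := (a^T *m v) ord0 ord0.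
have aj j : (a^T *m (v + delta_mx j ord0)) ord0 ord0 = u + a j ord0.
  rewrite mulmxDr mxE; congr (_ + _); rewrite mxE (bigD1 j) //= !mxE !eqxx mulr1.
  by rewrite big1 ?addr0 // => i /negbTE ij; rewrite !mxE ij mulr0.
transitivity (\sum_j (p j ord0 * ((u + b + N%:R * m) ^+ 2 + N%:R * (s - m ^+ 2))
   + 2 * (u + b + N%:R * m) * (p j ord0 * a j ord0) + p j ord0 * a j ord0 ^+ 2)).
  by apply: eq_bigr => j _; rewrite aj; ring.
rewrite !big_split /= -mulr_suml -mulr_sumr -mE -/s p1 -natr1; ring.
Qed.

Lemma Expect_sqr N p (a : 'cV[R]_L.+1) : simplex p ->
  Expect N.+1 p (fun y => ((a^T *m (y - p)) ord0 ord0) ^+ 2) <=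
  (\sum_j p j ord0 * a j ord0 ^+ 2) / N.+1%:R.
Proof.
move=> sp; rewrite Expect_walk.
set m := (a^T *m p) ord0 ord0.
have -> : (fun c => ((a^T *m (N.+1%:R^-1 *: c - p)) ord0 ord0) ^+ 2) =
   (fun c => (((N.+1%:R^-1 *: a)^T *m c) ord0 ord0 - m) ^+ 2).
  apply/funext => c; congr (_ ^+ 2).
  rewrite mulmxBr mxE [X in _ + X]mxE -/m; congr (_ - _).
  by rewrite -scalemxAr [in RHS]linearZ /= -scalemxAl.
rewrite walk_sqr //.
have -> : ((N.+1%:R^-1 *: a)^T *m p) ord0 ord0 = N.+1%:R^-1 * m.
  by rewrite linearZ /= -scalemxAl mxE.
rewrite mulmx0 mxE (eq_bigr (fun j => N.+1%:R^-1 ^+ 2 * (p j ord0 * a j ord0 ^+ 2))).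
  rewrite -mulr_sumr; set s := \sum_j _.
  have : 0 <= N.+1%:R^-1 :> R by rewrite invr_ge0.
  have : N.+1%:R * N.+1%:R^-1 = 1 :> R by rewrite divff ?pnatr_eq0.
  move: (N.+1%:R : R) (N.+1%:R^-1 : R) => x y xy y0.
  have -> : (0 - m + x * (y * m)) = 0 by rewrite mulrA xy; ring.
  have -> : x * (y ^+ 2 * s - (y * m) ^+ 2) = x * y * y * (s - m ^+ 2) by ring.
  rewrite xy mul1r expr0n add0r mulrC.
  by apply: ler_wpM2r => //; rewrite gerBl sqr_ge0.
by move=> j _; rewrite !mxE; ring.
Qed.

Lemma simplex_le1 p j : simplex p -> p j ord0 <= 1.
Proof.
move=> [p0 <-]; rewrite (bigD1 j) //= lerDl; exact: sumr_ge0.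
Qed.

(** Coordinate [j] contributes at most p_j / (N + 1), and the p_j sum to 1, so the bound does not
    depend on the number of cells. *)
Lemma sumsqr_phat N p : simplex p ->
  Expect N.+1 p (fun y => \sum_j (y j ord0 - p j ord0) ^+ 2) <= N.+1%:R^-1.
Proof.
move=> sp.
have -> : Expect N.+1 p (fun y => \sum_j (y j ord0 - p j ord0) ^+ 2) =
  \sum_j Expect N.+1 p (fun y => (((delta_mx j ord0 : 'cV[R]_L.+1)^T *m (y - p)) ord0 ord0) ^+ 2).
  rewrite exchange_big; apply: eq_bigr => n _; rewrite mulr_sumr.
  apply: eq_bigr => j _; congr (_ * _ ^+ 2).
  by rewrite trmx_delta -rowE !mxE.
apply: (@le_trans _ _ (\sum_j p j ord0 / N.+1%:R)); last first.
  by rewrite -mulr_suml sp.2 mul1r.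
apply: ler_sum => j _; apply: (le_trans (Expect_sqr _ _ sp)).
apply: ler_wpM2r; first by rewrite invr_ge0.
rewrite (bigD1 j) //= mxE !eqxx expr1n mulr1 big1 ?addr0 // => i /negbTE ij.
by rewrite mxE ij expr0n mulr0.
Qed.

Lemma Chebyshev_phat N p (eps : R) : simplex p -> 0 < eps ->
  Prob N.+1 p (fun y => eps <= `|y - p|) <= (eps ^+ 2 * N.+1%:R)^-1.
Proof.
move=> sp e0; rewrite invfM ler_pdivlMl ?exprn_gt0 //.
apply: le_trans (sumsqr_phat N sp); rewrite ProbE -ExpectZ.
apply: ler_Expect => // y; case: asboolP => [ey|_]; last first.
  by rewrite mulr0 sumr_ge0 // => j _; rewrite sqr_ge0.
(* The norm is the largest absolute entry, so it is attained at one coordinate, whose square is one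
   term of the sum. *)
have /(@mx_norm_neq0 R)[[j k]] : mx_norm (y - p) != 0.
  by rewrite gt_eqF // (lt_le_trans e0 ey).
rewrite -[mx_norm _]/(`|y - p|) => /= yj; rewrite yj in ey.
rewrite mulr1 (bigD1 j) //= ler_wpDr ?sumr_ge0 // => [i _|]; first exact: sqr_ge0.
move: ey; rewrite (ord1 k) !mxE => ey.
by rewrite -(real_normK (num_real (y j ord0 - _))) ler_pXn2r // nnegrE ltW.
Qed.

(* Each step replaces [cos] by [w cos], so the errors add up to at most [N eps]. *)
Lemma walk_cos N p (b : 'cV[R]_L.+1) (w eps phi : R) v : simplex p ->
  0 <= w <= 1 ->
  (forall psi, `|\sum_j p j ord0 * cos (psi + b j ord0)
                 - w * cos (psi + (b^T *m p) ord0 ord0)| <= eps) ->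
  `|walk p N (fun c => cos ((b^T *m c) ord0 ord0 + phi)) v
    - w ^+ N * cos ((b^T *m v) ord0 ord0 + phi + N%:R * (b^T *m p) ord0 ord0)|
    <= N%:R * eps.
Proof.
move=> [p0 p1] /andP[w0 w1] step; elim: N v => [|N IH] v.
  by rewrite /= !mul0r addr0 mul1r subrr normr0.
rewrite /=; set m := (b^T *m p) ord0 ord0 in step IH *.
set u := (b^T *m v) ord0 ord0.
have bj j : (b^T *m (v + delta_mx j ord0)) ord0 ord0 = u + b j ord0.
  rewrite mulmxDr mxE; congr (_ + _); rewrite mxE (bigD1 j) //= !mxE !eqxx mulr1.
  by rewrite big1 ?addr0 // => i /negbTE ij; rewrite !mxE ij mulr0.
pose psi := u + phi + N%:R * m.
rewrite -(subrKA (w ^+ N * \sum_j p j ord0 * cos (psi + b j ord0))).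
rewrite -natr1 [leRHS]mulrDl mul1r; apply: (le_trans (ler_normD _ _)).
apply: lerD.
  rewrite mulr_sumr -sumrB; apply: (le_trans (ler_norm_sum _ _ _)).
  apply: (@le_trans _ _ (\sum_j p j ord0 * (N%:R * eps))); last first.
    by rewrite -mulr_suml p1 mul1r.
  apply: ler_sum => j _; rewrite mulrCA -mulrBr normrM ger0_norm //.
  apply: ler_wpM2l => //; have := IH (v + delta_mx j ord0); rewrite bj.
  by rewrite (_ : u + b j ord0 + phi + N%:R * m = psi + b j ord0) // /psi; ring.
rewrite exprSr -mulrA -mulrBr normrM ger0_norm ?exprn_ge0 //.
rewrite (_ : u + phi + (N%:R + 1) * m = psi + m); last by rewrite /psi; ring.
apply: le_trans (step psi); apply: ler_piMl => //; exact: exprn_ile1.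
Qed.

End Walk.

(** * Means under the standard normal law in one dimension *)

Section GaussMean.
Variable R : realType.
Local Notation mu := (@lebesgue_measure R).
Local Notation phi := (@normal_pdf R 0 1).
Implicit Types (h f g : R -> R) (B : R).

Definition gmean h : R := (\int[mu]_(z in [set: R]) (h z * phi z))%R.

Lemma integrable_bounded_pdf h B : continuous h -> (forall z, `|h z| <= B) ->
  mu.-integrable [set: R] (EFin \o (fun z => h z * phi z)).
Proof.
move=> ch hB.
apply: (@le_integrable _ _ _ mu _ measurableT _ (fun z => (B * phi z)%:E)).
- apply/measurable_EFinP; apply: measurable_funM.
    exact: continuous_measurable_fun.
  exact: measurable_normal_pdf.
- move=> z _; rewrite /= lee_fin !normrM; apply: ler_wpM2r => //.
  exact: le_trans (hB z) (ler_norm _).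
- have := integrable_normal_pdf (0 : R) (1 : R).
  by move/(integrableZl measurableT B).
Qed.

Lemma gmeanD h g B1 B2 : continuous h -> (forall z, `|h z| <= B1) ->
  continuous g -> (forall z, `|g z| <= B2) ->
  gmean (fun z => h z + g z) = gmean h + gmean g.
Proof.
move=> ch hB cg gB; rewrite /gmean -RintegralD //.
- by apply: eq_Rintegral => z _; rewrite mulrDl.
- exact: (integrable_bounded_pdf ch hB).
- exact: (integrable_bounded_pdf cg gB).
Qed.

Lemma gmeanZ h B a : continuous h -> (forall z, `|h z| <= B) ->
  gmean (fun z => a * h z) = a * gmean h.
Proof.
move=> ch hB; rewrite /gmean -RintegralZl //.
  by apply: eq_Rintegral => z _; rewrite mulrA.
exact: (integrable_bounded_pdf ch hB).
Qed.

Lemma gmean_cst a : gmean (fun=> a) = a.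
Proof.
rewrite /gmean RintegralZl //; last exact: integrable_normal_pdf.
by rewrite /Rintegral integral_normal_pdf mulr1.
Qed.

Lemma gmean_bound h B : continuous h -> (forall z, `|h z| <= B) ->
  `|gmean h| <= B.
Proof.
move=> ch hB; rewrite /gmean.
have ih := integrable_bounded_pdf ch hB.
apply: (le_trans (le_normr_Rintegral measurableT ih)).
rewrite -[leRHS]gmean_cst; apply: le_Rintegral => //.
- have := integrable_norm ih.
  by apply: eq_integrable => //= z _; rewrite abse_EFin.
- apply: (@integrable_bounded_pdf (fun=> B) `|B|) => // x; exact: cst_continuous.
- move=> z _; rewrite normrM (ger0_norm (normal_pdf_ge0 _ _ _)).
  by apply: ler_wpM2r => //; exact: normal_pdf_ge0.
Qed.

Lemma gmean_cvg (h_ : nat -> R -> R) h B :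
  (forall n, continuous (h_ n)) -> (forall n z, `|h_ n z| <= B) ->
  (forall z, h_ n z @[n --> \oo] --> h z) ->
  gmean (h_ n) @[n --> \oo] --> gmean h.
Proof.
move=> ch hB hh; apply: fine_cvg.
have ih n := integrable_bounded_pdf (ch n) (hB n).
have mh n : measurable_fun setT (fun z => (h_ n z * phi z)%:E).
  exact: measurable_int (ih n).
have cvgh z : setT z -> (h_ n z * phi z)%:E @[n --> \oo] --> (h z * phi z)%:E.
  move=> _; apply: cvg_EFin; first exact: nearW.
  by apply: cvgMl; exact: hh.
have iB : mu.-integrable setT (fun z => (B * phi z)%:E).
  apply: (@integrable_bounded_pdf (fun=> B) `|B|) => //; exact: cst_continuous.
have dom n z : setT z -> (`|(h_ n z * phi z)%:E| <= (B * phi z)%:E)%E.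
  move=> _; rewrite abse_EFin lee_fin normrM (ger0_norm (normal_pdf_ge0 _ _ _)).
  by apply: ler_wpM2r => //; exact: normal_pdf_ge0.
have [ihl _ cv] : [/\ mu.-integrable setT (fun z => (h z * phi z)%:E),
    (\int[mu]_(x in setT) `|(h_ n x * phi x)%:E - (h x * phi x)%:E| @[n --> \oo]
      --> 0)%E &
    (\int[mu]_(x in setT) (h_ n x * phi x)%:E @[n --> \oo]
      --> \int[mu]_(x in setT) (h x * phi x)%:E)%E].
  apply: (dominated_convergence _ _ _ _ iB) => //.
  - exact: emeasurable_fun_cvg mh cvgh.
  - exact: aeW.
  - by apply: aeW => z n Tz; exact: dom.
rewrite /Rintegral fineK; first exact: cv.
exact: integral_fune_fin_num.
Qed.

End GaussMean.

Section GaussContinuity.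
Variable R : realType.
Local Notation mu := (@lebesgue_measure R).
Local Notation phi := (@normal_pdf R 0 1).
Implicit Types (h f g : R -> R) (B : R).

(** Along a sequence converging to [a] this is dominated convergence, and sequential continuity
    suffices on the real line. *)
Lemma gmean_continuous (f : R -> R -> R) B : (forall x, continuous (f x)) ->
  (forall z, continuous (f ^~ z)) -> (forall x z, `|f x z| <= B) ->
  continuous (fun x => gmean (f x)).
Proof.
move=> cf cf' fB a; apply/(@cvg_nbhsP _ R^o) => u ua.
apply: (@gmean_cvg _ _ _ B) => // z.
exact: (cvg_comp _ (f ^~ z) ua (cf' z a)).
Qed.

Lemma EFin_gmean h B c : continuous h -> (forall z, `|h z| <= B) ->
  (\int[mu]_(z in [set: R]) (h z * phi z * c)%:E)%E = (gmean h * c)%:E.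
Proof.
move=> ch hB; have ih := integrable_bounded_pdf ch hB.
under eq_integral do rewrite EFinM.
rewrite integralZr // /gmean /Rintegral EFinM fineK //.
exact: integral_fune_fin_num.
Qed.

Lemma is_derive_cos_affine (v psi z : R) :
  is_derive z 1 (fun z => cos (v * z + psi)) (- (v * sin (v * z + psi))).
Proof.
have -> : (fun z => cos (v * z + psi)) = cos \o (v \*: id + cst psi) by [].
apply: is_derive_eq; rewrite /= /GRing.scale /=; ring.
Qed.

Lemma is_derive_sin_affine (v psi z : R) :
  is_derive z 1 (fun z => sin (v * z + psi)) (v * cos (v * z + psi)).
Proof.
have -> : (fun z => sin (v * z + psi)) = sin \o (v \*: id + cst psi) by [].
apply: is_derive_eq; rewrite /= /GRing.scale /=; ring.
Qed.

Lemma is_derive_normal_pdf (z : R) : is_derive z (1 : R) phi (- (z * phi z)).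
Proof.
rewrite normal_pdfE ?oner_neq0 //.
have -> : (fun x => normal_peak 1 * normal_fun 0 1 x) =
  normal_peak 1 \*: (expR \o ((- 2^-1) \*: (@GRing.exp R ^~ 2%N))).
  apply/funext => x; rewrite /normal_fun subr0 expr1n /=.
  by rewrite /GRing.scale /= mulrC mulNr mulNr [_ ^+ 2 / _]mulrC mulrC.
apply: is_derive_eq; rewrite /= /GRing.scale /= /normal_fun subr0 expr1n.
rewrite (_ : - z ^+ 2 / 2 = - 2^-1 * z ^+ 2); last by field.
by field.
Qed.

(** Integrals over growing symmetric intervals are boundary differences of [F], which vanish in the
    limit; by dominated convergence they also tend to the full integral. *)
Lemma integral_derive_eq0 (F f : R -> R) : (forall z : R, is_derive z (1 : R) F (f z)) ->
  continuous f -> mu.-integrable setT (EFin \o f) ->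
  F n%:R @[n --> \oo] --> 0 -> F (- n%:R) @[n --> \oo] --> 0 ->
  \int[mu]_z f z = 0.
Proof.
move=> dF cf fi F0 F0'.
have cF : continuous F.
  by move=> z; apply/differentiable_continuous/derivable1_diffP; apply: ex_derive.
have FTC n : \int[mu]_(z in `[- n.+1%:R, n.+1%:R]) f z = F n.+1%:R - F (- n.+1%:R).
  rewrite /Rintegral (@continuous_FTC2 _ f F) ?fineB ?fine_fin //.
  - by rewrite gtrN // ltr0Sn.
  - exact: continuous_subspaceT.
  - split => [z _||]; first exact: ex_derive.
    + exact/cvg_at_right_filter/cF.
    + exact/cvg_at_left_filter/cF.
  - by move=> z _; rewrite derive1E; apply: derive_val.
have l1 : \int[mu]_(z in `[- n.+1%:R, n.+1%:R]) f z @[n --> \oo] --> 0.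
  rewrite [X in X @ _ --> _](_ : _ = fun n => F n.+1%:R - F (- n.+1%:R)).
    rewrite -[X in _ --> X](subrr 0); apply: cvgB.
      by have := F0; rewrite -cvg_shiftS.
    by have := F0'; rewrite -cvg_shiftS.
  by apply/funext => n; exact: FTC.
have l2 : \int[mu]_(z in `[- n.+1%:R, n.+1%:R]) f z @[n --> \oo] -->
    \int[mu]_z f z.
  apply: fine_cvg; rewrite /Rintegral fineK; last exact: integral_fune_fin_num.
  rewrite [X in X @ _ --> _](_ : _ = fun n => (\int[mu]_z
    (f z * \1_(`[- n.+1%:R, n.+1%:R]%classic) z)%:E)%E); last first.
    apply/funext => n; rewrite integral_mkcond; apply: eq_integral => z _.
    by rewrite patchE indicE; case: ifP => _ /=; rewrite ?mulr1 ?mulr0.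
  have mf : measurable_fun setT f by exact: continuous_measurable_fun.
  have [_ _] : [/\ mu.-integrable setT (EFin \o f),
    (\int[mu]_(z in setT) `|(f z * \1_(`[- n.+1%:R, n.+1%:R]%classic) z)%:E
         - (f z)%:E| @[n --> \oo] --> 0)%E &
    (\int[mu]_(z in setT) (f z * \1_(`[- n.+1%:R, n.+1%:R]%classic) z)%:E
        @[n --> \oo] --> \int[mu]_(z in setT) (f z)%:E)%E].
    apply: (@dominated_convergence _ _ _ mu setT measurableT _ _
      (fun z => (`|f z|)%:E)).
    - move=> n; apply/measurable_EFinP/measurable_funM => //.
    - exact/measurable_EFinP.
    - apply: aeW => z _; apply: cvg_EFin; first exact: nearW.
      apply: cvg_near_cst; near=> n.
      rewrite /= indicE mem_set ?mulr1 //= in_itv /= -ler_norml.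
      apply: (@le_trans _ _ n%:R); last by rewrite ler_nat.
      by near: n; exact: nbhs_infty_ger.
    - exact: integrable_norm.
    - apply: aeW => z n _ /=; rewrite lee_fin normrM ler_piMr //.
      by rewrite indicE; case: (_ \in _); rewrite /= ?normr1 ?normr0.
  by [].
exact: (cvg_unique _ l2 l1).
Unshelve. all: by end_near. Qed.

End GaussContinuity.

(** * The characteristic function of the normal law *)

Section GaussCharacteristic.
Variable R : realType.
Local Notation mu := (@lebesgue_measure R).
Local Notation phi := (@normal_pdf R 0 1).
Implicit Types (h f g : R -> R) (B : R).

(** A wider Gaussian absorbs the linear factor: exp(z^2/4) >= 1 + z^2/4 >= |z|, the last step being
    (|z| - 2)^2 >= 0. Both the integrability of [|z| * phi z] and the decay of [phi] come from
    this. *)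
Lemma abs_pdf_le : exists C : R, forall z : R,
  `|z| * phi z <= C * normal_pdf 0 (Num.sqrt 2) z.
Proof.
have s0 : Num.sqrt 2 != 0 :> R by rewrite sqrtr_eq0 -ltNge.
exists (2 * normal_peak 1 / normal_peak (Num.sqrt 2)) => z.
rewrite !normal_pdfE ?oner_neq0 // [leRHS]mulrA divfK; last first.
  by rewrite gt_eqF // normal_peak_gt0.
rewrite mulrCA [2 * _]mulrC -mulrA; apply: ler_wpM2l; first exact: normal_peak_ge0.
rewrite /normal_fun subr0 expr1n sqr_sqrtr //.
have -> : - z ^+ 2 / (1 *+ 2) = z ^+ 2 / 4 * -1 + - z ^+ 2 / (2 *+ 2) by field.
rewrite expRD mulrA; apply: ler_wpM2r; first exact: expR_ge0.
rewrite mulrN1 expRN ler_pdivrMr ?expR_gt0 //.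
have h : 1 + z ^+ 2 / 4 <= expR (z ^+ 2 / 4) by exact: expR_ge1Dx.
have := sqr_ge0 (`|z| - 2); rewrite sqrrB real_normK ?num_real // => h2.
nra.
Qed.

Lemma integrable_abs_pdf : mu.-integrable setT (fun z => (`|z| * phi z)%:E).
Proof.
have [C hC] := abs_pdf_le.
apply: (@le_integrable _ _ _ mu _ measurableT _
  (fun z => (C * normal_pdf 0 (Num.sqrt 2) z)%:E)).
- apply/measurable_EFinP; apply: measurable_funM; last exact: measurable_normal_pdf.
  exact: continuous_measurable_fun (@norm_continuous _ R^o).
- move=> z _; rewrite /= lee_fin.
  apply: le_trans (ler_norm _); rewrite ger0_norm //.
  by rewrite mulr_ge0 // normal_pdf_ge0.
- have := integrable_normal_pdf (0 : R) (Num.sqrt 2 : R).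
  by move/(integrableZl measurableT C).
Qed.

Lemma pdf_cvg0 : phi n%:R @[n --> \oo] --> 0.
Proof.
have [C hC] := abs_pdf_le.
have s0 : Num.sqrt 2 != 0 :> R by rewrite sqrtr_eq0 -ltNge.
have C0 : 0 <= C.
  have := le_trans _ (hC 0); rewrite normr0 mul0r => /(_ 0 (lexx _)).
  rewrite pmulr_lge0 // normal_pdfE // mulr_gt0 ?expR_gt0 //.
  exact: normal_peak_gt0.
pose D := C * normal_peak (Num.sqrt 2).
rewrite -cvg_shiftS.
apply: (@squeeze_cvgr _ _ _ _ (fun=> 0) (fun n => D * n.+1%:R^-1)).
- apply: nearW => n; rewrite normal_pdf_ge0 /= ler_pdivlMr // mulrC.
  have := hC n.+1%:R; rewrite normr_nat => /le_trans; apply.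
  by apply: ler_wpM2l => //; exact: normal_pdf_ub.
- exact: cvg_cst.
- rewrite -[X in _ --> X](mulr0 D); apply: cvgMr; exact: cvg_harmonic.
Qed.

Lemma phiN z : phi (- z) = phi z.
Proof. by rewrite normal_pdfE ?oner_neq0 // /normal_fun !subr0 sqrrN. Qed.

(** Gaussian integration by parts: sin(v z + psi) phi(z) vanishes at both ends, so its derivative
    integrates to 0, and phi' = - z phi. *)
Lemma integral_sin_pdf (v psi : R) :
  \int[mu]_z (- z * sin (v * z + psi) * phi z) =
  - v * gmean (fun z => cos (v * z + psi)).
Proof.
have ccos : continuous (fun z => cos (v * z + psi)).
  move=> z; apply/differentiable_continuous/derivable1_diffP.
  exact: (@ex_derive _ _ _ _ _ _ _ (is_derive_cos_affine v psi z)).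
have csin : continuous (fun z => sin (v * z + psi)).
  move=> z; apply/differentiable_continuous/derivable1_diffP.
  exact: (@ex_derive _ _ _ _ _ _ _ (is_derive_sin_affine v psi z)).
have cphi : continuous phi by exact: (@continuous_normal_pdf R 0 1 (oner_neq0 R)).
have icos : mu.-integrable setT (EFin \o (fun z => cos (v * z + psi) * phi z)).
  by apply: (@integrable_bounded_pdf _ _ 1) => // z; exact: cos_max.
have czs : continuous (fun z : R => - z * sin (v * z + psi) * phi z).
  move=> z; apply: cvgM; last exact: cphi.
  by apply: cvgM; [apply: cvgN; exact: cvg_id|exact: csin].
have izs : mu.-integrable setT
    (EFin \o (fun z : R => - z * sin (v * z + psi) * phi z)).
  apply: (@le_integrable _ _ _ mu _ measurableT _ (fun z => (`|z| * phi z)%:E)).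
  - by apply/measurable_EFinP; exact: (continuous_measurable_fun czs).
  - move=> z _; rewrite /= lee_fin !normrM normrN normr_id.
    by rewrite ler_wpM2r // ler_piMr // sin_max.
  - exact: integrable_abs_pdf.
have H : \int[mu]_z (v * (cos (v * z + psi) * phi z)
                     + - z * sin (v * z + psi) * phi z) = 0.
  apply: (@integral_derive_eq0 _ (fun z => sin (v * z + psi) * phi z)).
  - move=> z.
    have d1 := is_derive_sin_affine v psi z.
    have d2 := is_derive_normal_pdf z.
    have d3 := is_deriveM d1 d2.
    by apply: is_derive_eq; rewrite /= /GRing.scale /=; ring.
  - move=> z; apply: cvgD; last exact: czs.
    by apply: cvgMr; apply: cvgM; [exact: ccos|exact: cphi].
  - have := integrableD measurableT (integrableZl measurableT v icos) izs.
    exact.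
  - apply: norm_cvg0; apply: (@squeeze_cvgr _ _ _ _ (fun=> 0) (fun n => phi n%:R)).
    + apply: nearW => n; rewrite normr_ge0 normrM /= (ger0_norm (normal_pdf_ge0 _ _ _)).
      by rewrite ler_piMl ?normal_pdf_ge0 ?sin_max.
    + exact: cvg_cst.
    + exact: pdf_cvg0.
  - apply: norm_cvg0; apply: (@squeeze_cvgr _ _ _ _ (fun=> 0) (fun n => phi n%:R)).
    + apply: nearW => n; rewrite normr_ge0 normrM phiN /= (ger0_norm (normal_pdf_ge0 _ _ _)).
      by rewrite ler_piMl ?normal_pdf_ge0 ?sin_max.
    + exact: cvg_cst.
    + exact: pdf_cvg0.
move: H; rewrite RintegralD //; last first.
  exact: (integrableZl measurableT v icos).
by rewrite RintegralZl // => /eqP; rewrite addrC addr_eq0 => /eqP ->; rewrite mulNr.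
Qed.

(* As a function of [v], the left-hand side satisfies [G' = - v G]. *)
Lemma gmean_cos (v psi : R) :
  gmean (fun z => cos (v * z + psi)) = expR (- v ^+ 2 / 2) * cos psi.
Proof.
pose G (v : R) := gmean (fun z => cos (v * z + psi)).
have dv (z u : R) : is_derive u 1 (fun u => cos (u * z + psi) * phi z)
    (- z * sin (u * z + psi) * phi z).
  have d : is_derive u 1 (fun u => cos (u * z + psi)) (- (z * sin (z * u + psi))).
    have -> : (fun u => cos (u * z + psi)) = fun u => cos (z * u + psi).
      by apply/funext => w; rewrite mulrC.
    exact: is_derive_cos_affine.
  have -> : (fun u => cos (u * z + psi) * phi z) =
    phi z \*: (fun u => cos (u * z + psi)) by apply/funext => w /=; rewrite mulrC.
  by apply: is_derive_eq; rewrite /GRing.scale /= [u * z]mulrC; ring.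
have dG (u : R) : is_derive u 1 G (- u * G u).
  pose f (u z : R) := cos (u * z + psi) * phi z.
  have p1 z : partial1of2 f u z = - z * sin (u * z + psi) * phi z.
    by rewrite partial1of2E; apply: derive_val.
  have p1' w z : partial1of2 f w z = - z * sin (w * z + psi) * phi z.
    by rewrite partial1of2E; apply: derive_val.
  have Iu : `]u - 1, u + 1[%classic u by rewrite /= in_itv /= ltrBlDr ltrDl ltr01.
  have If x : `]u - 1, u + 1[%classic x -> mu.-integrable setT (EFin \o f x).
    move=> _; apply: (@integrable_bounded_pdf _ _ 1) => // z; last exact: cos_max.
    apply/differentiable_continuous/derivable1_diffP.
    exact: (@ex_derive _ _ _ _ _ _ _ (is_derive_cos_affine x psi z)).
  have Df x z : `]u - 1, u + 1[%classic x -> setT z -> derivable (f ^~ z) x 1.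
    by move=> _ _; exact: (@ex_derive _ _ _ _ _ _ _ (dv z x)).
  have G0 z : 0 <= `|z| * phi z by rewrite mulr_ge0 // normal_pdf_ge0.
  have Bf x z : `]u - 1, u + 1[%classic x -> setT z ->
      `|partial1of2 f x z| <= `|z| * phi z.
    move=> _ _; rewrite p1' !normrM normrN (ger0_norm (normal_pdf_ge0 _ _ _)).
    by rewrite ler_wpM2r ?normal_pdf_ge0 // ler_piMr // sin_max.
  have dd := derivable_under_integral measurableT Iu If Df G0 integrable_abs_pdf Bf.
  have de := differentiation_under_integral measurableT Iu If Df G0 integrable_abs_pdf Bf.
  apply: DeriveDef => //; rewrite -derive1E de -integral_sin_pdf.
  by apply: eq_Rintegral => z _; rewrite p1.
(* The integrating factor turns the differential equation into a vanishing derivative; the constant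
   is then read off at 0. *)
have : G v * expR (v ^+ 2 / 2) = G 0 * expR (0 ^+ 2 / 2).
  apply: (@is_derive_0_is_cst _ (fun u => G u * expR (u ^+ 2 / 2))) => u.
  have d2 : is_derive u 1 (fun u => expR (u ^+ 2 / 2)) (u * expR (u ^+ 2 / 2)).
    have -> : (fun u : R => expR (u ^+ 2 / 2)) =
        expR \o (2^-1 \*: (@GRing.exp R ^~ 2%N)).
      by apply/funext => w /=; rewrite mulrC.
    by apply: is_derive_eq; rewrite /= /GRing.scale /= [2^-1 * u ^+ 2]mulrC; field.
  have d1 := dG u; have d3 := is_deriveM d1 d2.
  by apply: is_derive_eq; rewrite /= /GRing.scale /=; ring.
rewrite expr0n mul0r expR0 mulr1 => h.
rewrite -/(G v) -(@mulfK _ (expR (v ^+ 2 / 2)) _ (G v)) ?gt_eqF ?expR_gt0 //.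
rewrite h mulNr expRN mulrC; congr (_ * _).
rewrite /G -[RHS]gmean_cst; congr gmean; apply/funext => z.
by rewrite mul0r add0r.
Qed.

End GaussCharacteristic.

Lemma cvg_sumr (K : numFieldType) (V : normedModType K) (T : Type)
  (F : set_system T) {FF : Filter F} (I : Type) (s : seq I) (P : pred I)
  (f : I -> T -> V) (l : I -> V) : (forall i, P i -> f i x @[x --> F] --> l i) ->
  \sum_(i <- s | P i) f i x @[x --> F] --> \sum_(i <- s | P i) l i.
Proof. exact: (cvg_big (@add_continuous V)). Qed.

(** * Iterated Gaussian means in three dimensions *)

Section GaussMean3.
Variable R : realType.
Implicit Types (A : 'M[R]_3) (B : R).

Definition gmean3 A (f : 'cV[R]_3 -> R) : R :=
  gmean (fun g0 => gmean (fun g1 => gmean (fun g2 =>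
    f (g0 *: col i0 A + g1 *: col i1 A + g2 *: col i2 A)))).

Let affine_continuous (f : 'cV[R]_3 -> R) (a b : 'cV[R]_3) : 
  continuous f -> continuous (fun z : R => f (a + z *: b)).
Proof.
move=> cf z; apply: continuous_comp; last exact: cf.
by apply: cvgD; [exact: cvg_cst|apply: cvgZr_tmp; exact: cvg_id].
Qed.

Section Inner.
Variables (A : 'M[R]_3) (f : 'cV[R]_3 -> R) (B : R).
Hypotheses (cf : continuous f) (fB : forall y, `|f y| <= B).

Let inner g0 g1 g2 := f (g0 *: col i0 A + g1 *: col i1 A + g2 *: col i2 A).

Let cinner2 g0 g1 : continuous (inner g0 g1).
Proof. exact: affine_continuous. Qed.

Let cinner1 g0 g2 : continuous (fun g1 => inner g0 g1 g2).
Proof.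
have -> : (fun g1 => inner g0 g1 g2) =
    fun z : R => f ((g0 *: col i0 A + g2 *: col i2 A) + z *: col i1 A).
  by apply/funext => z; rewrite /inner addrAC.
exact: affine_continuous.
Qed.

Let cinner0 g1 g2 : continuous (fun g0 => inner g0 g1 g2).
Proof.
have -> : (fun g0 => inner g0 g1 g2) =
    fun z : R => f ((g1 *: col i1 A + g2 *: col i2 A) + z *: col i0 A).
  by apply/funext => z; rewrite /inner -addrA addrC.
exact: affine_continuous.
Qed.

Let mid_bound g0 g1 : `|gmean (inner g0 g1)| <= B.
Proof. by apply: gmean_bound => // z; exact: fB. Qed.

Let cmid1 g0 : continuous (fun g1 => gmean (inner g0 g1)).
Proof. by apply: (@gmean_continuous _ _ B) => // x z; exact: fB. Qed.

Let cmid0 g1 : continuous (fun g0 => gmean (inner g0 g1)).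
Proof.
by apply: (@gmean_continuous _ (fun g0 => inner g0 g1) B) => // x z; exact: fB.
Qed.

Let outer_bound g0 : `|gmean (fun g1 => gmean (inner g0 g1))| <= B.
Proof. exact: gmean_bound. Qed.

Let couter : continuous (fun g0 => gmean (fun g1 => gmean (inner g0 g1))).
Proof. exact: (@gmean_continuous _ _ B). Qed.

(** Linearity, dominated convergence and the passage to extended real integrals are applied one
    variable at a time; each application asks for continuity and the common bound [B] of the
    partially integrated function. *)
Lemma gmean3_levels :
  [/\ forall g0 g1, continuous (inner g0 g1) /\ forall g2, `|inner g0 g1 g2| <= B,
      forall g0, continuous (fun g1 => gmean (inner g0 g1)) /\
        forall g1, `|gmean (inner g0 g1)| <= B,
      continuous (fun g0 => gmean (fun g1 => gmean (inner g0 g1))) &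
      forall g0, `|gmean (fun g1 => gmean (inner g0 g1))| <= B].
Proof.
split=> [g0 g1|g0||]; [split|split| |].
- exact: cinner2.
- by move=> z; exact: fB.
- exact: cmid1.
- exact: mid_bound.
- exact: couter.
- exact: outer_bound.
Qed.

Lemma std_gauss_expectE : std_gauss_expect A f = (gmean3 A f)%:E.
Proof.
have [l1 l2 l3 l4] := gmean3_levels.
rewrite /std_gauss_expect.
transitivity (\int[lebesgue_measure]_(g0 in [set: R])
  \int[lebesgue_measure]_(g1 in [set: R])
  (gmean (inner g0 g1) * normal_pdf 0 1 g1 * normal_pdf 0 1 g0)%:E)%E.
  apply: eq_integral => g0 _; apply: eq_integral => g1 _.
  rewrite -mulrA -(EFin_gmean _ (l1 g0 g1).1 (l1 g0 g1).2).
  apply: eq_integral => g2 _.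
  have -> : A *m \col_(c < 3) (if c == i0 then g0 else if c == i1 then g1 else g2)
      = g0 *: col i0 A + g1 *: col i1 A + g2 *: col i2 A.
    apply/colP => i; rewrite !mxE !big_ord_recl big_ord0 addr0 !mxE /=.
    rewrite (_ : lift ord0 ord0 = i1); last exact: val_inj.
    rewrite (_ : lift ord0 (lift ord0 ord0) = i2); last exact: val_inj.
    rewrite (_ : ord0 = i0); last exact: val_inj.
    by rewrite addrA mulrC [A i i1 * _]mulrC [A i i2 * _]mulrC.
  rewrite -/(inner g0 g1 g2); congr (_%:E).
  move: (normal_pdf 0 1 g0) (normal_pdf 0 1 g1) (normal_pdf 0 1 g2) => x y z.
  by rewrite mulrAC -!mulrA; congr (_ * _); rewrite mulrCA [x * y]mulrC.
rewrite -[gmean3 A f]mulr1 /gmean3.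
transitivity (\int[lebesgue_measure]_(g0 in [set: R])
  (gmean (fun g1 => gmean (inner g0 g1)) * normal_pdf 0 1 g0 * 1)%:E)%E.
  apply: eq_integral => g0 _; by rewrite mulr1 -(EFin_gmean _ (l2 g0).1 (l2 g0).2).
by rewrite (EFin_gmean _ l3 l4).
Qed.


End Inner.

Lemma gmean3_cvg A (f : 'cV[R]_3 -> R) B (f_ : nat -> 'cV[R]_3 -> R) :
  (forall n, continuous (f_ n)) ->
  (forall n y, `|f_ n y| <= B) -> (forall y, f_ n y @[n --> \oo] --> f y) ->
  gmean3 A (f_ n) @[n --> \oo] --> gmean3 A f.
Proof.
move=> cf fB ff.
have lev n := gmean3_levels A (cf n) (fB n).
apply: (@gmean_cvg _ _ _ B) => [n|n z|g0]; first by case: (lev n).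
  by case: (lev n) => _ _ _; exact.
apply: (@gmean_cvg _ _ _ B) => [n|n z|g1]; first by case: (lev n) => _ /(_ g0)[].
  by case: (lev n) => _ /(_ g0)[].
apply: (@gmean_cvg _ _ _ B) => [n|n z|g2]; first by case: (lev n) => /(_ g0 g1)[].
  by case: (lev n) => /(_ g0 g1)[].
exact: ff.
Qed.

Lemma gmean3D A (f g : 'cV[R]_3 -> R) B1 B2 : continuous f -> (forall y, `|f y| <= B1) ->
  continuous g -> (forall y, `|g y| <= B2) ->
  gmean3 A (fun y => f y + g y) = gmean3 A f + gmean3 A g.
Proof.
move=> cf fB cg gB.
have [l1 l2 l3 l4] := gmean3_levels A cf fB.
have [k1 k2 k3 k4] := gmean3_levels A cg gB.
rewrite /gmean3 -(gmeanD l3 l4 k3 k4); congr gmean; apply/funext => g0.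
have [? ?] := l2 g0; have [? ?] := k2 g0.
rewrite -(@gmeanD _ _ _ B1 B2) //; congr gmean; apply/funext => g1.
have [? ?] := l1 g0 g1; have [? ?] := k1 g0 g1.
by rewrite -(@gmeanD _ _ _ B1 B2).
Qed.

Lemma gmean3Z A (f : 'cV[R]_3 -> R) B r : continuous f -> (forall y, `|f y| <= B) ->
  gmean3 A (fun y => r * f y) = r * gmean3 A f.
Proof.
move=> cf fB; have [l1 l2 l3 l4] := gmean3_levels A cf fB.
rewrite /gmean3 -(gmeanZ r l3 l4); congr gmean; apply/funext => g0.
have [? ?] := l2 g0; rewrite -(@gmeanZ _ _ B) //; congr gmean; apply/funext => g1.
by have [? ?] := l1 g0 g1; rewrite -(@gmeanZ _ _ B).
Qed.

(** With v = A^T u the argument is v_0 g_0 + v_1 g_1 + v_2 g_2 + psi. Integrating one variable while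
    the others sit in the phase multiplies by exp(- v_i^2 / 2), and the exponents add up to |v|^2 in
    the Euclidean sense. *)
Lemma gmean3_cos A (u : 'cV[R]_3) (psi : R) :
  gmean3 A (fun y => cos ((u^T *m y) ord0 ord0 + psi)) =
  expR (- (u^T *m (A *m A^T) *m u) ord0 ord0 / 2) * cos psi.
Proof.
have [v vE] : exists v, v = A^T *m u by exists (A^T *m u).
have uA i : (u^T *m col i A) ord0 ord0 = v i ord0.
  by rewrite vE !mxE; apply: eq_bigr => j _; rewrite !mxE mulrC.
have -> : (u^T *m (A *m A^T) *m u) ord0 ord0 =
    v i0 ord0 ^+ 2 + v i1 ord0 ^+ 2 + v i2 ord0 ^+ 2.
  rewrite (_ : _ *m u = v^T *m v); last by rewrite vE trmx_mul trmxK !mulmxA.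
  rewrite mxE !big_ord_recl big_ord0 addr0 !mxE -!expr2 addrA.
  rewrite (_ : lift ord0 ord0 = i1); last exact: val_inj.
  rewrite (_ : lift ord0 (lift ord0 ord0) = i2); last exact: val_inj.
  by rewrite (_ : v ord0 ord0 = v i0 ord0) //; congr (v _ _); exact: val_inj.
have e (g0 g1 g2 : R) :
    (u^T *m (g0 *: col i0 A + g1 *: col i1 A + g2 *: col i2 A)) ord0 ord0 + psi =
    v i2 ord0 * g2 + (v i1 ord0 * g1 + (v i0 ord0 * g0 + psi)).
  have dZ (s : R) i : (u^T *m (s *: col i A)) ord0 ord0 = v i ord0 * s.
    by rewrite -scalemxAr mxE uA mulrC.
  have dD (x y : 'M[R]_1) : (x + y) ord0 ord0 = x ord0 ord0 + y ord0 ord0.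
    by rewrite mxE.
  by rewrite !mulmxDr !dD !dZ; ring.
rewrite /gmean3.
have -> : (fun g0 => gmean (fun g1 => gmean (fun g2 => cos
   ((u^T *m (g0 *: col i0 A + g1 *: col i1 A + g2 *: col i2 A)) ord0 ord0 + psi))))
  = fun g0 => (expR (- v i2 ord0 ^+ 2 / 2) * expR (- v i1 ord0 ^+ 2 / 2)) *
              cos (v i0 ord0 * g0 + psi).
  apply/funext => g0; rewrite -mulrA -gmean_cos -(@gmeanZ _ _ 1).
  - congr gmean; apply/funext => g1; rewrite -gmean_cos.
    by congr gmean; apply/funext => g2; rewrite e.
  - move=> z; apply/differentiable_continuous/derivable1_diffP.
    exact: (@ex_derive _ _ _ _ _ _ _ (is_derive_cos_affine (v i1 ord0) _ z)).
  - by move=> z; exact: cos_max.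
rewrite (@gmeanZ _ _ 1); last 2 first.
- move=> z; apply/differentiable_continuous/derivable1_diffP.
  exact: (@ex_derive _ _ _ _ _ _ _ (is_derive_cos_affine (v i0 ord0) _ z)).
- by move=> z; exact: cos_max.
rewrite gmean_cos mulrA -!expRD; congr (expR _ * _); ring.
Qed.

End GaussMean3.

(** * Real trigonometric polynomials in three variables *)

Section TrigPoly.
Variable R : realType.

(** The free phase [psi] makes sines available, so everything stays real. Induction on the
    constructors reduces a linear limit statement to single cosines. *)
Inductive trigpoly : ('cV[R]_3 -> R) -> Prop :=
| TrigCos (u : 'cV[R]_3) (psi : R) :
    trigpoly (fun y => cos ((u^T *m y) ord0 ord0 + psi))
| TrigAdd f g of trigpoly f & trigpoly g : trigpoly (fun y => f y + g y)
| TrigScale (r : R) f of trigpoly f : trigpoly (fun y => r * f y).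

Lemma trigpoly_cst (r : R) : trigpoly (fun=> r).
Proof.
have -> : (fun _ : 'cV[R]_3 => r) =
    fun y => r * cos (((0 : 'cV[R]_3)^T *m y) ord0 ord0 + 0).
  by apply/funext => y; rewrite trmx0 mul0mx mxE addr0 cos0 mulr1.
exact: (TrigScale r (TrigCos 0 0)).
Qed.

(** Product-to-sum formula for two cosines. As a consequence a polynomial in trigonometric
    coordinates is again trigonometric. *)
Lemma trigpolyM f g : trigpoly f -> trigpoly g -> trigpoly (fun y => f y * g y).
Proof.
move=> tf tg; elim: tf => [u psi|f1 f2 _ IH1 _ IH2|r f1 _ IH]; last 2 first.
- by under eq_fun do rewrite mulrDl; exact: TrigAdd.
- by under eq_fun do rewrite -mulrA; exact: TrigScale.
elim: tg => [v chi|g1 g2 _ IH1 _ IH2|r g1 _ IH]; last 2 first.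
- by under eq_fun do rewrite mulrDr; exact: TrigAdd.
- by under eq_fun do rewrite mulrCA; exact: TrigScale.
rewrite (_ : (fun y => _) = fun y =>
  2^-1 * (cos (((u + v)^T *m y) ord0 ord0 + (psi + chi)) +
          cos (((u - v)^T *m y) ord0 ord0 + (psi - chi)))).
  exact: (TrigScale _ (TrigAdd (TrigCos _ _) (TrigCos _ _))).
apply/funext => y; rewrite !linearD /= !linearN /= !mulmxDl !mulNmx !mxE.
set a := \sum_j _; set b := \sum_j _.
have -> : a + b + (psi + chi) = (a + psi) + (b + chi) by ring.
have -> : a - b + (psi - chi) = (a + psi) - (b + chi) by ring.
by move: (a + psi) (b + chi) => p q; rewrite cosD cosB; field.
Qed.

Lemma trigpoly_exp f n : trigpoly f -> trigpoly (fun y => f y ^+ n).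
Proof.
move=> tf; elim: n => [|n IH]; first exact: trigpoly_cst.
by under eq_fun do rewrite exprS; exact: trigpolyM.
Qed.

Lemma trigpoly_prod (I : Type) (s : seq I) (P : pred I) (F : I -> 'cV[R]_3 -> R) :
  (forall i, trigpoly (F i)) -> trigpoly (fun y => \prod_(i <- s | P i) F i y).
Proof.
move=> tF; elim: s => [|i s IH].
  by under eq_fun do rewrite big_nil; exact: trigpoly_cst.
under eq_fun do rewrite big_cons.
by case: (P i) => //; exact: trigpolyM.
Qed.

Lemma trigpoly_sum (I : Type) (s : seq I) (P : pred I) (F : I -> 'cV[R]_3 -> R) :
  (forall i, trigpoly (F i)) -> trigpoly (fun y => \sum_(i <- s | P i) F i y).
Proof.
move=> tF; elim: s => [|i s IH].
  by under eq_fun do rewrite big_nil; exact: trigpoly_cst.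
under eq_fun do rewrite big_cons.
by case: (P i) => //; exact: TrigAdd.
Qed.

Lemma trigpoly_bounded f : trigpoly f -> exists B : R, forall y, `|f y| <= B.
Proof.
elim=> [u psi|f1 f2 _ [B1 h1] _ [B2 h2]|r f1 _ [B h]].
- by exists 1 => y; exact: cos_max.
- by exists (B1 + B2) => y; apply: (le_trans (ler_normD _ _)); exact: lerD.
- by exists (`|r| * B) => y; rewrite normrM ler_wpM2l.
Qed.

Lemma dot_continuous n (u : 'cV[R]_n) : 
  continuous (fun y : 'cV[R]_n => (u^T *m y) ord0 ord0).
Proof.
move=> y; have -> : (fun y : 'cV[R]_n => (u^T *m y) ord0 ord0) =
    fun y => \sum_j u j ord0 * y j ord0.
  by apply/funext => z; rewrite mxE; apply: eq_bigr => j _; rewrite mxE.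
apply: (@cvg_sumr _ _ _ (nbhs y)) => j _; apply: cvgMr; exact: coord_continuous.
Qed.

Lemma trigpoly_continuous f : trigpoly f -> continuous f.
Proof.
elim=> [u psi|f1 f2 _ h1 _ h2|r f1 _ h] y.
- apply: continuous_comp; last exact: continuous_cos.
  by apply: (@cvgD _ _ _ (nbhs y)); [exact: dot_continuous|exact: cvg_cst].
- by apply: (@cvgD _ _ _ (nbhs y)); [exact: h1|exact: h2].
- by apply: (@cvgMr _ _ (nbhs y)); exact: h.
Qed.

End TrigPoly.

(** * The central limit theorem *)

Section MatrixTopology.
Variable R : realType.

Lemma mx_coord_le m n (x : 'M[R]_(m, n)) i j : `|x i j| <= `|x|.
Proof.
by rewrite -[`|x|]/(mx_norm x) mx_normrE (le_bigmax _ (fun ij => `|x ij.1 ij.2|) (i, j)).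
Qed.

Lemma mx_norm_le m n (x : 'M[R]_(m, n)) (r : R) : 0 <= r ->
  (forall i j, `|x i j| <= r) -> `|x| <= r.
Proof.
by move=> r0 xr; rewrite -[`|x|]/(mx_norm x) mx_normrE; apply/bigmax_leP.
Qed.

Lemma mx_norm_tr m n (x : 'M[R]_(m, n)) : `|x^T| = `|x|.
Proof.
by apply/eqP; rewrite eq_le; apply/andP; split; apply: mx_norm_le => // i j;
  [rewrite mxE|have -> : x i j = x^T j i by rewrite mxE]; exact: mx_coord_le.
Qed.

Lemma trmx_continuous m n : continuous (@trmx R m n).
Proof.
move=> x; apply/(@cvgrPdist_lt _ _ _ (nbhs x) _) => e e0; near=> y.
rewrite -linearB /= mx_norm_tr; near: y.
exact: cvgr_dist_lt.
Unshelve. all: by end_near. Qed.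

(** Compactness is carried over from row vectors by transposition, an isometry for the largest-entry
    norm. *)
Lemma cV_closed_ball_compact n (y0 : 'cV[R]_n) (r : R) :
  compact [set y | `|y - y0| <= r].
Proof.
have -> : [set y | `|y - y0| <= r] =
    (@trmx R 1 n) @` [set v | `|v - y0^T| <= r].
  apply/seteqP; split => [y yr|_ [v vr <-]] /=.
    by exists y^T; rewrite ?trmxK //= -linearB /= mx_norm_tr.
  by rewrite -[y0]trmxK -linearB /= mx_norm_tr.
apply: continuous_compact; first exact/continuous_subspaceT/trmx_continuous.
apply: bounded_closed_compact.
  exists (`|r| + `|y0^T|); split; first exact: num_real.
  move=> M rM v /= vr; apply: ltW; apply: le_lt_trans rM.
  rewrite -[v](subrK y0^T); apply: (le_trans (ler_normD _ _)).
  by apply: lerD => //; apply: (le_trans vr); exact: ler_norm.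
have -> : [set v : 'rV[R]_n | `|v - y0^T| <= r] =
  (fun v => `|v - y0^T|) @^-1` [set x | x <= r] by [].
apply: closed_comp; last exact: closed_le.
move=> v _; apply: (@cvg_norm _ _ _ (nbhs v)).
by apply: (@cvgB _ _ _ (nbhs v)); [exact: cvg_id|exact: cvg_cst].
Qed.

(** Only [x] is confined to [K]; the nearby point [y] may leave it. This one-sided form allows
    comparison with frequency vectors and estimates that are not known to lie in [K]. *)
Lemma compact_unif_continuous (V : normedModType R) (K : set V) (g : V -> R) :
  compact K -> continuous g -> forall e : R, 0 < e -> exists2 d : R, 0 < d &
    forall x y, K x -> `|x - y| < d -> `|g x - g y| <= e.
Proof.
move=> /compact_near_coveringP cK cg e e0.
have := cK R (0^'+) (fun d x => forall y, `|x - y| < d -> `|g x - g y| <= e) _.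
have H : forall x, K x -> \forall x' \near x & d \near 0^'+,
    forall y, `|x' - y| < d -> `|g x' - g y| <= e.
  move=> x _; have e2 : 0 < e / 2 by rewrite divr_gt0.
  have /cvgrPdist_lt/(_ _ e2)/nbhs_normP[/= r r0 xr] := cg x.
  exists ([set x' | `|x - x'| < r / 2], [set d | d < r / 2]).
    split; last by apply: nbhs_right_lt; rewrite divr_gt0.
    by apply/nbhs_normP; exists (r / 2) => //=; rewrite divr_gt0.
  move=> [x' d] /= [xx' dr] y x'y.
  rewrite -(subrKA (g x)); apply: (le_trans (ler_normD _ _)).
  rewrite (splitr e) lerD // ltW //.
    by rewrite distrC; apply: xr; rewrite /= (lt_trans xx') // gtr_pMr ?invf_lt1 ?ltr1n.
  apply: xr => /=; rewrite -(subrKA x') (le_lt_trans (ler_normD _ _)) //.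
  by rewrite (splitr r) ltrD // (lt_trans x'y).
move=> /(_ _ H) h; near (0 : R)^'+ => d; exists d; first by [].
have hd : K `<=` (fun x => forall y, `|x - y| < d -> `|g x - g y| <= e).
  by near: d; exact: h.
by move=> x y Kx; exact: hd.
Unshelve. all: by end_near. Qed.

End MatrixTopology.

(** * Approximation of bounded continuous functions by trigonometric polynomials *)

Section Approximation.
Variable R : realType.

Lemma mx_continuous (T : topologicalType) m n (F : T -> 'M[R]_(m, n)) (x : T) :
  (forall i j, {for x, continuous (fun t => F t i j)}) -> {for x, continuous F}.
Proof.
move=> cF; apply/(@cvgrPdist_le _ _ _ (nbhs x) _) => e e0; near=> t.
apply: mx_norm_le; first exact: ltW.
near: t; apply: filter_forall => i; apply: filter_forall => j.
have /cvgrPdist_le/(_ _ e0) := cF i j.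
by apply: filterS => t; rewrite !mxE.
Unshelve. all: by end_near. Qed.

Lemma Expect_bounded L N (p : 'cV[R]_L.+1) (g : 'cV[R]_L.+1 -> R) B :
  simplex p -> (forall y, `|g y| <= B) -> `|Expect N p g| <= B.
Proof.
move=> sp gB; rewrite -[Expect N p g]subr0 -(Expect_cst N 0 sp).
rewrite -[leRHS](Expect_cst N B sp); apply: ler_norm_ExpectB => // y.
by rewrite subr0; exact: gB.
Qed.

Lemma Expect_continuous_le L N (p : 'cV[R]_L.+1) (g : 'cV[R]_L.+1 -> R)
  (c B d e : R) : simplex p -> 0 < d -> 0 <= e -> 0 <= B ->
  (forall y, `|y - p| < d -> `|g y - c| <= e) -> (forall y, `|g y - c| <= B) ->
  `|Expect N.+1 p g - c| <= e + B * (d ^+ 2 * N.+1%:R)^-1.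
Proof.
move=> sp d0 e0 B0 ge gB; rewrite -{1}(Expect_cst N.+1 c sp).
apply: (@le_trans _ _ (Expect N.+1 p (fun y => e + B * (`[< d <= `|y - p| >])%:R))).
  apply: ler_norm_ExpectB => // y; case: asboolP => [_|/negP].
    by rewrite mulr1 (le_trans (gB y)) // lerDr.
  by rewrite -ltNge mulr0 addr0 => /ge.
rewrite (ExpectD _ _ (fun=> e)) ExpectZ Expect_cst // lerD2l ler_wpM2l //.
by rewrite -ProbE; exact: Chebyshev_phat.
Qed.

(* Expectations over multinomial frequencies are Bernstein polynomials. *)
Lemma Bernstein_simplex L (g : 'cV[R]_L.+1 -> R) (B e : R) : continuous g ->
  (forall y, `|g y| <= B) -> 0 < e ->
  exists N, forall p, simplex p -> `|Expect N p g - g p| <= e.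
Proof.
move=> cg gB e0; have e20 : 0 < e / 2 by rewrite divr_gt0.
have [d d0 hd] := compact_unif_continuous
  (@cV_closed_ball_compact R L.+1 0 1) cg e20.
have B0 : 0 <= B by apply: le_trans (gB 0).
have [N hN] : exists N : nat, (2 * B) / (d ^+ 2 * (e / 2)) < N%:R.
  by exists (Num.truncn ((2 * B) / (d ^+ 2 * (e / 2)))).+1; exact: truncnS_gt.
exists N.+1 => p sp.
have pK : [set y | `|y - 0| <= 1] p.
  rewrite /= subr0; apply: mx_norm_le => // i j; rewrite (ord1 j) ger0_norm ?sp.1 //.
  exact: simplex_le1.
apply: (le_trans (@Expect_continuous_le _ _ _ _ _ (2 * B) d (e / 2) sp d0 _ _ _ _)).
- exact: ltW.
- by rewrite mulr_ge0.
- by move=> y yp; rewrite distrC; apply: hd => //; rewrite distrC.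
- move=> y; apply: (le_trans (ler_normB _ _)).
  by have := gB y; have := gB p; lra.
rewrite [leRHS](splitr e) lerD2l.
have d2 : 0 < d ^+ 2 by rewrite exprn_gt0.
rewrite ler_pdivrMr ?mulr_gt0 // (_ : _ * (_ * _) = N.+1%:R * (d ^+ 2 * (e / 2))).
  move: hN; rewrite ltr_pdivrMr ?mulr_gt0 // => /ltW /le_trans; apply.
  by rewrite ler_wpM2r ?ler_nat // ltW // mulr_gt0.
by ring.
Qed.

Lemma sin1_lt1 : sin 1 < 1 :> R.
Proof.
have := cos2Dsin2 (1 : R); have := @cos1_gt0 R => c0 h.
rewrite ltNge; apply/negP => s1; nra.
Qed.

Lemma sin1_gt0 : 0 < sin 1 :> R.
Proof. by apply: sin2_gt0; rewrite ltr01 ltr1n. Qed.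

(** Since sin 1 < 1, clamped values stay in the open interval where [asin] is continuous, and [asin]
    after [clamp] is a continuous left inverse of [sin] on [-1, 1]. *)
Let clamp (x : R) := Num.max (- sin 1) (Num.min x (sin 1)).

Let clamp_in x : -1 < clamp x < 1.
Proof.
have s1 := sin1_lt1; have s0 := sin1_gt0.
rewrite /clamp lt_max gt_max gt_min; apply/andP; split.
  by rewrite ltrN2 s1.
by rewrite s1 orbT andbT; lra.
Qed.

Let clamp_id x : -1 <= x <= 1 -> clamp (sin x) = sin x.
Proof.
move=> /andP[x1 x2]; have p1 := @pihalf_ge1 R.
have m (u v : R) : -1 <= u -> v <= 1 -> u <= v -> sin u <= sin v.
  move=> u1 v1; rewrite le_eqVlt => /predU1P[->//|uv]; apply: ltW.
  by rewrite ltr_sin // in_itv /=; apply/andP; split; lra.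
have h1 : sin x <= sin 1 by exact: m.
have h2 : - sin 1 <= sin x by rewrite -sinN; apply: m => //; lra.
by rewrite /clamp (min_idPl _) // (max_idPr _).
Qed.

Let clamp_continuous : continuous clamp.
Proof.
move=> x; apply: (@continuous_max _ _ (fun=> - sin 1)
  (fun x => Num.min x (sin 1))); first exact: cvg_cst.
by apply: (@continuous_min _ _ id (fun=> sin 1)); [exact: cvg_id|exact: cvg_cst].
Qed.

Let asin_clamp x : -1 <= x <= 1 -> asin (clamp (sin x)) = x.
Proof.
move=> x1; rewrite clamp_id // sinK // in_itv /=; have := @pihalf_ge1 R.
by case/andP: x1 => *; apply/andP; split; lra.
Qed.

Section Param.
Variable s : R.
Hypothesis s0 : 0 < s.

(** The factor 6 keeps each weight at most 1/3, so that three of them leave a non-negative fourth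
    barycentric coordinate. *)
Let w (y : 'cV[R]_3) (c : 'I_3) : R := (1 + sin (y c ord0 / s)) / 6.

Let bary (y : 'cV[R]_3) : 'cV[R]_4 :=
  \col_j (if unlift ord_max j is Some c then w y c else 1 - \sum_c w y c).

(** Inverts [bary] on the ball of radius [s] and is continuous on the whole of the ambient space,
    outside the simplex too. *)
Let unbary (z : 'cV[R]_4) : 'cV[R]_3 :=
  \col_c (s * asin (clamp (6 * z (lift ord_max c) ord0 - 1))).

Let bary_lift y c : bary y (lift ord_max c) ord0 = w y c.
Proof. by rewrite mxE liftK. Qed.

Let bary_max y : bary y ord_max ord0 = 1 - \sum_c w y c.
Proof. by rewrite mxE unlift_none. Qed.

Let w_bound y c : 0 <= w y c <= 3^-1.
Proof.
rewrite /w; have := sin_geN1 (y c ord0 / s); have := sin_le1 (y c ord0 / s).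
by move=> *; apply/andP; split; lra.
Qed.

Let bary_simplex y : simplex (bary y).
Proof.
split=> [j|].
  case: (unliftP ord_max j) => [c ->|->]; first by rewrite bary_lift; case/andP: (w_bound y c).
  rewrite bary_max subr_ge0; apply: (@le_trans _ _ (\sum_(c < 3) 3^-1)).
    by apply: ler_sum => c _; case/andP: (w_bound y c).
  by rewrite !big_ord_recl big_ord0; lra.
rewrite big_ord_recr /= bary_max addrC -addrA -[RHS]addr0; congr (_ + _).
apply/eqP; rewrite addrC subr_eq0; apply/eqP; apply: eq_bigr => c _.
by rewrite -bary_lift; congr (bary y _ _); apply: val_inj; rewrite /= /bump leqNgt ltn_ord.
Qed.

Let unbary_continuous : continuous unbary.
Proof.
move=> z; apply: mx_continuous => i j.
have -> : (fun t => unbary t i j) =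
    fun t : 'cV[R]_4 => s * asin (clamp (6 * t (lift ord_max i) ord0 - 1)).
  by apply/funext => t; rewrite mxE.
apply: (@cvgMr _ _ (nbhs z)).
apply: (@cvg_comp _ _ _ (fun t : 'cV[R]_4 => 6 * t (lift ord_max i) ord0 - 1)
  (fun u => asin (clamp u)) (nbhs z) (nbhs (6 * z (lift ord_max i) ord0 - 1))).
  apply: (@cvgB _ _ _ (nbhs z)); last exact: cvg_cst.
  by apply: (@cvgMr _ _ (nbhs z)); exact: coord_continuous.
apply: (@continuous_comp _ _ _ clamp (@asin R)); first exact: clamp_continuous.
exact/continuous_asin/clamp_in.
Qed.

Let unbaryK y : `|y| <= s -> unbary (bary y) = y.
Proof.
move=> ys; apply/colP => c; rewrite mxE bary_lift /w.
rewrite (_ : 6 * _ - 1 = sin (y c ord0 / s)); last by field.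
rewrite asin_clamp; first by rewrite mulrC divfK // gt_eqF.
rewrite -ler_norml normrM normfV (gtr0_norm s0) ler_pdivrMr // mul1r.
exact: le_trans (mx_coord_le y c ord0) ys.
Qed.

Let bary_trigpoly j : trigpoly (fun y => bary y j ord0).
Proof.
have tw c : trigpoly (fun y => w y c).
  (* The sine is written as a cosine with phase - pi / 2 and frequency 1 / s along coordinate
     [c]. *)
  have -> : (fun y => w y c) = fun y => 6^-1 *
      (1 + cos (((s^-1 *: (delta_mx c ord0 : 'cV[R]_3))^T *m y) ord0 ord0 - pi / 2)).
    apply/funext => y; rewrite linearZ /= -scalemxAl mxE cosBpihalf.
    by rewrite trmx_delta -rowE mxE /w mulrC [s^-1 * _]mulrC.
  exact: (TrigScale _ (TrigAdd (trigpoly_cst 1) (TrigCos _ _))).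
case: (unliftP ord_max j) => [c ->|->].
  by under eq_fun do rewrite bary_lift; exact: tw.
under eq_fun do rewrite bary_max -mulN1r.
by apply: (TrigAdd (trigpoly_cst 1) (TrigScale _ _)); exact: trigpoly_sum.
Qed.

(* The map [bary] has trigonometric coordinates and takes values in the simplex,
   where Bernstein polynomials bounded by [B] are available; composing with it
   keeps the bound [B] on the whole space. *)
Lemma trigpoly_approx (f : 'cV[R]_3 -> R) (B e : R) : continuous f ->
  (forall y, `|f y| <= B) -> 0 < e ->
  exists Q, [/\ trigpoly Q, forall y, `|Q y| <= B &
    forall y, `|y| <= s -> `|Q y - f y| <= e].
Proof.
move=> cf fB e0; pose g z := f (unbary z).
have cg : continuous g.
  by move=> z; apply: continuous_comp; [exact: unbary_continuous|exact: cf].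
have [N hN] := @Bernstein_simplex _ g B e cg (fun z => fB _) e0.
exists (fun y => Expect N (bary y) g); split.
- rewrite /Expect /multinom_pmf; apply: trigpoly_sum => n.
  under eq_fun do rewrite mulrAC.
  apply: TrigScale; apply: trigpoly_prod => j; apply: trigpoly_exp.
  exact: bary_trigpoly.
- by move=> y; apply: Expect_bounded => // z; exact: fB.
- by move=> y ys; have := hN _ (bary_simplex y); rewrite /g unbaryK.
Qed.

End Param.
End Approximation.

(** * Taylor remainders and the quantitative limit for a single cosine *)

Section TrigBounds.
Variable R : realType.

(** Mean value theorem between 0 and [x]. The constant is crude but the bound iterates: starting
    from |cos| <= 1 it yields the remainders of sine and cosine up to order four. *)
Lemma derive_pow_bound (f df : R -> R) (n : nat) :
  (forall x : R, is_derive x (1 : R) f (df x)) -> f 0 = 0 ->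
  (forall x, `|df x| <= `|x| ^+ n) -> forall x, `|f x| <= `|x| ^+ n.+1.
Proof.
move=> fd f0 dfb x.
have cf : continuous f.
  by move=> z; apply/differentiable_continuous/derivable1_diffP; apply: ex_derive.
have key (a b c : R) : a <= c <= b -> f b - f a = df c * (b - a) ->
    `|c| <= `|x| -> `|b - a| = `|x| -> `|f b - f a| <= `|x| ^+ n.+1.
  move=> _ -> cx ba; rewrite normrM ba exprSr ler_wpM2r //.
  by apply: (le_trans (dfb c)); rewrite lerXn2r ?nnegrE.
have [x0|x0|->] := ltgtP x 0; last by rewrite f0 normr0 expr0n.
- have [c cI fc] := @MVT_segment R f df x 0 (ltW x0) (fun z _ => fd z)
    (continuous_subspaceT cf).
  move: cI; rewrite in_itv /= => /andP[c1 c2].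
  rewrite -normrN -[- f x]add0r -{1}f0.
  apply: (key _ _ c) => //; rewrite ?sub0r ?normrN //; first by rewrite c1 c2.
  by rewrite !ler0_norm ?lerN2 // ltW.
- have [c cI fc] := @MVT_segment R f df 0 x (ltW x0) (fun z _ => fd z)
    (continuous_subspaceT cf).
  move: cI; rewrite in_itv /= => /andP[c1 c2].
  rewrite -[f x]subr0 -{1}f0.
  apply: (key _ _ c) => //; rewrite ?subr0 //; first by rewrite c1 c2.
  by rewrite !ger0_norm // ltW.
Qed.

Lemma sin_bound1 (x : R) : `|sin x| <= `|x|.
Proof.
have h (y : R) : `|cos y| <= `|y| ^+ 0 by rewrite expr0; exact: cos_max.
by have := derive_pow_bound (@is_derive_sin R) (sin0 R) h x; rewrite expr1.
Qed.

Lemma cos_bound2 (x : R) : `|cos x - 1| <= `|x| ^+ 2.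
Proof.
have d (y : R) : is_derive y (1 : R) (fun x => cos x - 1) (- sin y).
  have -> : (fun x : R => cos x - 1) = cos - cst 1 by [].
  by apply: is_derive_eq; rewrite subr0.
have h0 : cos 0 - 1 = 0 :> R by rewrite cos0 subrr.
have h (y : R) : `|- sin y| <= `|y| ^+ 1 by rewrite normrN expr1; exact: sin_bound1.
exact: (derive_pow_bound d h0 h).
Qed.

Lemma sin_bound3 (x : R) : `|sin x - x| <= `|x| ^+ 3.
Proof.
have d (y : R) : is_derive y (1 : R) (fun x => sin x - x) (cos y - 1).
  by have -> : (fun x : R => sin x - x) = sin - id by []; apply: is_derive_eq.
have h0 : sin 0 - 0 = 0 :> R by rewrite sin0 subrr.
exact: (derive_pow_bound d h0 cos_bound2).
Qed.

Lemma cos_bound4 (x : R) : `|cos x - 1 + x ^+ 2 / 2| <= `|x| ^+ 4.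
Proof.
have d (y : R) : is_derive y (1 : R) (fun x => cos x - 1 + x ^+ 2 / 2) (y - sin y).
  have -> : (fun x : R => cos x - 1 + x ^+ 2 / 2) =
      (cos - cst 1) + 2^-1 \*: (@GRing.exp R ^~ 2%N).
    by apply/funext => z; rewrite /= mulrC.
  by apply: is_derive_eq; rewrite /GRing.scale /=; field.
have h0 : cos 0 - 1 + 0 ^+ 2 / 2 = 0 :> R by rewrite cos0 subrr expr0n mul0r addr0.
have h (y : R) : `|y - sin y| <= `|y| ^+ 3 by rewrite distrC; exact: sin_bound3.
exact: (derive_pow_bound d h0 h).
Qed.

Lemma expRN_bound (s : R) : 0 <= s -> `|expR (- s) - 1 + s| <= s ^+ 2.
Proof.
move=> s0; have h1 := expR_ge1Dx (- s); have h2 := expR_ge1Dx s.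
have h3 : expR (- s) * expR s = 1 by rewrite -expRD addNr expR0.
have h4 := expR_gt0 (- s).
rewrite ler_norml; apply/andP; split; first by have := sqr_ge0 s; lra.
(* Gives exp(-s) <= 1 / (1 + s), hence the remainder is at most s^2 / (1 + s). *)
have : expR (- s) * (1 + s) <= 1 by rewrite -[leRHS]h3 ler_wpM2l // ltW.
have : 0 <= (expR (- s) - 1 + s) * s by rewrite mulr_ge0 //; lra.
by nra.
Qed.

Section Step.
Variables (L : nat) (p a : 'cV[R]_L.+1).
Hypothesis sp : simplex p.
Let m := (a^T *m p) ord0 ord0.
Let var := (\sum_j p j ord0 * a j ord0 ^+ 2) - m ^+ 2.

Let mE : m = \sum_j p j ord0 * a j ord0.
Proof. by rewrite /m mxE; apply: eq_bigr => j _; rewrite mxE mulrC. Qed.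

Let d j := a j ord0 - m.

Let sum_d : \sum_j p j ord0 * d j = 0.
Proof.
under eq_bigr do rewrite mulrBr.
by rewrite sumrB /= -mulr_suml sp.2 mul1r -mE subrr.
Qed.

Let sum_d2 : \sum_j p j ord0 * d j ^+ 2 = var.
Proof.
transitivity (\sum_j (p j ord0 * a j ord0 ^+ 2 - 2 * m * (p j ord0 * a j ord0)
   + p j ord0 * m ^+ 2)); first by apply: eq_bigr => j _; rewrite /d; ring.
by rewrite big_split sumrB /= -mulr_sumr -mE -mulr_suml sp.2 /var; ring.
Qed.

Lemma linear_variance_ge0 : 0 <= var.
Proof.
by rewrite -sum_d2 sumr_ge0 // => j _; rewrite mulr_ge0 ?sqr_ge0 ?sp.1.
Qed.

(** Around the mean, the first-order terms cancel because [d] is centred, and the second-order ones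
    agree because [var] is its variance. [E1], [E2], [E3] are the remainders of cosine, sine and
    exponential. A cubic error is small enough to be summed over N steps of size N^(-1/2). *)
Lemma cos_step : exists C : R, forall t psi : R, 0 <= t <= 1 ->
  `|\sum_j p j ord0 * cos (psi + t * a j ord0)
    - expR (- (t ^+ 2 * var / 2)) * cos (psi + t * m)| <= C * t ^+ 3.
Proof.
exists (\sum_j p j ord0 * `|d j| ^+ 4 + (var / 2) ^+ 2 + \sum_j p j ord0 * `|d j| ^+ 3).
move=> t psi /andP[t0 t1]; set th := psi + t * m.
pose E1 := \sum_j p j ord0 * (cos (t * d j) - 1 + (t * d j) ^+ 2 / 2).
pose E2 := \sum_j p j ord0 * (sin (t * d j) - t * d j).
pose E3 := expR (- (t ^+ 2 * var / 2)) - 1 + t ^+ 2 * var / 2.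
have t43 : t ^+ 4 <= t ^+ 3 by rewrite exprSr ler_piMr // exprn_ge0.
have b1 : `|E1| <= (\sum_j p j ord0 * `|d j| ^+ 4) * t ^+ 3.
  apply: (@le_trans _ _ ((\sum_j p j ord0 * `|d j| ^+ 4) * t ^+ 4)); last first.
    by rewrite ler_wpM2l // sumr_ge0 // => j _; rewrite mulr_ge0 ?sp.1 ?exprn_ge0.
  rewrite mulr_suml; apply: (le_trans (ler_norm_sum _ _ _)); apply: ler_sum => j _.
  rewrite normrM (ger0_norm (sp.1 j)) -mulrA ler_wpM2l ?sp.1 //.
  by apply: (le_trans (cos_bound4 _)); rewrite normrM (ger0_norm t0) exprMn mulrC.
have b2 : `|E2| <= (\sum_j p j ord0 * `|d j| ^+ 3) * t ^+ 3.
  rewrite mulr_suml; apply: (le_trans (ler_norm_sum _ _ _)); apply: ler_sum => j _.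
  rewrite normrM (ger0_norm (sp.1 j)) -mulrA ler_wpM2l ?sp.1 //.
  by apply: (le_trans (sin_bound3 _)); rewrite normrM (ger0_norm t0) exprMn mulrC.
have b3 : `|E3| <= (var / 2) ^+ 2 * t ^+ 3.
  apply: (le_trans (expRN_bound _)).
    by rewrite divr_ge0 // mulr_ge0 ?exprn_ge0 // linear_variance_ge0.
  rewrite (_ : (_ * _ / _) ^+ 2 = (var / 2) ^+ 2 * t ^+ 4); last by field.
  by rewrite ler_wpM2l // sqr_ge0.
have -> : \sum_j p j ord0 * cos (psi + t * a j ord0) =
    cos th * (1 - t ^+ 2 * var / 2 + E1) - sin th * E2.
  have -> : E1 = \sum_j p j ord0 * cos (t * d j) - 1 + t ^+ 2 * var / 2.
    rewrite -sum_d2 /E1.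
    transitivity (\sum_j (p j ord0 * cos (t * d j) - p j ord0 +
       (t ^+ 2 / 2) * (p j ord0 * d j ^+ 2))).
      by apply: eq_bigr => j _; field.
    by rewrite big_split sumrB /= sp.2 -mulr_sumr mulrAC.
  have -> : E2 = \sum_j p j ord0 * sin (t * d j).
    rewrite /E2; transitivity (\sum_j (p j ord0 * sin (t * d j) -
       t * (p j ord0 * d j))); first by apply: eq_bigr => j _; ring.
    by rewrite sumrB -mulr_sumr sum_d mulr0 subr0.
  rewrite (_ : 1 - _ + _ = \sum_j p j ord0 * cos (t * d j)); last by ring.
  rewrite !mulr_sumr -sumrB; apply: eq_bigr => j _.
  rewrite (_ : psi + t * a j ord0 = th + t * d j); last by rewrite /th /d; ring.
  by rewrite cosD; ring.
have -> : expR (- (t ^+ 2 * var / 2)) = 1 - t ^+ 2 * var / 2 + E3.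
  by rewrite /E3; ring.
rewrite (_ : _ - _ = cos th * E1 - cos th * E3 - sin th * E2); last by ring.
have c1 := cos_max th; have s1 := sin_max th.
rewrite 2!mulrDl; apply: (le_trans (ler_normB _ _)); apply: lerD; last first.
  by apply: le_trans b2; rewrite normrM ler_piMl.
apply: (le_trans (ler_normB _ _)); apply: lerD.
  by apply: le_trans b1; rewrite normrM ler_piMl.
by apply: le_trans b3; rewrite normrM ler_piMl.
Qed.

Lemma Expect_cos_bound : exists C : R, forall (N : nat) (phi : R),
  `|Expect N.+1 p (fun y => cos (Num.sqrt N.+1%:R * (a^T *m (y - p)) ord0 ord0 + phi))
     - expR (- (var / 2)) * cos phi| <= C / Num.sqrt N.+1%:R.
Proof.
have [C hC] := cos_step; exists C => N phi.
set r := Num.sqrt N.+1%:R.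
have r0 : 0 < r by rewrite sqrtr_gt0.
have r2 : r ^+ 2 = N.+1%:R by rewrite sqr_sqrtr.
have r1 : 1 <= r by rewrite -sqrtr1 ler_sqrt // ler1n.
pose t := r^-1.
have t01 : 0 <= t <= 1 by rewrite invr_ge0 ltW //= invf_le1.
pose b := t *: a.
have bv v : (b^T *m v) ord0 ord0 = t * (a^T *m v) ord0 ord0.
  by rewrite /b linearZ /= -scalemxAl mxE.
pose w := expR (- (t ^+ 2 * var / 2)).
have w01 : 0 <= w <= 1.
  rewrite expR_ge0 -expR0 ler_expR oppr_le0 divr_ge0 // mulr_ge0 ?sqr_ge0 //.
  exact: linear_variance_ge0.
have step psi : `|\sum_j p j ord0 * cos (psi + b j ord0)
     - w * cos (psi + (b^T *m p) ord0 ord0)| <= C * t ^+ 3.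
  rewrite bv -/m; under eq_bigr => j _ do rewrite [b j ord0]mxE.
  exact: hC.
(* The phase [phi - r * m] centres the walk: its drift over N + 1 steps is (N + 1) t m = r m. The
   total error (N + 1) C t^3 equals C / r. *)
have := walk_cos N.+1 (phi - r * m) 0 sp w01 step.
rewrite !bv -/m mulmx0 [X in t * X]mxE mulr0 add0r.
rewrite (_ : phi - r * m + N.+1%:R * (t * m) = phi); last first.
  by rewrite -r2 /t; field; exact: lt0r_neq0.
rewrite (_ : w ^+ N.+1 = expR (- (var / 2))); last first.
  rewrite /w -expRM_natl -r2 /t; congr expR; field; exact: lt0r_neq0.
rewrite (_ : N.+1%:R * _ = C / r); last first.
  by rewrite -r2 /t; field; exact: lt0r_neq0.
rewrite Expect_walk; congr (`|walk _ _ _ _ - _| <= _); apply/funext => c.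
have dB (x y : 'M[R]_1) : (x - y) ord0 ord0 = x ord0 ord0 - y ord0 ord0.
  by rewrite !mxE.
rewrite bv mulmxBr dB -/m -scalemxAr [X in X - m]mxE; congr cos.
by rewrite -r2 /t; field; exact: lt0r_neq0.
Qed.

End Step.
End TrigBounds.

Section CLT.
Variables (R : realType) (L : nat).
Implicit Types (p : 'cV[R]_L.+1) (B : 'M[R]_(3, L.+1)) (A : 'M[R]_3).

(** Covariance matrix of one multinomial draw, hence of the frequencies centred at [p] and scaled by
    the square root of N. *)
Definition covm p : 'M[R]_L.+1 := diag_mx p^T - p *m p^T.

Lemma dot_covm p (a : 'cV[R]_L.+1) :
  (a^T *m covm p *m a) ord0 ord0 =
  (\sum_j p j ord0 * a j ord0 ^+ 2) - ((a^T *m p) ord0 ord0) ^+ 2.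
Proof.
rewrite /covm mulmxBr mulmxBl mxE [X in _ + X]mxE; congr (_ - _).
  rewrite mul_mx_diag mxE; apply: eq_bigr => j _; rewrite !mxE; ring.
have -> : a^T *m (p *m p^T) *m a = (a^T *m p) *m (a^T *m p)^T.
  by rewrite trmx_mul trmxK !mulmxA.
by rewrite mxE big_ord1 [X in _ * X]mxE expr2.
Qed.

Lemma cvg_inv_sqrt (C : R) : C / Num.sqrt n.+1%:R @[n --> \oo] --> (0 : R).
Proof.
rewrite -[X in _ --> X](mulr0 C); apply: cvgMr.
rewrite -[X in _ --> X](@sqrtr0 R).
under eq_fun do rewrite -sqrtrV //.
apply: (@cvg_comp _ _ _ (fun n : nat => n.+1%:R^-1 : R) Num.sqrt).
  exact: cvg_harmonic.
exact: sqrt_continuous.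
Qed.

(** Sums and multiples pass to the limit by linearity. For a cosine of frequency [u], the direction
    a = B^T u reduces the claim to the scalar bound, and the hypothesis on [A] identifies the two
    variances. *)
Lemma trigpoly_CLT p B A Q : simplex p -> A *m A^T = B *m covm p *m B^T ->
  trigpoly Q ->
  Expect N p (fun y => Q (Num.sqrt N%:R *: (B *m (y - p)))) @[N --> \oo]
    --> gmean3 A Q.
Proof.
move=> sp AB; elim=> [u psi|f g tf IHf tg IHg|r f tf IHf].
- rewrite gmean3_cos AB.
  pose a := B^T *m u.
  have [C hC] := Expect_cos_bound a sp.
  have -> : (u^T *m (B *m covm p *m B^T) *m u) ord0 ord0 =
      (\sum_j p j ord0 * a j ord0 ^+ 2) - ((a^T *m p) ord0 ord0) ^+ 2.
    by rewrite -dot_covm /a trmx_mul trmxK !mulmxA.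
  rewrite -cvg_shiftS; apply/cvgrPdist_lt => e e0.
  have := cvg_inv_sqrt C; move=> /cvgrPdist_lt/(_ _ e0).
  apply: filterS => N; rewrite sub0r normrN => h.
  rewrite distrC; apply: le_lt_trans h; apply: le_trans (ler_norm _).
  have := hC N psi; rewrite -[- (_ / 2)]mulNr /=.
  set E1 := Expect _ _ _; set E2 := Expect _ _ _.
  suff -> : E1 = E2 by [].
  congr (Expect _ _ _); apply/funext => y.
  by congr (cos (_ + _)); rewrite -scalemxAr [RHS]mxE /a trmx_mul trmxK mulmxA.
- have [Bf hf] := trigpoly_bounded tf; have [Bg hg] := trigpoly_bounded tg.
  rewrite (gmean3D A (trigpoly_continuous tf) hf (trigpoly_continuous tg) hg).
  have -> : (fun N => Expect N p (fun y => f (Num.sqrt N%:R *: (B *m (y - p))) +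
        g (Num.sqrt N%:R *: (B *m (y - p))))) =
      (fun N => Expect N p (fun y => f (Num.sqrt N%:R *: (B *m (y - p)))) +
        Expect N p (fun y => g (Num.sqrt N%:R *: (B *m (y - p))))).
    by apply/funext => N; exact: ExpectD.
  exact: cvgD IHf IHg.
- have [Bf hf] := trigpoly_bounded tf.
  rewrite (gmean3Z A r (trigpoly_continuous tf) hf).
  have -> : (fun N => Expect N p (fun y => r * f (Num.sqrt N%:R *: (B *m (y - p)))))
      = (fun N => r * Expect N p (fun y => f (Num.sqrt N%:R *: (B *m (y - p))))).
    by apply/funext => N; exact: ExpectZ.
  exact: cvgMr IHf.
Qed.

Lemma mulmx_norm_le m n q (B : 'M[R]_(m, n)) (y : 'M[R]_(n, q)) :
  `|B *m y| <= (n%:R * `|B|) * `|y|.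
Proof.
apply: mx_norm_le => [|i j]; first by rewrite !mulr_ge0.
rewrite mxE; apply: (le_trans (ler_norm_sum _ _ _)).
apply: (@le_trans _ _ (\sum_(k < n) `|B| * `|y|)).
  by apply: ler_sum => k _; rewrite normrM ler_pM // mx_coord_le.
by rewrite sumr_const card_ord -[leLHS]mulr_natl mulrA.
Qed.

(** Tightness: the scaling by the square root of the sample size cancels the denominator in
    Chebyshev's inequality, so the bound is uniform in N. *)
Lemma tail_scaled N p B (c s : R) : simplex p -> 0 < c -> 0 < s ->
  (forall y : 'cV[R]_L.+1, `|B *m y| <= c * `|y|) ->
  Prob N.+1 p (fun y => s < `|Num.sqrt N.+1%:R *: (B *m (y - p))|) <= (c / s) ^+ 2.
Proof.
move=> sp c0 s0 Bc; set r := Num.sqrt N.+1%:R.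
have r0 : 0 < r by rewrite sqrtr_gt0.
have r2 : r ^+ 2 = N.+1%:R by rewrite sqr_sqrtr.
have d0 : 0 < s / (c * r) by rewrite divr_gt0 // mulr_gt0.
apply: (@le_trans _ _ (Prob N.+1 p (fun y => s / (c * r) <= `|y - p|))).
  apply: ler_Prob => // y; rewrite normrZ (gtr0_norm r0) => h.
  rewrite ler_pdivrMr ?mulr_gt0 //; apply: ltW; apply: (lt_le_trans h).
  by rewrite [c * r]mulrC mulrCA ler_pM2l // mulrC.
apply: (le_trans (Chebyshev_phat _ sp d0)).
rewrite -r2 le_eqVlt; apply/orP; left; apply/eqP; field.
by rewrite !lt0r_neq0.
Qed.

Let dist_chain (a b c d u v e : R) : `|a - b| < e / 4 -> `|b - c| < e / 4 ->
  `|c - d| <= u + v -> u < e / 4 -> v < e / 4 -> `|a - d| < e.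
Proof.
rewrite (_ : a - d = (a - b) + (b - c) + (c - d)); last by ring.
have := ler_normD (a - b + (b - c)) (c - d).
have := ler_normD (a - b) (b - c).
by lra.
Qed.

(* Tails need no control on the Gaussian side, where the approximating
   trigonometric polynomials converge pointwise with the common bound [M]. *)
Theorem multinomial_CLT p B A (f : 'cV[R]_3 -> R) (M : R) : simplex p ->
  A *m A^T = B *m covm p *m B^T -> continuous f -> (forall y, `|f y| <= M) ->
  Expect N p (fun y => f (Num.sqrt N%:R *: (B *m (y - p)))) @[N --> \oo]
    --> gmean3 A f.
Proof.
move=> sp AB cf fM; have M0 : 0 <= M by apply: le_trans (fM 0).
pose c := L.+1%:R * `|B| + 1.
have c0 : 0 < c by rewrite ltr_wpDl // mulr_ge0.
have Bc (y : 'cV[R]_L.+1) : `|B *m y| <= c * `|y|.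
  by apply: (le_trans (mulmx_norm_le B y)); rewrite ler_wpM2r // lerDl.
have apx n : {Q | [/\ trigpoly Q, forall y, `|Q y| <= M &
    forall y : 'cV[R]_3, `|y| <= n.+1%:R -> `|Q y - f y| <= n.+1%:R^-1]}.
  by apply: cid; apply: trigpoly_approx => //; rewrite invr_gt0.
pose Q n := sval (apx n).
have Qt n : trigpoly (Q n) by case: (svalP (apx n)).
have QM n y : `|Q n y| <= M by case: (svalP (apx n)) => _ + _; apply.
have Qf n (y : 'cV[R]_3) : `|y| <= n.+1%:R -> `|Q n y - f y| <= n.+1%:R^-1.
  by case: (svalP (apx n)) => _ _; apply.
have cvgQ : gmean3 A (Q n) @[n --> \oo] --> gmean3 A f.
  apply: (@gmean3_cvg _ A f M Q) => // [n|y]; first exact: trigpoly_continuous (Qt n).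
  apply/cvgrPdist_le => e e0.
  have /cvgrPdist_lt/(_ _ e0) he := @cvg_harmonic R.
  near=> n; rewrite distrC; apply: (le_trans (Qf n y _)).
    apply: (@le_trans _ _ n%:R); last by rewrite ler_nat.
    by near: n; exact: nbhs_infty_ger.
  apply: ltW; have : `|0 - harmonic n| < e by near: n; exact: he.
  by rewrite sub0r normrN; apply: le_lt_trans; exact: ler_norm.
apply/cvgrPdist_lt => e e0; have e4 : 0 < e / 4 by rewrite divr_gt0.
(* One polynomial is fixed before N grows. The third condition controls the tail for all sample
   sizes at once, where [f] and [Q n] differ by at most 2 M. *)
have [n [n1 n2 n3]] : exists n, [/\ `|gmean3 A f - gmean3 A (Q n)| < e / 4,
    n.+1%:R^-1 < e / 4 & (2 * M) * (c / n.+1%:R) ^+ 2 < e / 4].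
  have h3 : (2 * M) * (c / n.+1%:R) ^+ 2 @[n --> \oo] --> (0 : R).
    have h1 : c / n.+1%:R @[n --> \oo] --> (0 : R).
      by rewrite -[X in _ --> X](mulr0 c); apply: cvgMr; exact: cvg_harmonic.
    have h2 : (c / n.+1%:R) ^+ 2 @[n --> \oo] --> (0 : R).
      have -> : (fun n : nat => (c / n.+1%:R) ^+ 2) =
          (fun n : nat => (c / n.+1%:R) * (c / n.+1%:R)) by [].
      by rewrite -[X in _ --> X](mulr0 (0 : R)); exact: cvgM.
    by rewrite -[X in _ --> X](mulr0 (2 * M)); apply: cvgMr.
  near \oo => n; exists n; split.
  - by near: n; have /cvgrPdist_lt/(_ _ e4) := cvgQ.
  - have : `|0 - harmonic n| < e / 4.
      by near: n; have /cvgrPdist_lt/(_ _ e4) := @cvg_harmonic R.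
    by rewrite sub0r normrN; apply: le_lt_trans; exact: ler_norm.
  - have : `|0 - (2 * M) * (c / n.+1%:R) ^+ 2| < e / 4.
      by near: n; have /cvgrPdist_lt/(_ _ e4) := h3.
    by rewrite sub0r normrN; apply: le_lt_trans; exact: ler_norm.
have /cvgrPdist_lt/(_ _ e4) hQ := trigpoly_CLT sp AB (Qt n).
near=> N.
have N0 : (0 < N)%N by near: N; exact: nbhs_infty_gt.
have hN : `|gmean3 A (Q n) - Expect N p (fun y => Q n (Num.sqrt N%:R *: (B *m (y - p))))|
    < e / 4 by near: N.
move: hN; rewrite -(prednK N0); move: N.-1 => k hN.
set Ef := Expect _ _ _; set EQ := Expect _ _ _ in hN.
have hEf : `|EQ - Ef| <= n.+1%:R^-1 + (2 * M) * (c / n.+1%:R) ^+ 2.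
  apply: (@le_trans _ _ (Expect k.+1 p (fun y => n.+1%:R^-1 + (2 * M) *
      (`[< n.+1%:R < `|Num.sqrt k.+1%:R *: (B *m (y - p))| >])%:R))).
    apply: ler_norm_ExpectB => // y; set z := _ *: _.
    case: asboolP => [_|/negP]; last by rewrite -leNgt mulr0 addr0 => /Qf.
    rewrite mulr1; apply: (le_trans (ler_normB _ _)).
    have := QM n z; have := fM z; have : 0 <= n.+1%:R^-1 :> R by rewrite invr_ge0.
    move: (_^-1) (`|Q n z|) (`|f z|) => a b d; lra.
  rewrite (ExpectD _ _ (fun=> n.+1%:R^-1)) ExpectZ Expect_cst // lerD2l.
  by rewrite ler_wpM2l ?mulr_ge0 // -ProbE tail_scaled.
exact: (dist_chain n1 hN hEf n2 n3).
Unshelve. all: by end_near. Qed.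

End CLT.

(** * Roots of constrained estimating equations *)

Section Calculus.
Variable R : realType.

Lemma differentiable_remainder (V : normedModType R) (f : V -> R) (x : V) :
  differentiable f x -> forall e : R, 0 < e -> exists2 d : R, 0 < d &
    forall y, `|y - x| < d -> `|f y - f x - 'D_(y - x) f x| <= e * `|y - x|.
Proof.
move=> df e e0; have := diff_locally df => /eqaddoP/(_ _ e0) /nbhs_normP[d /= d0 hd].
exists d => // y yx; have := hd (y - x); rewrite /= sub0r normrN => /(_ yx).
rewrite [X in `|X| <= _](_ : _ = f (y - x + x) - (f x + 'd f x (y - x))) //.
by rewrite subrK deriveE // opprD addrA.
Qed.

Lemma is_derive_line (V : normedModType R) (f : V -> R) (x v : V) :
  differentiable f x -> is_derive 0 (1 : R) (fun s : R => f (s *: v + x)) ('D_v f x).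
Proof.
move=> df; have dv : derivable f x v := @diff_derivable _ _ _ f x v df.
have E : (fun h : R => h^-1 *: (((fun s : R => f (s *: v + x)) \o shift 0) (h *: 1)
    - f (0 *: v + x))) = (fun h => h^-1 *: ((f \o shift x) (h *: v) - f x)).
  apply/funext => h; rewrite /= scale0r add0r addr0.
  by rewrite [h *: 1]mulr1.
apply: DeriveDef; first by rewrite /derivable E.
by rewrite /derive E.
Qed.

Lemma local_min_derive0 (f : R -> R) (d : R) : is_derive 0 (1 : R) f d ->
  (\forall s \near (0 : R), f 0 <= f s) -> d = 0.
Proof.
move=> [fd fv] fmin.
have qc : h^-1 *: (f h - f 0) @[h --> 0^'] --> d.
  rewrite -fv; move: fd; rewrite /derivable /derive.
  have -> : (fun h => h^-1 *: ((f \o shift 0) (h *: 1) - f 0)) =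
      (fun h : R => h^-1 *: (f h - f 0)); last by [].
  by apply/funext => h; rewrite /= addr0 [h *: 1]mulr1.
apply/eqP; rewrite eq_le; apply/andP; split.
- apply: (cvgr_to_le (cvg_dnbhs_at_left qc)); near=> h.
  have h0 : h < 0 by near: h; exact: nbhs_left_lt.
  rewrite /GRing.scale /= nmulr_rle0 ?invr_lt0 // subr_ge0.
  by near: h; exact: (cvg_at_left_filter cvg_id).
- apply: (cvgr_to_ge (cvg_dnbhs_at_right qc)); near=> h.
  have h0 : 0 < h by near: h; exact: nbhs_right_gt.
  rewrite /GRing.scale /= pmulr_rge0 ?invr_gt0 // subr_ge0.
  by near: h; exact: (cvg_at_right_filter cvg_id).
Unshelve. all: by end_near. Qed.

End Calculus.

Section MatrixCalculus.
Variable R : realType.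

Lemma mulmx_continuous (T : topologicalType) m n q (A : T -> 'M[R]_(m, n))
  (B : T -> 'M[R]_(n, q)) (x : T) : {for x, continuous A} ->
  {for x, continuous B} -> {for x, continuous (fun t => A t *m B t)}.
Proof.
move=> cA cB; apply: mx_continuous => i j.
have -> : (fun t => (A t *m B t) i j) = (fun t => \sum_k A t i k * B t k j).
  by apply/funext => t; rewrite mxE.
apply: (@cvg_sumr _ _ _ (nbhs x)) => k _; apply: (@cvgM _ _ (nbhs x)).
  exact: (continuous_comp cA (@coord_continuous _ _ _ i k (A x))).
exact: (continuous_comp cB (@coord_continuous _ _ _ k j (B x))).
Qed.

Lemma mx_remainder n q (F : 'cV[R]_n -> 'cV[R]_q) (D : 'M[R]_(q, n)) x :
  (forall i, differentiable (fun t => F t i ord0) x) ->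
  (forall i v, 'D_v (fun t => F t i ord0) x = (D *m v) i ord0) ->
  forall e : R, 0 < e ->
  \forall y \near x, `|F y - F x - D *m (y - x)| <= e * `|y - x|.
Proof.
move=> dF DF e e0.
have : \forall y \near x, forall i, `|(F y - F x - D *m (y - x)) i ord0| <= e * `|y - x|.
  apply: (@filter_forall _ _ (fun i y =>
    `|(F y - F x - D *m (y - x)) i ord0| <= e * `|y - x|) (nbhs x)) => i.
  have [d d0 hd] := differentiable_remainder (dF i) e0.
  apply/(@nbhs_normP _ _ x); exists d => //= y; rewrite /= distrC => /hd.
  by rewrite DF !mxE.
apply: filterS => y hy; apply: mx_norm_le => [|i j]; first by rewrite mulr_ge0 // ltW.
by rewrite (ord1 j).
Qed.

(** Covers both orders of [a] and [b]. The sign condition records that [c] lies on the same side of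
    [a] as [b], which gives the sign of a derivative of the form (c - a) times a non-negative
    factor. *)
Lemma MVT_between (f df : R -> R) (a b : R) :
  (forall x, `|x - a| <= `|b - a| -> is_derive x (1 : R) f (df x)) ->
  exists c, [/\ `|c - a| <= `|b - a|, 0 <= (c - a) * (b - a) &
    f b - f a = df c * (b - a)].
Proof.
move=> fd.
have cf u v : (forall x, u <= x <= v -> `|x - a| <= `|b - a|) ->
    {within `[u, v], continuous f}.
  move=> uv; apply: continuous_in_subspaceT => x; rewrite inE /= in_itv /= => xuv.
  have := fd _ (uv _ xuv); move=> /(@ex_derive _ _ _ _ _ _ _)/derivable1_diffP.
  exact: differentiable_continuous.
have [ab|ba] := leP a b.
- have h x : a <= x <= b -> `|x - a| <= `|b - a|.
    by move=> /andP[? ?]; rewrite !ger0_norm ?subr_ge0 // lerD2r.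
  have [x xab|c cI fc] := @MVT_segment R f df a b ab _ (cf _ _ h).
    by apply: fd; apply: h; move: xab; rewrite in_itv /= => /andP[/ltW -> /ltW ->].
  have cI' : a <= c <= b by move: cI; rewrite in_itv.
  exists c; split => //; first exact: h.
  by case/andP: cI' => *; rewrite mulr_ge0 // subr_ge0.
- have h x : b <= x <= a -> `|x - a| <= `|b - a|.
    move=> /andP[bx xa]; rewrite !ler0_norm ?subr_le0 //; last exact: ltW.
    by rewrite !opprB lerD2l lerN2.
  have [x xab|c cI fc] := @MVT_segment R f df b a (ltW ba) _ (cf _ _ h).
    by apply: fd; apply: h; move: xab; rewrite in_itv /= => /andP[/ltW -> /ltW ->].
  have cI' : b <= c <= a by move: cI; rewrite in_itv.
  exists c; split => //; first exact: h.
    by case/andP: cI' => *; rewrite mulr_le0 // subr_le0 // ltW.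
  by rewrite -opprB fc -mulrN opprB.
Qed.

End MatrixCalculus.

(** * Existence and first-order expansion of a constrained root *)

Section ConstrainedRoot.
Variables (R : realType) (n k r : nat).
Variables (th0 : 'cV[R]_n) (rho : R).
Variables (pi : 'cV[R]_n -> 'cV[R]_k) (W : 'cV[R]_n -> 'M[R]_(k, n)).
Variables (m : 'cV[R]_n -> 'cV[R]_r) (M : 'cV[R]_n -> 'M[R]_(n, r)).
Variables (w l E : R -> R).
Local Notation inb th := (`|th - th0| <= rho).
Hypothesis rho_gt0 : 0 < rho.
Hypothesis dpi : forall th : 'cV[R]_n, inb th -> forall j,
  differentiable (fun t => pi t j ord0) th.
Hypothesis Dpi : forall th : 'cV[R]_n, inb th -> forall j v,
  'D_v (fun t => pi t j ord0) th = (W th *m v) j ord0.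
Hypothesis cW : forall th : 'cV[R]_n, inb th -> {for th, continuous W}.
Hypothesis dm : forall th : 'cV[R]_n, inb th -> forall i,
  differentiable (fun t => m t i ord0) th.
Hypothesis Dm : forall th : 'cV[R]_n, inb th -> forall i v,
  'D_v (fun t => m t i ord0) th = ((M th)^T *m v) i ord0.
Hypothesis cM : forall th : 'cV[R]_n, inb th -> {for th, continuous M}.
Hypothesis pi_gt0 : forall th : 'cV[R]_n, inb th -> forall j, 0 < pi th j ord0.
Hypothesis Dl : forall s : R, 0 < s -> is_derive s (1 : R) l (w s).
Hypothesis DE : forall s : R, 0 < s -> is_derive s (1 : R) E (s * w s).
Hypothesis w_gt0 : forall s : R, 0 < s -> 0 < w s.
Hypothesis cw : forall s : R, 0 < s -> {for s, continuous w}.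
Hypothesis m0 : m th0 = 0.

Definition weighted_score (th : 'cV[R]_n) : 'M[R]_(n, k) :=
  (W th)^T *m diag_mx (\row_j w (pi th j ord0)).
Local Notation G := weighted_score.
Let J := G th0 *m W th0.
Let M0 := M th0.
Hypothesis J_unit : J \in unitmx.
Hypothesis MJM_unit : M0^T *m invmx J *m M0 \in unitmx.
Let q := pi th0.

Let inb0 : inb th0. Proof. by rewrite subrr normr0 ltW. Qed.

Let cpi th : inb th -> {for th, continuous pi}.
Proof.
move=> hth; apply: mx_continuous => i j; rewrite (ord1 j).
exact: differentiable_continuous (dpi hth i).
Qed.

Let cG th : inb th -> {for th, continuous G}.
Proof.
move=> hth; apply: mulmx_continuous.
  exact: (continuous_comp (cW hth) (@trmx_continuous _ _ _ (W th))).
apply: mx_continuous => i j.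
have [->|ij] := eqVneq i j; last first.
  have -> : (fun t => diag_mx (\row_j w (pi t j ord0)) i j) = cst 0.
    by apply/funext => t; rewrite !mxE (negbTE ij).
  exact: cst_continuous.
have -> : (fun t => diag_mx (\row_j w (pi t j ord0)) j j) =
    (fun t => w (pi t j ord0)).
  by apply/funext => t; rewrite !mxE eqxx.
apply: (@continuous_comp _ _ _ (fun t => pi t j ord0) w).
  exact: differentiable_continuous (dpi hth j).
exact/cw/pi_gt0.
Qed.

(** A single [e] serves as radius, as lower bound of the weight and as inverse of its upper bound,
    so later estimates carry one constant. *)
Let weight_bounds : exists2 e : R, 0 < e & forall j s, `|s - q j ord0| <= e ->
  [/\ 0 < s, e <= w s & w s <= e^-1].
Proof.
have h : \forall e \near 0^'+, forall j s, `|s - q j ord0| <= e ->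
    [/\ 0 < s, e <= w s & w s <= e^-1].
  apply: (@filter_forall _ _ (fun j e => forall s, `|s - q j ord0| <= e ->
    [/\ 0 < s, e <= w s & w s <= e^-1]) 0^'+) => j.
  have q0 : 0 < q j ord0 by exact: pi_gt0.
  have wq0 := w_gt0 q0; set c := w (q j ord0) in wq0.
  have c2 : 0 < c / 2 by rewrite divr_gt0.
  have /cvgrPdist_lt/(_ _ c2)/(@nbhs_normP _ _ (q j ord0))[d /= d0 hd] := cw q0.
  near=> e => s se.
  have e0 : 0 < e by [].
  have h1 : `|q j ord0 - s| < d.
    by rewrite distrC (le_lt_trans se) //; near: e; exact: nbhs_right_lt.
  have := hd _ h1; rewrite /= -/c => wcs.
  have e1 : e < q j ord0 by near: e; exact: nbhs_right_lt.
  have e2 : e < c / 2 by near: e; exact: nbhs_right_lt.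
  have e3 : e < (2 * c)^-1.
    by near: e; apply: nbhs_right_lt; rewrite invr_gt0 mulr_gt0.
  move: wcs se; rewrite ltr_norml ler_norml => /andP[w1 w2] /andP[s1 s2].
  split; [lra|lra|].
  apply: (@le_trans _ _ (2 * c)); first by lra.
  by rewrite -[leLHS]invrK lef_pV2 ?posrE ?invr_gt0 ?mulr_gt0 // ltW.
near (0 : R)^'+ => e; exists e; first by [].
by near: e; exact: h.
Unshelve. all: by end_near. Qed.

(* For [w s = s^(beta-1)] this is, up to a positive factor and a term depending on
   [p] only, the density power divergence between [p] and [pi th] (for [beta = 0],
   the Kullback-Leibler divergence, because the coordinates of [pi th] sum to 1). *)
Let objective (p : 'cV[R]_k) th :=
  \sum_j (E (pi th j ord0) - p j ord0 * l (pi th j ord0)).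

(* [E - a l] has derivative [(s - a) w s]. *)
Let bregman e (a s : R) : (forall x, `|x - a| <= e -> [/\ 0 < x, e <= w x & w x <= e^-1]) ->
  `|s - a| <= e ->
  e / 2 * (s - a) ^+ 2 <= (E s - a * l s) - (E a - a * l a) /\
  `|l s - l a| <= e^-1 * `|s - a|.
Proof.
move=> we sa.
have wpos x : `|x - a| <= `|s - a| -> [/\ 0 < x, e <= w x & w x <= e^-1].
  by move=> xs; apply: we; exact: le_trans sa.
split; last first.
  have [x xs|c [ca _ ->]] := @MVT_between R l w a s.
    by apply: Dl; case: (wpos _ xs).
  rewrite normrM ler_wpM2r //; have [? ? ?] := wpos _ ca.
  by rewrite gtr0_norm // w_gt0.
pose f x := E x - a * l x - e / 2 * (x - a) ^+ 2.
have df x : `|x - a| <= `|s - a| -> is_derive x (1 : R) f ((x - a) * (w x - e)).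
  move=> xs; have [x0 _ _] := wpos _ xs.
  have d1 := Dl x0; have d2 := DE x0.
  have -> : f = (E - a \*: l) - (e / 2) \*: ((id - cst a) ^+ 2).
    by apply/funext => y.
  apply: is_derive_eq; rewrite /GRing.scale /= (_ : (id - cst a) x = x - a) //.
  by field.
have [c [ca cs fc]] := @MVT_between R f _ a s df.
have [_ h _] := wpos _ ca.
have : 0 <= (c - a) * (w c - e) * (s - a).
  by rewrite mulrAC mulr_ge0 // subr_ge0.
by rewrite -fc /f subrr expr0n mulr0 subr0; lra.
Qed.

(** With D the distance of [pi th] from [q], the objective for [q] grows by at least e D^2 / 2,
    while replacing [q] by [p] changes the increment by at most k |p - q| D / e. Dividing by D gives
    the constant. *)
Let objective_lower e p th : 0 < e ->
  (forall j s, `|s - q j ord0| <= e -> [/\ 0 < s, e <= w s & w s <= e^-1]) ->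
  `|pi th - q| <= e -> objective p th <= objective p th0 ->
  `|pi th - q| <= 2 * k%:R / e ^+ 2 * `|p - q|.
Proof.
move=> e0 we pie Hle; set D := `|pi th - q| in pie *.
have cD j : `|pi th j ord0 - q j ord0| <= D.
  by have := mx_coord_le (pi th - q) j ord0; rewrite !mxE.
have h : \sum_j e / 2 * (pi th j ord0 - q j ord0) ^+ 2 <=
    \sum_(j < k) `|p - q| * (e^-1 * D).
  apply: (@le_trans _ _ (\sum_j ((E (pi th j ord0) - p j ord0 * l (pi th j ord0))
     - (E (q j ord0) - p j ord0 * l (q j ord0))
     + (p j ord0 - q j ord0) * (l (pi th j ord0) - l (q j ord0))))).
    apply: ler_sum => j _; have [h1 _] := bregman (we j) (le_trans (cD j) pie).
    by apply: (le_trans h1); rewrite le_eqVlt; apply/orP; left; apply/eqP; ring.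
  rewrite big_split sumrB /= -/(objective p th) -/(objective p th0).
  apply: (@le_trans _ _ (\sum_j (p j ord0 - q j ord0) *
      (l (pi th j ord0) - l (q j ord0)))); first by lra.
  apply: ler_sum => j _; have [_ h2] := bregman (we j) (le_trans (cD j) pie).
  apply: (le_trans (ler_norm _)); rewrite normrM ler_pM //.
    by have := mx_coord_le (p - q) j ord0; rewrite !mxE.
  by apply: (le_trans h2); rewrite ler_wpM2l // invr_ge0 ltW.
have [->|D0] := eqVneq D 0; first by rewrite !mulr_ge0 ?invr_ge0 ?sqr_ge0.
have Dgt : 0 < D by rewrite lt0r D0 /D normr_ge0.
have [[j i] Dj] := mx_norm_neq0 D0.
have {}Dj : D ^+ 2 = (pi th j ord0 - q j ord0) ^+ 2.
  by rewrite [D]Dj (ord1 i) real_normK ?num_real // !mxE.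
have h1 : e / 2 * D ^+ 2 <= \sum_j e / 2 * (pi th j ord0 - q j ord0) ^+ 2.
  rewrite Dj (bigD1 j) //= lerDl; apply: sumr_ge0 => a _.
  by rewrite mulr_ge0 ?sqr_ge0 // divr_ge0 // ltW.
have := le_trans h1 h; rewrite sumr_const card_ord -[X in _ <= X]mulr_natl.
rewrite expr2 !mulrA ler_pM2r // => h2.
have e2 : 0 < e / 2 by rewrite divr_gt0.
rewrite -(ler_pM2l e2); apply: (le_trans h2).
rewrite le_eqVlt; apply/orP; left; apply/eqP; field.
exact: lt0r_neq0.
Qed.

Let pi_remainder (e : R) : 0 < e ->
  \forall th \near th0, `|pi th - q - W th0 *m (th - th0)| <= e * `|th - th0|.
Proof. by apply: mx_remainder => [i|i v]; [exact: dpi|exact: Dpi]. Qed.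

Let m_remainder (e : R) : 0 < e ->
  \forall th \near th0, `|m th - M0^T *m (th - th0)| <= e * `|th - th0|.
Proof.
move=> e0; have := @mx_remainder R n r m M0^T th0 (dm inb0) (Dm inb0) e e0.
by apply: filterS => th; rewrite m0 subr0.
Qed.

Let invJG : invmx J *m G th0 *m W th0 = 1%:M.
Proof. by rewrite -(mulmxA (invmx J) (G th0) (W th0)) mulVmx. Qed.

(** [invmx J *m G th0] is a left inverse of [W th0]. The remainder is taken with tolerance 1 / (2
    c), so that half of |th - th0| is absorbed and the constant doubles. *)
Let inverse_bound : exists2 a : R, 0 < a &
  \forall th \near th0, `|th - th0| <= a * `|pi th - q|.
Proof.
pose c := k%:R * `|invmx J *m G th0| + 1.
have c0 : 0 < c by rewrite ltr_wpDl // mulr_ge0.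
have c2 : 0 < (2 * c)^-1 by rewrite invr_gt0 mulr_gt0.
exists (2 * c); first by rewrite mulr_gt0.
apply: filterS (pi_remainder c2) => th; set h := th - th0; set D := pi th - q => hr.
have h1 : `|h| <= c * `|W th0 *m h|.
  have -> : `|h| = `|(invmx J *m G th0) *m (W th0 *m h)|.
    by rewrite (mulmxA (invmx J *m G th0) (W th0) h) invJG mul1mx.
  by apply: (le_trans (mulmx_norm_le _ _)); rewrite ler_wpM2r // lerDl.
have h2 : `|W th0 *m h| <= `|D| + (2 * c)^-1 * `|h|.
  have -> : W th0 *m h = D - (D - W th0 *m h) by rewrite opprB addrC subrK.
  by apply: (le_trans (ler_normB _ _)); rewrite lerD2l.
have h3 : c * (`|D| + (2 * c)^-1 * `|h|) = c * `|D| + `|h| / 2.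
  by field; exact: lt0r_neq0.
have : `|h| <= c * `|D| + `|h| / 2.
  by rewrite -h3; apply: (le_trans h1); rewrite ler_wpM2l // ltW.
by rewrite -mulrA; lra.
Qed.

(** [L0] is a left inverse of [M0]. Continuity of [M] makes the perturbation cost at most half of
    |lam|, so injectivity persists near [th0] with a uniform constant. *)
Let multiplier_bound : exists2 b : R, 0 < b &
  \forall th \near th0, forall lam : 'cV[R]_r, `|lam| <= b * `|M th *m lam|.
Proof.
pose L0 := invmx (M0^T *m invmx J *m M0) *m (M0^T *m invmx J).
pose c := n%:R * `|L0| + 1.
have c0 : 0 < c by rewrite ltr_wpDl // mulr_ge0.
have r1 : 0 < r%:R + 1 :> R by rewrite ltr_wpDl.
exists (2 * c); first by rewrite mulr_gt0.
have c2 : 0 < (2 * c * (r%:R + 1))^-1 by rewrite invr_gt0 !mulr_gt0.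
have /(@cvgrPdist_lt _ _ _ (nbhs th0) _)/(_ _ c2) := cM inb0.
apply: filterS => th hM lam.
have e : lam = L0 *m (M th *m lam) + L0 *m ((M th0 - M th) *m lam).
  rewrite -mulmxDr -mulmxDl addrC subrK /L0 mulmxA -(mulmxA (invmx _)) mulVmx //.
  by rewrite mul1mx.
have h1 : `|(M th0 - M th) *m lam| <= (2 * c)^-1 * `|lam|.
  apply: (le_trans (mulmx_norm_le _ _)); rewrite ler_wpM2r //.
  apply: (@le_trans _ _ ((r%:R + 1) * (2 * c * (r%:R + 1))^-1)).
    by rewrite ler_pM // ?lerDl // ltW.
  by rewrite le_eqVlt; apply/orP; left; apply/eqP; field; rewrite !lt0r_neq0.
have bd (y : 'cV[R]_n) : `|L0 *m y| <= c * `|y|.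
  by apply: (le_trans (mulmx_norm_le _ _)); rewrite ler_wpM2r // lerDl.
have : `|lam| <= c * `|M th *m lam| + `|lam| / 2.
  rewrite {1}e; apply: (le_trans (ler_normD _ _)); rewrite lerD //.
  apply: (le_trans (bd _)).
  have -> : `|lam| / 2 = c * ((2 * c)^-1 * `|lam|) by field; exact: lt0r_neq0.
  by rewrite ler_wpM2l // ltW.
by rewrite -mulrA; lra.
Qed.

(** Partial derivatives vanish at a local minimum. The penalty contributes 2 K M(th) m(th), so - 2 K
    m(th) stands where the Lagrange multiplier does; the sign comes from the objective having
    gradient - G (p - pi). *)
Let gradient_zero p (K : R) th :
  inb th -> (\forall t \near th, objective p th + K * \sum_i m th i ord0 ^+ 2 <=
     objective p t + K * \sum_i m t i ord0 ^+ 2) ->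
  G th *m (p - pi th) + M th *m (- (2 * K) *: m th) = 0.
Proof.
move=> hth tmin; apply/colP => c; rewrite [RHS]mxE.
pose v : 'cV[R]_n := delta_mx c ord0.
pose f s := \sum_j (E (pi (s *: v + th) j ord0) - p j ord0 * l (pi (s *: v + th) j ord0))
  + K * \sum_i m (s *: v + th) i ord0 ^+ 2.
pose d := \sum_j ((pi th j ord0 - p j ord0) * w (pi th j ord0) * (W th *m v) j ord0)
  + K * \sum_i (2 * m th i ord0 * ((M th)^T *m v) i ord0).
have f0 : forall j, pi (0 *: v + th) j ord0 = pi th j ord0.
  by move=> j; rewrite scale0r add0r.
have fm0 : forall j, m (0 *: v + th) j ord0 = m th j ord0.
  by move=> j; rewrite scale0r add0r.
have df : is_derive (0 : R) (1 : R) f d.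
  have dj j : is_derive (0 : R) (1 : R) (fun s => pi (s *: v + th) j ord0) ((W th *m v) j ord0).
    by rewrite -Dpi //; apply: is_derive_line; exact: dpi.
  have dmi i : is_derive (0 : R) (1 : R) (fun s => m (s *: v + th) i ord0)
      (((M th)^T *m v) i ord0).
    by rewrite -Dm //; apply: is_derive_line; exact: dm.
  have d1 j : is_derive (0 : R) (1 : R) (fun s => E (pi (s *: v + th) j ord0)
      - p j ord0 * l (pi (s *: v + th) j ord0))
      ((pi th j ord0 - p j ord0) * w (pi th j ord0) * (W th *m v) j ord0).
    have p0 : 0 < pi (0 *: v + th) j ord0 by rewrite f0; exact: pi_gt0.
    have e1 := @is_derive1_comp _ E _ _ _ _ (DE p0) (dj j).
    have e2 := @is_derive1_comp _ l _ _ _ _ (Dl p0) (dj j).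
    have e3 := is_deriveB e1 (is_deriveZ (p j ord0) e2).
    by apply: (is_derive_eq e3); rewrite f0 /GRing.scale /=; ring.
  have d2 i : is_derive (0 : R) (1 : R) (fun s => m (s *: v + th) i ord0 ^+ 2)
      (2 * m th i ord0 * ((M th)^T *m v) i ord0).
    have e3 := is_deriveX 2 (dmi i).
    by apply: (is_derive_eq e3); rewrite fm0 /GRing.scale /= expr1.
  have -> : f = \sum_(j < k) (fun s => E (pi (s *: v + th) j ord0)
      - p j ord0 * l (pi (s *: v + th) j ord0)) +
      K \*: \sum_(i < r) (fun s => m (s *: v + th) i ord0 ^+ 2).
    by apply/funext => s; rewrite /f !fctE !fct_sumE.
  exact: is_deriveD.
have d0 : d = 0.
  apply: (local_min_derive0 df).
  have cl : {for 0 : R, continuous (fun s : R => s *: v + th)}.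
    apply: (@cvgD _ _ _ (nbhs (0 : R))); last exact: cvg_cst.
    exact: scalel_continuous.
  have tmin' : nbhs (0 *: v + th) (fun t => objective p th + K * \sum_i m th i ord0 ^+ 2 <=
     objective p t + K * \sum_i m t i ord0 ^+ 2) by rewrite scale0r add0r.
  have h : nbhs (0 : R) [set s | objective p th + K * \sum_i m th i ord0 ^+ 2 <=
     objective p (s *: v + th) + K * \sum_i m (s *: v + th) i ord0 ^+ 2] := cl _ tmin'.
  apply: (@filterS _ (nbhs (0 : R)) _ _ _ _ h) => s /=.
  by rewrite /f /objective scale0r add0r.
have vc a (A : 'M[R]_(a, n)) j : (A *m v) j ord0 = A j c.
  rewrite mxE (bigD1 c) //= big1 => [|i /negbTE ic].
    by rewrite mxE !eqxx mulr1 addr0.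
  by rewrite mxE ic mulr0.
apply/eqP; rewrite -oppr_eq0 -[X in _ == X]d0 /d; apply/eqP.
rewrite mxE opprD; congr (_ + _).
  rewrite /weighted_score mul_mx_diag mxE -sumrN; apply: eq_bigr => j _.
  by rewrite vc !mxE; ring.
rewrite -scalemxAr mxE mulNr opprK -mulrA mulrCA; congr (_ * _).
rewrite mxE mulr_sumr; apply: eq_bigr => i _.
by rewrite vc mxE; ring.
Qed.

Let local_radius : exists C b d : R, [/\ 0 < C, 0 < b, 0 < d, d <= rho &
  forall th, `|th - th0| <= d ->
    (forall p, objective p th <= objective p th0 -> `|th - th0| <= C * `|p - q|) /\
    (forall lam : 'cV[R]_r, `|lam| <= b * `|M th *m lam|)].
Proof.
have [e e0 we] := weight_bounds.
have [a a0 ha] := inverse_bound.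
have [b b0 hb] := multiplier_bound.
have he : \forall th \near th0, `|pi th - q| < e.
  have /(@cvgrPdist_lt _ _ _ (nbhs th0) _)/(_ _ e0) := cpi inb0.
  by apply: filterS => th; rewrite distrC.
have [d /= d0 hd] := (@nbhs_normP _ _ th0 _).1 (filterI ha (filterI hb he)).
exists (a * (2 * k%:R / e ^+ 2) + 1), b, (Num.min (d / 2) rho).
have d2 : d / 2 < d by rewrite gtr_pMr // invf_lt1 // ltr1n.
split=> //.
- by rewrite ltr_wpDl // !mulr_ge0 ?invr_ge0 ?sqr_ge0 // ltW.
- by rewrite lt_min divr_gt0 //= rho_gt0.
- by rewrite ge_min lexx orbT.
move=> th; rewrite le_min => /andP[thd _].
have [h1 [h2 h3]] : [set t | `|t - th0| <= a * `|pi t - q|] th /\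
    (forall lam : 'cV[R]_r, `|lam| <= b * `|M th *m lam|) /\ `|pi th - q| < e.
  by apply: hd; rewrite /= distrC (le_lt_trans thd).
split=> // p Hp; have := objective_lower e0 we (ltW h3) Hp => h4.
apply: (le_trans h1); apply: (@le_trans _ _ (a * (2 * k%:R / e ^+ 2 * `|p - q|))).
  by rewrite ler_wpM2l // ltW.
by rewrite mulrA ler_wpM2r // lerDl.
Qed.

Let penalty_continuous p (K : R) th : inb th ->
  {for th, continuous (fun t => objective p t + K * \sum_i m t i ord0 ^+ 2)}.
Proof.
move=> hth; apply: (@cvgD _ _ _ (nbhs th)).
  apply: (@cvg_sumr _ _ _ (nbhs th)) => j _.
  have p0 := pi_gt0 hth j; have d1 := Dl p0; have d2 := DE p0.
  have cj : {for th, continuous (fun t => pi t j ord0)}.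
    exact: differentiable_continuous (dpi hth j).
  apply: (@cvgB _ _ _ (nbhs th)).
    apply: (continuous_comp cj); apply: differentiable_continuous.
    by apply/derivable1_diffP; exact: ex_derive.
  apply: (@cvgMr _ _ (nbhs th)).
  apply: (continuous_comp cj); apply: differentiable_continuous.
  by apply/derivable1_diffP; exact: ex_derive.
apply: (@cvgMr _ _ (nbhs th)); apply: (@cvg_sumr _ _ _ (nbhs th)) => i _.
have ci : {for th, continuous (fun t => m t i ord0)}.
  exact: differentiable_continuous (dm hth i).
exact: (@cvgM _ _ (nbhs th) _ _ _ _ _ ci ci).
Qed.

(* The multiplier [- 2 K m th] of a penalised minimiser stays bounded because [M th]
   has a left inverse near [th0]; minimising the defect [gap] over a compact set of
   pairs (parameter, multiplier) replaces the extraction of a limit as [K] grows. *)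
Lemma constrained_root : exists C b d : R, [/\ 0 < C, 0 < b & 0 < d /\
  forall p : 'cV[R]_k, `|p - q| < d -> exists th (lam : 'cV[R]_r),
    [/\ `|th - th0| <= C * `|p - q|, inb th, m th = 0,
        `|lam| <= b * `|M th *m lam| &
        G th *m (p - pi th) + M th *m lam = 0]].
Proof.
have [C [b [d [C0 b0 d0 drho hloc]]]] := local_radius.
(* Minimisers satisfy the bound with [C], so a ball with [2 * C] keeps them strictly inside, and the
   last constant keeps that ball within the radius [d]. *)
exists (2 * C), b, (d / (2 * C)).
have C2 : 0 < 2 * C by rewrite mulr_gt0.
split=> //; split; first by rewrite divr_gt0.
move=> p; rewrite ltr_pdivlMr // => pd.
(* For p = q the ball shrinks to a point without interior; [th0] with multiplier 0 is the root. *)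
have [pq|pq] := eqVneq p q.
  exists th0, 0; split; first by rewrite pq !subrr !normr0 mulr0.
  - exact: inb0.
  - exact: m0.
  - by rewrite mulmx0 !normr0 mulr0.
  - by rewrite pq subrr !mulmx0 addr0.
have x0 : 0 < `|p - q| by rewrite normr_gt0 subr_eq0.
set r0 := 2 * C * `|p - q|; have r00 : 0 < r0 by rewrite mulr_gt0.
pose S := [set th : 'cV[R]_n | `|th - th0| <= r0].
have Sb th : S th -> `|th - th0| <= d.
  by move=> h; apply: (le_trans h); rewrite /r0 mulrC ltW.
have Sin th : S th -> inb th by move=> /Sb h; exact: le_trans drho.
have cS : compact S by exact: cV_closed_ball_compact.
have S0 : S !=set0 by exists th0; rewrite /S /= subrr normr0 ltW.
have cw' (f : 'cV[R]_n -> R) : (forall th, inb th -> {for th, continuous f}) ->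
    {within S, continuous f}.
  by move=> cf; apply: continuous_in_subspaceT => th; rewrite inE => /Sin /cf.
pose score th := G th *m (p - pi th).
have cscore th : inb th -> {for th, continuous score}.
  move=> hth; apply: mulmx_continuous; first exact: cG.
  by apply: (@cvgB _ _ _ (nbhs th)); [exact: cvg_cst|exact: cpi].
(* The maximal score bounds all multipliers, which confines them to a compact set; the minimal
   objective found next bounds what the penalty can cost. *)
have [tB _ scB] : exists2 c, c \in S & forall t, t \in S -> `|score t| <= `|score c|.
  apply: (compact_EVT_max S0 cS); apply: cw' => th hth.
  by apply: (@cvg_norm _ _ _ (nbhs th)); exact: cscore.
have [tL _ objL] : exists2 c, c \in S & forall t, t \in S -> objective p c <= objective p t.
  apply: (compact_EVT_min S0 cS); apply: cw' => th hth.
  have := @penalty_continuous p 0 th hth.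
  have -> // : (fun t => objective p t + 0 * \sum_i m t i ord0 ^+ 2) = objective p.
  by apply/funext => t; rewrite mul0r addr0.
pose Lam := [set lam : 'cV[R]_r | `|lam - 0| <= b * `|score tB|].
have cLam : compact Lam by exact: cV_closed_ball_compact.
pose gap (z : 'cV[R]_n * 'cV[R]_r) :=
  `|score z.1 + M z.1 *m z.2| + \sum_i m z.1 i ord0 ^+ 2.
have cgap : {within S `*` Lam, continuous gap}.
  apply: continuous_in_subspaceT => -[th lam]; rewrite inE => -[/= /Sin hth _].
  have c1 : {for (th, lam), continuous (fun z : 'cV[R]_n * 'cV[R]_r => z.1)}.
    exact: cvg_fst.
  have c2 : {for (th, lam), continuous (fun z : 'cV[R]_n * 'cV[R]_r => z.2)}.
    exact: cvg_snd.
  apply: (@cvgD _ _ _ (nbhs (th, lam))).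
    apply: (@cvg_norm _ _ _ (nbhs (th, lam))); apply: (@cvgD _ _ _ (nbhs (th, lam))).
      by apply: (continuous_comp c1); exact: cscore.
    apply: mulmx_continuous; last exact: c2.
    by apply: (continuous_comp c1); exact: cM.
  apply: (@cvg_sumr _ _ _ (nbhs (th, lam))) => i _.
  have ci : {for (th, lam), continuous (fun z : 'cV[R]_n * 'cV[R]_r => m z.1 i ord0)}.
    apply: (@continuous_comp _ _ _ fst (fun t => m t i ord0)); first exact: c1.
    exact: differentiable_continuous (dm hth i).
  exact: (@cvgM _ _ (nbhs (th, lam)) _ _ _ _ _ ci ci).
have step (N : nat) : exists z, (S `*` Lam) z /\
    gap z <= (objective p th0 - objective p tL) / N.+1%:R.
  pose K : R := N.+1%:R.
  have [t tS tmin] : exists2 c, c \in S & forall t, t \in S ->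
      objective p c + K * \sum_i m c i ord0 ^+ 2 <=
      objective p t + K * \sum_i m t i ord0 ^+ 2.
    by apply: (compact_EVT_min S0 cS); apply: cw' => th; exact: penalty_continuous.
  have K0 : 0 < K by rewrite ltr0Sn.
  have sq0 (u : 'cV[R]_n) : 0 <= \sum_i m u i ord0 ^+ 2.
    by apply: sumr_ge0 => i _; exact: sqr_ge0.
  have th0S : th0 \in S by rewrite inE /S /= subrr normr0 ltW.
  (* Comparison with [th0], where the penalty is zero, is used twice: it bounds the objective at
     [t], which puts [t] in the interior, and it bounds K |m(t)|^2, which makes the gap of order 1 /
     K. *)
  have := tmin _ th0S; rewrite m0 [X in _ <= _ + _ * X]big1; last first.
    by move=> i _; rewrite mxE expr0n.
  rewrite mulr0 addr0 => Hle.
  have tS' : S t by rewrite inE in tS.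
  have [hp hl] := hloc _ (Sb _ tS').
  have Ksq := mulr_ge0 (ltW K0) (sq0 t).
  have tint : `|t - th0| < r0.
    have : `|t - th0| <= C * `|p - q| by apply: hp; lra.
    by move=> /le_lt_trans; apply; rewrite /r0 -mulrA ltr_pMl ?mulr_gt0 // ltr1n.
  have gz : score t + M t *m (- (2 * K) *: m t) = 0.
    apply: gradient_zero; first exact: Sin.
    apply/(@nbhs_normP _ _ t); exists (r0 - `|t - th0|) => /=; first by rewrite subr_gt0.
    move=> u /= tu; apply: tmin; rewrite inE /S /= -(subrKA t).
    apply: (le_trans (ler_normD _ _)); rewrite [`|u - t|]distrC.
    by apply: ltW; rewrite -ltrBrDr.
  exists (t, - (2 * K) *: m t); split.
    split=> //=; rewrite /Lam /= subr0; apply: (le_trans (hl _)).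
    rewrite ler_pM2l // -[M t *m _](addKr (score t)) gz addr0 normrN.
    exact: scB.
  rewrite /gap /= gz normr0 add0r ler_pdivlMr // mulrC.
  have := objL _ tS; lra.
have SL0 : (S `*` Lam) !=set0 by have [z [zS _]] := step 0%N; exists z.
have [[th lam] zS zmin] := compact_EVT_min SL0 (compact_setX cS cLam) cgap.
have [thS lamL] : S th /\ Lam lam by rewrite inE in zS; case: zS.
have gap0 : gap (th, lam) <= 0.
  apply/ler_addgt0Pr => e e0.
  rewrite add0r; set H := objective p th0 - objective p tL in step.
  pose N := Num.truncn (H / e).
  have [z [zS' hz]] := step N.
  have zin : z \in S `*` Lam by rewrite inE.
  apply: (le_trans (zmin _ zin)); apply: (le_trans hz).
  by rewrite ler_pdivrMr // mulrC -ler_pdivrMr // ltW // truncnS_gt.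
have s0 : 0 <= \sum_i m th i ord0 ^+ 2 by apply: sumr_ge0 => i _; exact: sqr_ge0.
have n0 : 0 <= `|score th + M th *m lam| by [].
rewrite /gap /= in gap0.
exists th, lam; split.
- exact: thS.
- exact: Sin.
- have /eqP : \sum_i m th i ord0 ^+ 2 = 0 by lra.
  rewrite psumr_eq0 => [/allP h|i _]; last exact: sqr_ge0.
  apply/colP => i; rewrite mxE; apply/eqP.
  by have := h i (mem_index_enum _); rewrite sqrf_eq0.
- by have [_ hl] := hloc _ (Sb _ thS).
- by apply/eqP; rewrite -normr_eq0; apply/eqP; move: n0; rewrite -/(score th); lra.
Qed.

Let Q := invmx J *m M0 *m invmx (M0^T *m invmx J *m M0).
Let P := invmx J - Q *m M0^T *m invmx J.

Let PM0 : P *m M0 = 0.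
Proof.
rewrite /P mulmxBl -(mulmxA (Q *m M0^T)) -(mulmxA Q) (mulmxA M0^T) /Q.
by rewrite -(mulmxA (invmx J *m M0)) mulVmx // mulmx1 subrr.
Qed.

Let PGW : P *m G th0 *m W th0 = 1%:M - Q *m M0^T.
Proof.
rewrite -(mulmxA P (G th0) (W th0)) -/J /P mulmxBl mulVmx //.
by rewrite -(mulmxA (Q *m M0^T)) mulVmx // mulmx1.
Qed.

(** Exact, with four errors: the linearisations of [m] (where m(th) = 0) and of [pi], and the
    variations of [G] and [M] away from [th0]. Since P M0 = 0, the multiplier survives only against
    M(th) - M0. *)
Let error_identity (p : 'cV[R]_k) th (lam : 'cV[R]_r) :
  G th *m (p - pi th) + M th *m lam = 0 ->
  th - th0 - P *m G th0 *m (p - q) =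
  Q *m (M0^T *m (th - th0))
  - P *m G th0 *m (pi th - q - W th0 *m (th - th0))
  + P *m ((G th - G th0) *m (p - pi th)) + P *m ((M th - M0) *m lam).
Proof.
move=> eq0; move/(congr1 (mulmx P)): (eq0); rewrite mulmx0 mulmxDr => Pz.
set h := th - th0.
have Ph : P *m G th0 *m (W th0 *m h) = h - Q *m (M0^T *m h).
  by rewrite (mulmxA (P *m G th0) (W th0)) PGW mulmxBl mul1mx mulmxA.
rewrite (mulmxBr (P *m G th0) (pi th - q)) Ph.
rewrite (mulmxBl (G th) (G th0)) (mulmxBl (M th) M0).
rewrite (mulmxBr P (G th *m _)) (mulmxBr P (M th *m _)).
rewrite (mulmxA P M0) PM0 mul0mx subr0 (mulmxA P (G th0)).
have -> : P *m (G th *m (p - pi th)) = - (P *m (M th *m lam)).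
  by apply/eqP; rewrite -addr_eq0 Pz.
have -> : p - pi th = (p - q) - (pi th - q) by rewrite opprB addrA subrK.
rewrite (mulmxBr (P *m G th0) (p - q)).
move: (P *m G th0 *m (p - q)) (P *m G th0 *m (pi th - q)) (P *m (M th *m lam))
  (Q *m (M0^T *m h)) => a c d e.
by apply/colP => i; rewrite !mxE; ring.
Qed.

Lemma root_expansion (C b eps : R) : 0 < C -> 0 < b -> 0 < eps ->
  exists2 d : R, 0 < d & forall (p : 'cV[R]_k) th (lam : 'cV[R]_r),
    `|p - q| < d -> `|th - th0| <= C * `|p - q| -> m th = 0 ->
    `|lam| <= b * `|M th *m lam| -> G th *m (p - pi th) + M th *m lam = 0 ->
    `|th - th0 - P *m G th0 *m (p - q)| <= eps * `|p - q|.
Proof.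
move=> C0 b0 eps0.
(* In units of |p - q|, [c3] bounds |p - pi th|, [c4] bounds the multiplier, and [c5] collects the
   four error terms after a common factor [z] is taken out. *)
pose c3 := 1 + (n%:R * `|W th0| + 1) * C.
pose c4 := b * (k%:R * (`|G th0| + 1)) * c3.
pose c5 := r%:R * `|Q| * C + k%:R * `|P *m G th0| * C
  + n%:R * `|P| * (k%:R * c3) + n%:R * `|P| * (r%:R * c4).
have C0' := ltW C0; have b0' := ltW b0.
have c30 : 0 <= c3 by rewrite addr_ge0 // mulr_ge0 // addr_ge0 // mulr_ge0.
have c40 : 0 <= c4 by rewrite !mulr_ge0 // addr_ge0.
have c50 : 0 <= c5 by rewrite !addr_ge0 // !mulr_ge0.
have c51 : 0 < c5 + 1 by rewrite ltr_wpDl.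
(* The cap 1 supplies the a priori bounds on [G th] and on the remainder of [pi] that [c3] and [c4]
   presuppose. *)
pose z := Num.min 1 (eps / (c5 + 1)).
have z0 : 0 < z by rewrite lt_min ltr01 divr_gt0.
have z1 : z <= 1 by rewrite ge_min lexx.
have zc : z * c5 <= eps.
  apply: (@le_trans _ _ (eps / (c5 + 1) * (c5 + 1))).
    apply: ler_pM => //; first exact: ltW.
      by rewrite ge_min lexx orbT.
    by rewrite lerDl.
  by rewrite divfK // lt0r_neq0.
have /(@cvgrPdist_lt _ _ _ (nbhs th0) _)/(_ _ z0) nG := cG inb0.
have /(@cvgrPdist_lt _ _ _ (nbhs th0) _)/(_ _ z0) nM := cM inb0.
have [d /= d0 hd] := (@nbhs_normP _ _ th0 _).1
  (filterI (filterI nG nM) (filterI (pi_remainder z0) (m_remainder z0))).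
exists (d / C); first by rewrite divr_gt0.
move=> p th lam; rewrite ltr_pdivlMr // => pd hC mth hlam eq0.
set x := p - q in pd hC *.
have [[hG hM] [hp hm]] : (`|G th0 - G th| < z /\ `|M th0 - M th| < z) /\
    (`|pi th - q - W th0 *m (th - th0)| <= z * `|th - th0| /\
     `|m th - M0^T *m (th - th0)| <= z * `|th - th0|).
  by apply: hd; rewrite /= distrC (le_lt_trans hC) // mulrC.
rewrite (error_identity eq0) -/x; set h := th - th0 in hC hp hm *.
have {}hm : `|M0^T *m h| <= z * (C * `|x|).
  move: hm; rewrite mth sub0r normrN => /le_trans; apply.
  by rewrite ler_wpM2l // ltW.
have {}hp' : `|pi th - q - W th0 *m h| <= z * (C * `|x|).
  by apply: (le_trans hp); rewrite ler_wpM2l // ltW.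
have hs : `|p - pi th| <= c3 * `|x|.
  have -> : p - pi th = x - ((pi th - q - W th0 *m h) + W th0 *m h).
    by rewrite subrK /x opprB addrA subrK.
  apply: (le_trans (ler_normB _ _)); rewrite /c3 mulrDl mul1r lerD2l.
  apply: (le_trans (ler_normD _ _)); rewrite -mulrA mulrDl addrC mul1r lerD //.
    by apply: (le_trans (mulmx_norm_le _ _)); rewrite ler_wpM2l // mulr_ge0.
  by apply: (le_trans hp'); rewrite ler_piMl // mulr_ge0.
have nGth : `|G th| <= `|G th0| + 1.
  rewrite -[G th](subKr (G th0)); apply: (le_trans (ler_normB _ _)).
  by rewrite lerD2l (le_trans (ltW hG)).
have hl : `|lam| <= c4 * `|x|.
  apply: (le_trans hlam); rewrite /c4 -!mulrA ler_wpM2l //.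
  rewrite -[M th *m lam](addKr (G th *m (p - pi th))) eq0 addr0 normrN.
  apply: (le_trans (mulmx_norm_le _ _)); rewrite -mulrA ler_wpM2l //.
  by rewrite ler_pM.
have -> : eps * `|x| = z * c5 * `|x| + (eps - z * c5) * `|x| by ring.
rewrite -[leLHS]addr0 lerD //; last by rewrite mulr_ge0 // subr_ge0.
have -> : z * c5 * `|x| = r%:R * `|Q| * (z * (C * `|x|))
  + k%:R * `|P *m G th0| * (z * (C * `|x|))
  + n%:R * `|P| * (k%:R * z * (c3 * `|x|)) + n%:R * `|P| * (r%:R * z * (c4 * `|x|)).
  by rewrite /c5; ring.
apply: (le_trans (ler_normD _ _)); apply: lerD.
  apply: (le_trans (ler_normD _ _)); apply: lerD.
    apply: (le_trans (ler_normB _ _)); apply: lerD.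
      by apply: (le_trans (mulmx_norm_le _ _)); rewrite ler_wpM2l // mulr_ge0.
    by apply: (le_trans (mulmx_norm_le _ _)); rewrite ler_wpM2l // mulr_ge0.
  apply: (le_trans (mulmx_norm_le _ _)); rewrite ler_wpM2l ?mulr_ge0 //.
  apply: (le_trans (mulmx_norm_le _ _)); rewrite ler_pM ?mulr_ge0 //.
  by rewrite ler_wpM2l // distrC ltW.
apply: (le_trans (mulmx_norm_le _ _)); rewrite ler_wpM2l ?mulr_ge0 //.
apply: (le_trans (mulmx_norm_le _ _)); rewrite ler_pM ?mulr_ge0 //.
by rewrite ler_wpM2l // distrC ltW.
Qed.

End ConstrainedRoot.

(** * The step-stress model *)

Section ContinuouslyDifferentiable.
Variables (R : realType) (V : normedModType R).
Implicit Types (f g : V -> R) (phi dphi : R -> R).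

Lemma near_eq_differentiable f g (x : V) : (\forall t \near x, f t = g t) ->
  differentiable f x -> differentiable g x.
Proof.
move=> fg df; have fx : f x = g x := nbhs_singleton fg.
have gx : g \o shift x = cst (g x) + 'd f x +o_ (0 : V) id.
  apply/eqaddoP => e e0.
  have [d1 /= d10 h1] := (@nbhs_normP _ _ x _).1 fg.
  have [d2 /= d20 h2] : nbhs_ball_ (ball_ Num.norm) (0 : V) (fun h =>
    `|(f \o shift x - (cst (f x) + 'd f x)) h| <= e * `|h|).
    by apply/(@nbhs_normP _ _ (0 : V)); have := diff_locally df => /eqaddoP/(_ _ e0).
  apply/(@nbhs_normP _ _ (0 : V)); exists (Num.min d1 d2); first by rewrite /= lt_min d10.
  move=> h /=; rewrite sub0r normrN lt_min => /andP[hd1 hd2].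
  have := h2 h; rewrite /= sub0r normrN => /(_ hd2).
  have -> : (g \o shift x - (cst (g x) + 'd f x)) h =
      (f \o shift x - (cst (f x) + 'd f x)) h; last by [].
  rewrite -[LHS]/(g (h + x) - (g x + 'd f x h)).
  rewrite -[RHS]/(f (h + x) - (f x + 'd f x h)) fx h1 //=.
  by rewrite opprD addrCA subrr addr0 normrN.
have dc : continuous ('d f x) by exact: diff_continuous.
by apply/diff_locallyP; rewrite (diff_unique dc gx).
Qed.

(** Differentiability is asked on a neighbourhood so that derivative formulas hold near [x], and
    continuity of the derivatives passes through sums, products and compositions. *)
Definition C1at f x := (\forall t \near x, differentiable f t) /\
  forall v, {for x, continuous (fun t => 'D_v f t)}.

Lemma C1at_differentiable f x : C1at f x -> differentiable f x.
Proof. by move=> [/nbhs_singleton]. Qed.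

Lemma C1at_continuous f x : C1at f x -> {for x, continuous f}.
Proof. by move=> /C1at_differentiable/differentiable_continuous. Qed.

Lemma near_eq_for_continuous f g x : (\forall t \near x, f t = g t) ->
  {for x, continuous f} -> {for x, continuous g}.
Proof.
move=> fg cf; rewrite /prop_for /continuous_at -(nbhs_singleton fg).
exact: cvg_trans (near_eq_cvg fg) cf.
Qed.

Lemma C1at_near f g x : (\forall t \near x, f t = g t) -> C1at f x -> C1at g x.
Proof.
move=> fg [df cf]; have fg2 : \forall t \near x, \forall u \near t, f u = g u.
  exact: nbhs_interior.
split=> [|v].
  near=> t; apply: (@near_eq_differentiable f); first by near: t.
  by near: t.
apply: near_eq_for_continuous (cf v); near=> t.
by apply: near_eq_derive; near: t.
Unshelve. all: by end_near. Qed.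

Lemma C1at_cst (a : R) x : C1at (cst a) x.
Proof.
split=> [|v]; first by apply: nearW => t; exact: differentiable_cst.
have -> : (fun t : V => 'D_v (cst a : V -> R) t) = cst 0.
  by apply/funext => t; rewrite derive_cst.
exact: cst_continuous.
Qed.

Lemma C1atD f g x : C1at f x -> C1at g x -> C1at (fun t => f t + g t) x.
Proof.
move=> [df cf] [dg cg]; split=> [|v].
  by near=> t; apply: differentiableD; near: t.
have cfg : {for x, continuous (fun t => 'D_v f t + 'D_v g t)}.
  by apply: (@cvgD _ _ _ (nbhs x)); [exact: cf|exact: cg].
apply: near_eq_for_continuous cfg; near=> t; apply/esym/deriveD.
  by apply: diff_derivable; near: t.
by apply: diff_derivable; near: t.
Unshelve. all: by end_near. Qed.

Lemma C1atM f g x : C1at f x -> C1at g x -> C1at (fun t => f t * g t) x.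
Proof.
move=> Cf Cg; have [df cf] := Cf; have [dg cg] := Cg; split=> [|v].
  by near=> t; apply: differentiableM; near: t.
have cfg : {for x, continuous (fun t => f t * 'D_v g t + g t * 'D_v f t)}.
  apply: (@cvgD _ _ _ (nbhs x)); apply: (@cvgM _ _ (nbhs x)).
  - exact: C1at_continuous Cf.
  - exact: cg.
  - exact: C1at_continuous Cg.
  - exact: cf.
apply: near_eq_for_continuous cfg; near=> t; apply/esym/deriveM.
  by apply: diff_derivable; near: t.
by apply: diff_derivable; near: t.
Unshelve. all: by end_near. Qed.

Lemma C1at_comp phi dphi f x : C1at f x ->
  (\forall s \near f x, is_derive s (1 : R) phi (dphi s)) ->
  {for f x, continuous dphi} -> C1at (fun t => phi (f t)) x.
Proof.
move=> Cf dp cp; have [df cf] := Cf.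
have dp2 : \forall t \near x, is_derive (f t) (1 : R) phi (dphi (f t)).
  by have := C1at_continuous Cf; move=> /(_ _ dp).
have dcomp (t : V) : differentiable f t -> is_derive (f t) (1 : R) phi (dphi (f t)) ->
    differentiable (fun t => phi (f t)) t.
  move=> dft dpt; apply: (@differentiable_comp _ _ _ _ f phi) => //.
  by apply/derivable1_diffP; exact: ex_derive.
split=> [|v]; first by near=> t; apply: dcomp; near: t.
have cfg : {for x, continuous (fun t => dphi (f t) * 'D_v f t)}.
  apply: (@cvgM _ _ (nbhs x)); last exact: cf.
  exact: (continuous_comp (C1at_continuous Cf) cp).
apply: near_eq_for_continuous cfg; near=> t.
have dft : differentiable f t by near: t.
have dpt : is_derive (f t) (1 : R) phi (dphi (f t)) by near: t.
have l1 := is_derive_line v dft.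
have l2 := is_derive_line v (dcomp t dft dpt).
have dpt' : is_derive ((fun s : R => f (s *: v + t)) 0) (1 : R) phi (dphi (f t)).
  by rewrite scale0r add0r.
have l3 := is_derive1_comp dpt' l1.
by rewrite -(@derive_val _ _ _ _ _ _ _ l2) -(@derive_val _ _ _ _ _ _ _ l3).
Unshelve. all: by end_near. Qed.

Lemma C1at_sum (I : Type) (s : seq I) (f : I -> V -> R) x :
  (forall i, C1at (f i) x) -> C1at (fun t => \sum_(i <- s) f i t) x.
Proof.
move=> Cf; elim: s => [|i s IH].
  by under eq_fun do rewrite big_nil; exact: C1at_cst.
by under eq_fun do rewrite big_cons; exact: C1atD.
Qed.

End ContinuouslyDifferentiable.

Section Gradient.
Variable R : realType.

Lemma derive_delta n (f : 'cV[R]_n -> R) x v : differentiable f x ->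
  'D_v f x = \sum_c 'D_(delta_mx c ord0) f x * v c ord0.
Proof.
move=> df; rewrite deriveE // [in LHS](_ : v = \sum_c v c ord0 *: delta_mx c ord0).
  rewrite linear_sum; apply: eq_bigr => c _.
  by rewrite linearZ /= -deriveE // mulrC.
apply/colP => i; rewrite summxE (bigD1 i) //= big1 ?addr0 => [|c /negbTE ci].
  by rewrite !mxE !eqxx mulr1.
by rewrite !mxE eq_sym ci mulr0.
Qed.

Lemma C1at_coord n (i : 'I_n) x : C1at (fun t : 'cV[R]_n => t i ord0) x.
Proof.
have dc (t : 'cV[R]_n) : differentiable (fun t : 'cV[R]_n => t i ord0) t.
  exact: differentiable_coord.
split=> [|v]; first by apply: (@filterE _ (nbhs x)) => t; exact: dc.
have -> : (fun t => 'D_v (fun t : 'cV[R]_n => t i ord0) t) = cst (v i ord0).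
  apply/funext => t; have l1 := is_derive_line v (dc t).
  have l2 : is_derive (0 : R) (1 : R) (fun s : R => (s *: v + t) i ord0) (v i ord0).
    have -> : (fun s : R => (s *: v + t) i ord0) = (v i ord0 \*: id) + cst (t i ord0).
      by apply/funext => s; rewrite !mxE /= mulrC.
    by apply: is_derive_eq; rewrite /GRing.scale /= addr0 mulr1.
  by rewrite -(@derive_val _ _ _ _ _ _ _ l1) -(@derive_val _ _ _ _ _ _ _ l2).
exact: cst_continuous.
Qed.

End Gradient.

(** * Positivity and smoothness of the cell probabilities *)

Section StepStress.
Variables (R : realType) (k L : nat) (x tau t : nat -> R).
Hypothesis k_gt0 : (0 < k)%N.
Hypothesis tau0 : tau 0%N = 0.
Hypothesis tau_lt : forall i, (i < k)%N -> tau i < tau i.+1.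
Hypothesis t0 : t 0%N = 0.
Hypothesis tL : t L = tau k.
Hypothesis t_lt : forall j, (j < L)%N -> t j < t j.+1.
Implicit Types (th : 'cV[R]_3) (s : R).

Let tau_le i j : (i <= j)%N -> (j <= k)%N -> tau i <= tau j.
Proof.
move=> ij; rewrite -(subnKC ij); elim: (j - i)%N => [|n IH]; first by rewrite addn0.
rewrite addnS => ink; apply: (le_trans (IH (ltnW ink))).
exact/ltW/tau_lt.
Qed.

Let t_le i j : (i <= j)%N -> (j <= L)%N -> t i <= t j.
Proof.
move=> ij; rewrite -(subnKC ij); elim: (j - i)%N => [|n IH]; first by rewrite addn0.
rewrite addnS => ink; apply: (le_trans (IH (ltnW ink))).
exact/ltW/t_lt.
Qed.

(** The last stage is closed at [tau k], where [stage] takes its default value [k]; this is why the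
    strict upper bound is conditional. *)
Lemma stageP s : 0 <= s -> s <= tau k ->
  exists2 i, stage k tau s = i.+1 &
    [/\ (i < k)%N, tau i <= s, s <= tau i.+1 & s < tau k -> s < tau i.+1].
Proof.
move=> s0 sk; rewrite /stage.
(* The search is generalised to a suffix of the stage list, with the invariant that all change times
   up to [tau a] have passed. *)
have gen n a : (a.+1 + n)%N = k -> tau a <= s ->
  exists2 i, head k [seq i <- iota a.+1 n | s < tau i] = i.+1 &
    [/\ (i < k)%N, tau i <= s, s <= tau i.+1 & s < tau k -> s < tau i.+1].
  elim: n a => [|n IH] a /=.
    by rewrite addn0 => ak sa; exists a => //=; rewrite ak; split.
  move=> ank sa; case: ifP => [sta|/negbT].
    by exists a => //; split=> //; [lia|exact: ltW].
  by rewrite -leNgt => tas; apply: IH => //; lia.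
by apply: gen; rewrite ?tau0 ?add1n ?prednK.
Qed.

Definition exposure_length s (l : nat) : R :=
  Num.max 0 (Num.min s (tau l.+1) - tau l).

(* Closed form of [(s + h_(i-1)) / lambda_i], valid across all stages: the time
   spent at each stress up to [s], in units of the corresponding scale. *)
Definition exposure th s : R :=
  \sum_(l < k) exposure_length s l * expR (- (a0 th + a1 th * x l.+1)).

Let lam_gt0 th i : 0 < lam x th i. Proof. exact: expR_gt0. Qed.

(** The continuity condition defining the shift says that the standardised age is the same on both
    sides of a stress change, so each finished stage just adds its duration over its own scale. *)
Let shiftE th n : (tau n + Defs.shift x tau th n) / lam x th n.+1 =
  \sum_(l < n) (tau l.+1 - tau l) / lam x th l.+1.
Proof.
elim: n => [|n IH]; first by rewrite big_ord0 /= tau0 addr0 mul0r.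
rewrite big_ord_recr /= -IH; field.
by rewrite !lt0r_neq0.
Qed.

Lemma exposureE th s : 0 <= s -> s <= tau k ->
  (s + Defs.shift x tau th (stage k tau s).-1) / lam x th (stage k tau s) = exposure th s.
Proof.
move=> s0 sk; have [i -> [ik si si1 _]] := stageP s0 sk => /=.
have -> : s + Defs.shift x tau th i = (tau i + Defs.shift x tau th i) + (s - tau i) by ring.
rewrite mulrDl shiftE /exposure.
rewrite -(big_mkord xpredT (fun l => exposure_length s l * expR (- (a0 th + a1 th * x l.+1)))).
(* Stages after the current one contribute nothing, earlier ones their full length, and the current
   one s - tau i. *)
rewrite (@big_cat_nat _ _ _ i.+1) //= [X in _ = _ + X]big1_seq ?addr0; last first.
  move=> l; rewrite mem_index_iota => /andP[_ /andP[il lk]].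
  rewrite /exposure_length max_l ?mul0r // subr_le0.
  have h1 : tau i.+1 <= tau l by apply: tau_le => //; exact: ltnW.
  by rewrite ge_min (le_trans si1).
rewrite big_nat_recr //= big_mkord; congr (_ + _).
  apply: eq_bigr => l _; rewrite -expRN; congr (_ * _).
  have h1 : tau l.+1 <= tau i by apply: tau_le => //; exact: ltnW.
  have h2 : tau l <= tau l.+1 by apply/ltW/tau_lt; exact: ltn_trans ik.
  by rewrite /exposure_length min_r ?(le_trans h1) // max_r // subr_ge0.
by rewrite -expRN; congr (_ * _); rewrite /exposure_length min_l // max_r // subr_ge0.
Qed.

Lemma cdfT_exposure th s : 0 <= s -> s <= tau k ->
  cdfT k x tau th s = 1 - expR (- powR (exposure th s) (Defs.eta th)).
Proof. by move=> s0 sk; rewrite /cdfT exposureE. Qed.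

Lemma exposure0 th : exposure th 0 = 0.
Proof.
rewrite /exposure big1 // => l _; rewrite /exposure_length max_l ?mul0r //.
rewrite subr_le0 ge_min -tau0 (tau_le (leq0n l)) //.
exact: ltnW.
Qed.

(** No stage loses exposure, and the stage running at time [s] gains strictly. *)
Lemma exposure_lt th s s' : 0 <= s -> s < s' -> s' <= tau k ->
  exposure th s < exposure th s'.
Proof.
move=> s0 ss' s'k; have sk := lt_le_trans ss' s'k.
have [i _ [ik si _ si1]] := stageP s0 (ltW sk).
have mono l : exposure_length s l <= exposure_length s' l.
  rewrite /exposure_length ge_max le_max lexx /= le_max; apply/orP; right.
  by rewrite lerD2r le_min ge_min (ltW ss') /= ge_min lexx orbT.
rewrite /exposure (bigD1 (Ordinal ik)) //= [ltRHS](bigD1 (Ordinal ik)) //=.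
apply: ltr_leD; last first.
  by apply: ler_sum => l _; rewrite ler_wpM2r // expR_ge0.
rewrite ltr_pM2r ?expR_gt0 //.
have {}si1 := si1 sk.
rewrite /exposure_length min_l ?(ltW si1) // max_r ?subr_ge0 //.
by rewrite lt_max ltrD2r lt_min ss' si1 orbT.
Qed.

Lemma exposure_gt0 th s : 0 < s -> s <= tau k -> 0 < exposure th s.
Proof. by move=> s0 sk; rewrite -(exposure0 th); apply: exposure_lt. Qed.

Let t_ge0 j : (j <= L)%N -> 0 <= t j.
Proof. by move=> jL; rewrite -t0; exact: t_le. Qed.

Let t_lek j : (j <= L)%N -> t j <= tau k.
Proof. by move=> jL; rewrite -tL; exact: t_le. Qed.

Lemma piv_gt0 th j : inTheta th -> 0 < piv k L x tau t th j ord0.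
Proof.
move=> [_ eta0]; rewrite mxE; case: ifP => jL.
  rewrite !cdfT_exposure ?t_ge0 ?t_lek //; [|exact: ltnW|exact: ltnW].
  rewrite subr_gt0 ltrD2l ltrN2 ltr_expR ltrN2.
  have h1 := exposure_lt th (t_ge0 (ltnW jL)) (t_lt jL) (t_lek jL).
  have h0 : 0 <= exposure th (t j).
    have := t_ge0 (ltnW jL); rewrite le_eqVlt => /predU1P[<-|tj].
      by rewrite exposure0.
    by apply/ltW/exposure_gt0 => //; exact/t_lek/ltnW.
  by apply: gt0_ltr_powR => //; rewrite nnegrE // (le_trans h0) // ltW.
by rewrite /cdfT subKr expR_gt0.
Qed.

Lemma cdfT0 th : inTheta th -> cdfT k x tau th 0 = 0.
Proof.
move=> [_ eta0]; rewrite cdfT_exposure //; last by rewrite -tau0 tau_le.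
by rewrite exposure0 powR0 ?gt_eqF // oppr0 expR0 subrr.
Qed.

Lemma piv_simplex th : inTheta th -> simplex (piv k L x tau t th).
Proof.
move=> hth; split=> [j|]; first exact/ltW/piv_gt0.
rewrite big_ord_recr /= mxE ltnn.
rewrite (eq_bigr (fun j : 'I_L => cdfT k x tau th (t j.+1) - cdfT k x tau th (t j))).
  rewrite -(big_mkord xpredT (fun j => cdfT k x tau th (t j.+1) - cdfT k x tau th (t j))).
  by rewrite telescope_sumr // t0 cdfT0 // subr0 addrC subrK.
by move=> j _; rewrite mxE /= ltn_ord.
Qed.

Lemma inTheta_near th : inTheta th -> exists2 rho : R, 0 < rho &
  forall th', `|th' - th| <= rho -> inTheta th'.
Proof.
move=> [a10 eta0]; exists (Num.min (- a1 th / 2) (Defs.eta th / 2)).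
  by rewrite lt_min !divr_gt0 // oppr_gt0.
move=> th'; rewrite le_min => /andP[h1 h2].
have c1 := le_trans (mx_coord_le (th' - th) i1 ord0) h1.
have c2 := le_trans (mx_coord_le (th' - th) i2 ord0) h2.
move: c1 c2; rewrite !mxE -/(a1 th') -/(a1 th) -/(Defs.eta th') -/(Defs.eta th) !ler_norml.
by move=> /andP[? ?] /andP[? ?]; split; lra.
Qed.

Lemma nbhs_inTheta th : inTheta th -> \forall th' \near th, inTheta th'.
Proof.
move=> /inTheta_near[rho rho0 h].
apply/(@nbhs_normP _ _ th); exists rho => //= u; rewrite /= distrC => /ltW; exact: h.
Qed.

Let C1at_expR (f : 'cV[R]_3 -> R) th : C1at f th -> C1at (fun u => expR (f u)) th.
Proof.
move=> Cf; apply: (@C1at_comp _ _ expR expR) => //; last exact: continuous_expR.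
by apply: (@filterE _ (nbhs (f th))) => s; exact: is_derive_expR.
Qed.

Let C1at_exposure th s : C1at (fun u => exposure u s) th.
Proof.
apply: C1at_sum => l; apply: C1atM; first exact: C1at_cst.
apply: C1at_expR.
have -> : (fun u : 'cV[R]_3 => - (a0 u + a1 u * x l.+1)) =
    fun u => (-1) * (u i0 ord0 + u i1 ord0 * x l.+1).
  by apply/funext => u; rewrite mulN1r.
apply: C1atM; first exact: C1at_cst.
apply: C1atD; first exact: C1at_coord.
by apply: C1atM; [exact: C1at_coord|exact: C1at_cst].
Qed.

Let C1at_cdfT th s : inTheta th -> 0 <= s -> s <= tau k ->
  C1at (fun u => cdfT k x tau u s) th.
Proof.
move=> hth; rewrite le_eqVlt => /predU1P[<- _|s0 sk].
  (* At time 0 the exposure is 0 and the logarithmic form below fails; there the distribution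
     function is constantly 0 for all parameters near [th]. *)
  apply: (@C1at_near _ _ (cst 0)); last exact: C1at_cst.
  by apply: filterS (nbhs_inTheta hth) => u hu; rewrite cdfT0.
have -> : (fun u => cdfT k x tau u s) =
    fun u => 1 + (-1) * expR ((-1) * expR (Defs.eta u * ln (exposure u s))).
  apply/funext => u; rewrite (cdfT_exposure u (ltW s0) sk) !mulN1r; congr (1 - expR (- _)).
  by rewrite /powR gt_eqF // exposure_gt0.
apply: C1atD; first exact: C1at_cst.
apply: C1atM; first exact: C1at_cst.
apply: C1at_expR; apply: C1atM; first exact: C1at_cst.
apply: C1at_expR; apply: C1atM; first exact: C1at_coord.
have u0 := exposure_gt0 th s0 sk.
apply: (@C1at_comp R _ (@ln R) (fun s => s^-1) (fun u => exposure u s) th); first exact: C1at_exposure.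
  near=> z; apply: is_derive1_ln; near: z; exact: lt_nbhsr.
by apply: cvgV; [rewrite gt_eqF|exact: cvg_id].
Unshelve. all: by end_near. Qed.

Lemma C1at_piv th j : inTheta th -> C1at (fun u => piv k L x tau t u j ord0) th.
Proof.
move=> hth.
have Cs (f g : 'cV[R]_3 -> R) : C1at f th -> C1at g th -> C1at (fun u => f u - g u) th.
  move=> Cf Cg; have -> : (fun u => f u - g u) = fun u => f u + (-1) * g u.
    by apply/funext => u; rewrite mulN1r.
  by apply: C1atD => //; apply: C1atM => //; exact: C1at_cst.
case: (ltnP j L) => jL.
  have -> : (fun u => piv k L x tau t u j ord0) =
      fun u => cdfT k x tau u (t j.+1) - cdfT k x tau u (t j).
    by apply/funext => u; rewrite mxE jL.
  have jL' := ltnW jL.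
  by apply: Cs; apply: C1at_cdfT; rewrite ?t_ge0 ?t_lek.
have -> : (fun u => piv k L x tau t u j ord0) = fun u => 1 - cdfT k x tau u (t L).
  by apply/funext => u; rewrite mxE ltnNge jL.
by apply: Cs; [exact: C1at_cst|apply: C1at_cdfT; rewrite ?t_ge0 ?t_lek].
Qed.

Lemma Wmat_continuous th : inTheta th -> {for th, continuous (Wmat k L x tau t)}.
Proof.
move=> hth; apply: mx_continuous => j c.
have [_ /(_ (delta_mx c ord0))] := C1at_piv j hth.
have -> // : (fun u => Wmat k L x tau t u j c) =
  (fun u => 'D_(delta_mx c ord0) (fun th' : 'cV[R]_3 => piv k L x tau t th' j ord0) u).
by apply/funext => u; rewrite mxE.
Qed.

Lemma Wmat_derive th j v : inTheta th ->
  'D_v (fun u => piv k L x tau t u j ord0) th = (Wmat k L x tau t th *m v) j ord0.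
Proof.
move=> hth; rewrite derive_delta; last exact: C1at_differentiable (C1at_piv j hth).
by rewrite mxE; apply: eq_bigr => c _; rewrite mxE.
Qed.

End StepStress.

(** * Square roots of positive semidefinite matrices *)

Section Cholesky.
Variable R : realType.

Definition psd n (S : 'M[R]_n) :=
  S^T = S /\ forall v : 'cV[R]_n, 0 <= (v^T *m S *m v) ord0 ord0.

Let quad_block n (a : 'M[R]_1) (b : 'cV[R]_n) (S : 'M[R]_n) (x : 'M[R]_1) y :
  ((col_mx x y)^T *m block_mx a b^T b S *m col_mx x y) ord0 ord0 =
  x ord0 ord0 ^+ 2 * a ord0 ord0 + 2 * x ord0 ord0 * (b^T *m y) ord0 ord0
  + (y^T *m S *m y) ord0 ord0.
Proof.
rewrite tr_col_mx mul_row_block mul_row_col !mulmxDl.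
have dD (u v : 'M[R]_1) : (u + v) ord0 ord0 = u ord0 ord0 + v ord0 ord0 by rewrite mxE.
have dM (u v : 'M[R]_1) : (u *m v) ord0 ord0 = u ord0 ord0 * v ord0 ord0.
  by rewrite mxE big_ord1.
have -> : y^T *m b *m x = (b^T *m y)^T *m x by rewrite trmx_mul trmxK.
have -> : x^T *m b^T *m y = x^T *m (b^T *m y) by rewrite mulmxA.
by rewrite !dD !dM ![(_^T) ord0 ord0]mxE; ring.
Qed.

Lemma Cholesky n (S : 'M[R]_n) : psd S -> exists A : 'M[R]_n, A *m A^T = S.
Proof.
elim: n S => [|n IH] S [Ssym Spos].
  by exists 0; apply/matrixP => -[].
pose S1 : 'M[R]_(1 + n) := S.
have [a [b [S' [SE S'sym]]]] : exists (a : 'M[R]_1) (b : 'cV[R]_n) (S' : 'M[R]_n),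
    S1 = block_mx a b^T b S' /\ S'^T = S'.
  exists (ulsubmx S1), (dlsubmx S1), (drsubmx S1).
  rewrite trmx_dlsub trmx_drsub (_ : S1^T = S1); last exact: Ssym.
  by rewrite submxK.
have q (x : 'M[R]_1) (y : 'cV[R]_n) : 0 <= x ord0 ord0 ^+ 2 * a ord0 ord0 + 2 * x ord0 ord0 *
    (b^T *m y) ord0 ord0 + (y^T *m S' *m y) ord0 ord0.
  by rewrite -quad_block -SE; exact: Spos.
pose al := a ord0 ord0.
have al0 : 0 <= al.
  have := q 1%:M 0; rewrite !mulmx0 !mxE eqxx /= expr1n mul1r mulr0 !addr0.
  exact.
(* With zero pivot the form is affine in [x]; a nonzero entry of [b] would let it reach the value
   -1. *)
have b0 : al = 0 -> b = 0.
  move=> alz; apply/colP => i; rewrite [RHS]mxE.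
  pose y : 'cV[R]_n := delta_mx i ord0.
  have by' : (b^T *m y) ord0 ord0 = b i ord0.
    rewrite mxE (bigD1 i) //= big1 => [|j /negbTE ji]; first by rewrite !mxE !eqxx mulr1 addr0.
    by rewrite !mxE ji mulr0.
  pose s := (y^T *m S' *m y) ord0 ord0.
  have h (x : R) : 0 <= 2 * x * b i ord0 + s.
    have := q x%:M y; rewrite -/al alz by' mulr0 add0r mxE eqxx mulr1n.
    exact.
  apply/eqP/negPn/negP => bi.
  have := h (- (s + 1) / (2 * b i ord0)).
  rewrite (_ : 2 * _ * _ = - (s + 1)); last by field.
  by lra.
(* The convention that 0 has inverse 0 gives c = 0 for a zero pivot, consistent with b = 0. *)
pose r := Num.sqrt al; pose c := r^-1 *: b.
have rr : r * r = al by rewrite -expr2 sqr_sqrtr.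
have rc : r *: c = b.
  rewrite /c scalerA; have [r0|r0] := eqVneq r 0.
    by rewrite r0 mul0r scale0r b0 // -rr r0 mul0r.
  by rewrite divff // scale1r.
have psd' : psd (S' - c *m c^T).
  split; first by rewrite linearB /= trmx_mul trmxK S'sym.
  move=> v; pose e := (c^T *m v) ord0 ord0.
  have bv : (b^T *m v) ord0 ord0 = r * e.
    by rewrite -rc linearZ /= -scalemxAl mxE.
  have cv : (v^T *m (c *m c^T) *m v) ord0 ord0 = e ^+ 2.
    have -> : v^T *m (c *m c^T) *m v = (c^T *m v)^T *m (c^T *m v).
      by rewrite trmx_mul trmxK !mulmxA.
    by rewrite mxE big_ord1 mxE expr2.
  rewrite mulmxBr mulmxBl mxE [X in _ + X]mxE cv.
  have [r0|r0] := eqVneq r 0.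
    have := q 0 v; rewrite mxE expr0n mulr0 !mul0r !add0r => h.
    have e0 : e = 0 by rewrite /e /c r0 invr0 scale0r trmx0 mul0mx mxE.
    by rewrite e0 expr0n subr0.
  (* This first coordinate minimises the form for fixed [v], and the minimum is the Schur complement
     at [v]. *)
  have := q (- e / r)%:M v; rewrite mxE eqxx mulr1n bv -/al -rr.
  rewrite (_ : (- e / r) ^+ 2 * (r * r) + 2 * (- e / r) * (r * e) = - e ^+ 2).
    by rewrite addrC.
  by field.
have [A' hA'] := IH _ psd'.
pose A1 : 'M[R]_(1 + n) := block_mx r%:M 0 c A'.
have h : A1 *m A1^T = S1.
  rewrite SE /A1 tr_block_mx mulmx_block.
  rewrite trmx0 !mul0mx !mulmx0 !addr0 hA' [X in block_mx _ _ _ X]addrC subrK tr_scalar_mx.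
  have -> : r%:M *m c^T = b^T by rewrite mul_scalar_mx -[in RHS]rc [in RHS]linearZ.
  have -> : c *m r%:M = b by rewrite mul_mx_scalar rc.
  congr block_mx; apply/matrixP => i j.
  by rewrite -scalar_mxM rr !ord1 mxE eqxx mulr1n /al.
by exists A1; exact: h.
Qed.

End Cholesky.

(** * From a first-order expansion to convergence in law *)

Section DeltaMethod.
Variables (R : realType) (L : nat).
Implicit Types (p : 'cV[R]_L.+1) (B : 'M[R]_(3, L.+1)) (A : 'M[R]_3).

Lemma covm_psd p B : simplex p -> psd (B *m covm p *m B^T).
Proof.
move=> sp; split.
  rewrite !trmx_mul trmxK /covm linearB /= trmx_mul trmxK tr_diag_mx.
  by rewrite mulmxA.
move=> v; have -> : v^T *m (B *m covm p *m B^T) *m v =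
    (B^T *m v)^T *m covm p *m (B^T *m v) by rewrite trmx_mul trmxK !mulmxA.
by rewrite dot_covm; exact: linear_variance_ge0.
Qed.

Lemma Prob_cvg0 p d (E : nat -> 'cV[R]_L.+1 -> Prop) : simplex p -> 0 < d ->
  (forall N y, E N y -> d <= `|y - p|) ->
  Prob N p (E N) @[N --> \oo] --> (0 : R).
Proof.
move=> sp d0 Ed; rewrite -cvg_shiftS.
apply: (@squeeze_cvgr _ _ _ _ (fun=> 0) (fun N => (d ^+ 2)^-1 * N.+1%:R^-1)).
- apply: nearW => N /=; rewrite Prob_ge0 //= -invfM.
  by apply: le_trans (Chebyshev_phat N sp d0); apply: ler_Prob => // y; exact: Ed.
- exact: cvg_cst.
- by rewrite -[X in _ --> X](mulr0 (d ^+ 2)^-1); apply: cvgMr; exact: cvg_harmonic.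
Qed.

(** Where |y - p| < s / sqrt N, the linear part stays in a fixed compact ball and the scaled error
    is below the modulus of continuity of [f]. The complement has probability at most 1 / s^2,
    whatever N. *)
Lemma delta_method p B A (f : 'cV[R]_3 -> R) M (T : 'cV[R]_L.+1 -> 'cV[R]_3) th0 :
  simplex p -> A *m A^T = B *m covm p *m B^T ->
  continuous f -> (forall y, `|f y| <= M) ->
  (forall e : R, 0 < e -> exists2 d : R, 0 < d & forall y, `|y - p| < d ->
     `|T y - th0 - B *m (y - p)| <= e * `|y - p|) ->
  Expect N p (fun y => f (Num.sqrt N%:R *: (T y - th0))) @[N --> \oo]
    --> gmean3 A f.
Proof.
move=> sp AB cf fM dT; have M0 : 0 <= M by apply: le_trans (fM 0).
have clt := multinomial_CLT sp AB cf fM.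
apply/cvgrPdist_lt => e e0.
have e2 : 0 < e / 2 by rewrite divr_gt0.
have e4 : 0 < e / 4 by rewrite divr_gt0.
have e8 : 0 < e / 8 by rewrite divr_gt0.
pose s := Num.sqrt (2 * M / (e / 8)) + 1.
have s0 : 0 < s by rewrite ltr_wpDl // sqrtr_ge0.
have sM : 2 * M / s ^+ 2 <= e / 8.
  rewrite ler_pdivrMr ?exprn_gt0 // [leRHS]mulrC -ler_pdivrMr //.
  have h : 0 <= 2 * M / (e / 8) by rewrite divr_ge0 ?mulr_ge0 // ltW.
  rewrite -{1}(sqr_sqrtr h) /s ler_pXn2r ?nnegrE ?sqrtr_ge0 ?addr_ge0 ?sqrtr_ge0 //.
  by rewrite lerDl.
pose c := L.+1%:R * `|B| + 1.
have c0 : 0 < c by rewrite ltr_wpDl // mulr_ge0.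
have Bc (y : 'cV[R]_L.+1) : `|B *m y| <= c * `|y|.
  by apply: (le_trans (mulmx_norm_le B y)); rewrite ler_wpM2r // lerDl.
have [du du0 hdu] := compact_unif_continuous
  (@cV_closed_ball_compact R 3 0 (c * s)) cf e8.
(* Multiplied by |y - p| < s / r and by the scaling [r], this relative error is at most du / 2. *)
have ez : 0 < du / (2 * s) by rewrite divr_gt0 // mulr_gt0.
have [d d0 hd] := dT _ ez.
have /cvgrPdist_lt/(_ _ e2) hclt := clt.
have hs : \forall N \near \oo, `|0 - s / Num.sqrt N%:R| < d.
  have : s / Num.sqrt N%:R @[N --> \oo] --> (0 : R).
    by rewrite -cvg_shiftS; exact: cvg_inv_sqrt.
  by move=> /cvgrPdist_lt/(_ _ d0).
near=> N.
have N0 : (0 < N)%N by near: N; exact: nbhs_infty_gt.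
have hN : `|gmean3 A f - Expect N p (fun y => f (Num.sqrt N%:R *: (B *m (y - p))))| < e / 2.
  by near: N.
have hsN : `|0 - s / Num.sqrt N%:R| < d by near: N.
move: hN hsN; rewrite -(prednK N0); move: N.-1 => j hN hsN.
set r := Num.sqrt j.+1%:R in hN hsN *.
have r0 : 0 < r by rewrite sqrtr_gt0.
have r2 : r ^+ 2 = j.+1%:R by rewrite sqr_sqrtr.
have sr0 : 0 < s / r by rewrite divr_gt0.
have {}hsN : s / r < d by move: hsN; rewrite sub0r normrN gtr0_norm.
set E1 := Expect _ _ _ in hN; set E2 := Expect _ _ _.
have h12 : `|E1 - E2| <= e / 8 + 2 * M / s ^+ 2.
  apply: (@le_trans _ _ (Expect j.+1 p (fun y => e / 8 + 2 * M *
      (`[< s / r <= `|y - p| >])%:R))); last first.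
    rewrite (ExpectD _ _ (fun=> e / 8)) (ExpectZ _ _ (2 * M)) Expect_cst // lerD2l.
    rewrite ler_wpM2l ?mulr_ge0 // -ProbE.
    apply: (le_trans (Chebyshev_phat _ sp sr0)).
    rewrite -r2 le_eqVlt; apply/orP; left; apply/eqP; field.
    by rewrite !lt0r_neq0.
  apply: ler_norm_ExpectB => // y; case: asboolP => [_|/negP].
    rewrite mulr1; apply: (le_trans (ler_normB _ _)).
    have := fM (r *: (B *m (y - p))); have := fM (r *: (T y - th0)).
    by move: (`|f _|) (`|f _|) => u v; lra.
  rewrite -ltNge mulr0 addr0 => ys; apply: hdu.
    rewrite /= subr0 normrZ (gtr0_norm r0).
    apply: (@le_trans _ _ (r * (c * (s / r)))).
      rewrite ler_wpM2l ?(ltW r0) //; apply: (le_trans (Bc _)).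
      by rewrite ler_wpM2l // ltW.
    by rewrite le_eqVlt; apply/orP; left; apply/eqP; field; exact: lt0r_neq0.
  rewrite -scalerBr normrZ (gtr0_norm r0) distrC.
  apply: (@le_lt_trans _ _ (r * (du / (2 * s) * (s / r)))).
    rewrite ler_wpM2l ?(ltW r0) //; apply: (le_trans (hd y (lt_trans ys hsN))).
    by rewrite ler_wpM2l // ltW.
  rewrite (_ : r * _ = du / 2); first by rewrite ltr_pdivrMr // ltr_pMr // ltr1n.
  by field; rewrite !lt0r_neq0.
have := ler_normD (gmean3 A f - E1) (E1 - E2); rewrite addrA subrK.
by clearbody E1 E2; move: sM hN h12; lra.
Unshelve. all: by end_near. Qed.

End DeltaMethod.

(** * Asymptotics of the estimator *)

Section DensityPower.
Variables (R : realType) (beta : R).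
Hypothesis beta_ge0 : 0 <= beta.

Definition dp_weight (s : R) : R := powR s (beta - 1).

(** Both branches are primitives of s^(beta-1); the case split merges the Kullback-Leibler and
    density power divergences. *)
Definition dp_log (s : R) : R := if beta == 0 then ln s else powR s beta / beta.

Definition dp_energy (s : R) : R := powR s (1 + beta) / (1 + beta).

Lemma dp_weight_gt0 (s : R) : 0 < s -> 0 < dp_weight s.
Proof. exact: powR_gt0. Qed.

Lemma dp_weight_continuous (s : R) : 0 < s -> {for s, continuous dp_weight}.
Proof.
move=> s0; apply/differentiable_continuous/derivable1_diffP.
by apply: derivable_powR; rewrite in_itv /= s0.
Qed.

Lemma is_derive_dp_log (s : R) : 0 < s -> is_derive s (1 : R) dp_log (dp_weight s).
Proof.
move=> s0; rewrite /dp_log /dp_weight; have [->|b0] := eqVneq beta 0.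
  by rewrite sub0r powR_inv1 ?ltW //; exact: is_derive1_ln.
have d := is_derive1_powR beta s0.
have -> : (fun s : R => powR s beta / beta) = beta^-1 \*: (@powR R ^~ beta).
  by apply/funext => u /=; rewrite mulrC.
by apply: is_derive_eq; rewrite /GRing.scale /= mulKf.
Qed.

Lemma is_derive_dp_energy (s : R) : 0 < s ->
  is_derive s (1 : R) dp_energy (s * dp_weight s).
Proof.
move=> s0; have d := is_derive1_powR (1 + beta) s0.
have b1 : 1 + beta != 0 by rewrite gt_eqF // ltr_pwDl.
have -> : dp_energy = (1 + beta)^-1 \*: (@powR R ^~ (1 + beta)).
  by apply/funext => u; rewrite /dp_energy /= mulrC.
apply: is_derive_eq; rewrite /GRing.scale /= mulKf // /dp_weight.
rewrite -{2}(powRr1 (ltW s0)) -powRD; last by rewrite (gt_eqF s0) implybT.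
by congr powR; ring.
Qed.

(** Exponents add: 2 (beta - 1) + 1 on the diagonal, and (beta - 1) + 1 in the rank-one part. This
    is the inner matrix of K. *)
Lemma dp_covm n (p : 'cV[R]_n.+1) : (forall j, 0 < p j ord0) ->
  diag_mx (\row_j powR (p j ord0) (beta - 1)) *m covm p *m
  diag_mx (\row_j powR (p j ord0) (beta - 1)) =
  diag_mx (\row_j powR (p j ord0) (2 * beta - 1))
  - (\col_j powR (p j ord0) beta) *m (\col_j powR (p j ord0) beta)^T.
Proof.
move=> p0; set D := diag_mx _.
have Dp : D *m p = \col_j powR (p j ord0) beta.
  apply/colP => j; rewrite mul_diag_mx !mxE.
  rewrite -[X in _ * X](powRr1 (ltW (p0 j))) -powRD; last by rewrite (gt_eqF (p0 j)) implybT.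
  by congr powR; ring.
rewrite /covm mulmxBr mulmxBl; congr (_ - _).
  rewrite !mulmx_diag; congr diag_mx; apply/rowP => j; rewrite !mxE.
  rewrite -[X in _ * X * _](powRr1 (ltW (p0 j))) -!powRD ?(gt_eqF (p0 j)) ?implybT //.
  by congr powR; ring.
rewrite mulmxA Dp -mulmxA; congr (_ *m _).
by rewrite -Dp trmx_mul tr_diag_mx.
Qed.

End DensityPower.

Theorem theorem2 (R : realType) (k L : nat) (x tau t : nat -> R) (r : nat)
    (m : 'cV[R]_3 -> 'cV[R]_r) (beta : R) (th0 : 'cV[R]_3) :
  (0 < k)%N ->
  (forall i, (1 <= i < k)%N -> x i < x i.+1) ->
  tau 0%N = 0 ->
  (forall i, (i < k)%N -> tau i < tau i.+1) ->
  t 0%N = 0 -> t L = tau k ->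
  (forall j, (j < L)%N -> t j < t j.+1) ->
  (forall i, (1 <= i <= k)%N -> exists2 j, (j <= L)%N & t j = tau i) ->
  (r <= 3)%N ->
  (forall th, inTheta th -> differentiable m th) ->
  (forall th, inTheta th -> {for th, continuous (Mmat m)}) ->
  (forall th, inTheta th -> \rank (Mmat m th) = r) ->
  0 <= beta ->
  inTheta th0 -> m th0 = 0 ->
  let pi0 := piv k L x tau t th0 in
  let W := Wmat k L x tau t th0 in
  let J := W^T *m Dpow k L x tau t th0 (beta - 1) *m W in
  let K := W^T *m (Dpow k L x tau t th0 (2 * beta - 1)
                   - pipow k L x tau t th0 beta *m (pipow k L x tau t th0 beta)^T)
              *m W in
  let M := Mmat m th0 in
  J \in unitmx -> (M^T *m invmx J *m M) \in unitmx ->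
  let Q := invmx J *m M *m invmx (M^T *m invmx J *m M) in
  let P := invmx J - Q *m M^T *m invmx J in
  let Sigma := P *m K *m P^T in
  exists T : nat -> 'cV[R]_(L.+1) -> 'cV[R]_3,
    ((fun N => Prob N pi0 (fun ph =>
        inTheta (T N ph) /\ m (T N ph) = 0 /\
        exists lam : 'cV[R]_r,
          (Wmat k L x tau t (T N ph))^T *m Dpow k L x tau t (T N ph) (beta - 1)
            *m (ph - piv k L x tau t (T N ph))
          + Mmat m (T N ph) *m lam = 0)) @ \oo --> (1 : R))
    /\ cvg_prob pi0 T th0
    /\ cvg_law_normal pi0 (fun N ph => Num.sqrt (N%:R) *: (T N ph - th0)) Sigma.
Proof.
move=> k0 _ tau0 tau_lt t0 tL t_lt _ _ dm cM _ beta0 hth0 mth0 pi0 W J K M Ju MJMu Q P Sigma.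
have [rho rho0 hrho] := inTheta_near hth0.
have dmi th : inTheta th -> forall i : 'I_r, differentiable (fun u => m u i ord0) th.
  move=> hth i; apply: (@differentiable_comp _ _ _ _ m (fun v : 'cV[R]_r => v i ord0)).
    exact: dm.
  exact: differentiable_coord.
have sp : simplex pi0 by exact: piv_simplex.
have ppos th j : inTheta th -> 0 < piv k L x tau t th j ord0 by move=> h; exact: piv_gt0.
have C1p th j : inTheta th -> C1at (fun u => piv k L x tau t u j ord0) th.
  by move=> h; exact: C1at_piv.
have H1 th : `|th - th0| <= rho -> forall j : 'I_L.+1,
    differentiable (fun u => piv k L x tau t u j ord0) th.
  by move=> /hrho h j; exact: C1at_differentiable (C1p th j h).
have H2 th : `|th - th0| <= rho -> forall (j : 'I_L.+1) v,
    'D_v (fun u => piv k L x tau t u j ord0) th = (Wmat k L x tau t th *m v) j ord0.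
  by move=> /hrho h j v; exact: Wmat_derive.
have H3 th : `|th - th0| <= rho -> {for th, continuous (Wmat k L x tau t)}.
  by move=> /hrho h; exact: Wmat_continuous.
have H4 th : `|th - th0| <= rho -> forall i : 'I_r,
    differentiable (fun u => m u i ord0) th.
  by move=> /hrho h; exact: dmi.
have H5 th : `|th - th0| <= rho -> forall (i : 'I_r) v,
    'D_v (fun u => m u i ord0) th = ((Mmat m th)^T *m v) i ord0.
  move=> /hrho h i v; rewrite derive_delta; last exact: dmi.
  by rewrite mxE; apply: eq_bigr => c _; rewrite !mxE.
have H6 th : `|th - th0| <= rho -> {for th, continuous (Mmat m)}.
  by move=> /hrho; exact: cM.
have H7 th : `|th - th0| <= rho -> forall j : 'I_L.+1, 0 < piv k L x tau t th j ord0.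
  by move=> /hrho h j; exact: ppos.
have [C [b [d [C0 b0 [d0 root]]]]] := constrained_root rho0 H1 H2 H3 H4 H5 H6 H7
  (@is_derive_dp_log R beta) (@is_derive_dp_energy R beta beta0)
  (@dp_weight_gt0 R beta) (@dp_weight_continuous R beta) mth0 Ju MJMu.
(* Away from pi(th0) the property is void and [T] is unconstrained; only the vanishing probability
   of that region matters. *)
have /choice[T hT] : forall p : 'cV[R]_L.+1, exists th, `|p - pi0| < d ->
    exists lam : 'cV[R]_r, [/\ `|th - th0| <= C * `|p - pi0|,
      `|th - th0| <= rho, m th = 0, `|lam| <= b * `|Mmat m th *m lam| &
      weighted_score (piv k L x tau t) (Wmat k L x tau t) (dp_weight beta) th
        *m (p - piv k L x tau t th) + Mmat m th *m lam = 0].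
  move=> p; have [pd|pd] := ltP `|p - pi0| d; last by exists th0.
  by have [th [lam h]] := root p pd; exists th => _; exists lam.
exists (fun _ => T); split; [|split].
- have h : Prob N pi0 (fun y => ~ (inTheta (T y) /\ m (T y) = 0 /\
      exists lam : 'cV[R]_r,
          (Wmat k L x tau t (T y))^T *m Dpow k L x tau t (T y) (beta - 1)
            *m (y - piv k L x tau t (T y)) + Mmat m (T y) *m lam = 0)) @[N --> \oo]
      --> (0 : R).
    apply: (Prob_cvg0 sp d0) => N y; rewrite leNgt => ny; apply/negP => yd; apply: ny.
    have [lam [_ Trho mT _ eqT]] := hT y yd.
    by split; [exact: hrho|split=> //; exists lam].
  rewrite -[X in _ --> X](subr0 (1 : R)).
  have -> : (fun N => Prob N pi0 (fun ph => inTheta (T ph) /\ m (T ph) = 0 /\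
        exists lam : 'cV[R]_r,
          (Wmat k L x tau t (T ph))^T *m Dpow k L x tau t (T ph) (beta - 1)
            *m (ph - piv k L x tau t (T ph)) + Mmat m (T ph) *m lam = 0)) =
    (fun N => 1 - Prob N pi0 (fun y => ~ (inTheta (T y) /\ m (T y) = 0 /\
      exists lam : 'cV[R]_r,
          (Wmat k L x tau t (T y))^T *m Dpow k L x tau t (T y) (beta - 1)
            *m (y - piv k L x tau t (T y)) + Mmat m (T y) *m lam = 0))).
    by apply/funext => N; exact: ProbC.
  by apply: cvgB => //; exact: cvg_cst.
(* Within [d] the root exists, and within eps / C its distance to [th0] stays below eps. *)
- move=> eps eps0; have de : 0 < Num.min d (eps / C) by rewrite lt_min d0 divr_gt0.
  apply: (Prob_cvg0 sp de) => N y eT; rewrite leNgt; apply/negP.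
  rewrite lt_min ltr_pdivlMr // => /andP[yd yC].
  have [lam [hC _ _ _ _]] := hT y yd.
  by have := lt_le_trans eT hC; rewrite mulrC ltNge (ltW yC).
(* [B] is the derivative of the estimator at pi(th0), so Sigma is the covariance of one draw
   transported by [B]. *)
- pose B := P *m weighted_score (piv k L x tau t) (Wmat k L x tau t) (dp_weight beta) th0.
  have SB : Sigma = B *m covm pi0 *m B^T.
    rewrite /Sigma /K -(dp_covm beta (fun j => ppos th0 j hth0)) /B /weighted_score.
    by rewrite !trmx_mul trmxK tr_diag_mx !mulmxA.
  have [A hA] := Cholesky (covm_psd B sp).
  exists A; split; first by rewrite SB.
  move=> f cf [Bf hf]; rewrite (std_gauss_expectE A cf hf).
  apply: cvg_EFin; first exact: nearW.
  apply: (delta_method sp hA cf hf) => e e0.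
  have [d' d'0 hd'] := root_expansion rho0 H1 H2 H3 H4 H5 H6 H7
    (@dp_weight_continuous R beta) mth0 Ju MJMu C0 b0 e0.
  exists (Num.min d d'); first by rewrite lt_min d0.
  move=> y; rewrite lt_min => /andP[yd yd'].
  by have [lam [hC _ mT hl eqT]] := hT y yd; exact: hd' yd' hC mT hl eqT.
Qed.
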